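(* For $\beta>\beta_c$, the normalized Gibbs weights $$\big(G_{\beta,N}(\sigma),\ \sigma\in\Sigma_N\big)_\downarrow$$ ordered in decreasing order converge in law, as $N\to\infty$, to a Poisson-Dirichlet variable with parameter $\beta_c/\beta$.
   Context: For $N\in\mathbb{N}$ let $\Sigma_N=\{-1,+1\}^N$. On a probability space $(\Omega,\mathcal{F},\mathbb{P})$ with expectation $\mathbb{E}$ are defined: for each $N$, a family $X_N=(X_N(\sigma),\sigma\in\Sigma_N)$ of i.i.d. centered Gaussian random variables of variance $N$; and a sequence $\vec h=(h_i,i\in\mathbb{N})$ of i.i.d. real random variables independent of the $X_N$'s, with $\mathbb{E}[\exp(t h_1)]<\infty$ for all $t\in\mathbb{R}$. The Hamiltonian is $$H_N(\sigma)=X_N(\sigma)+Y_N(\sigma),\qquad Y_N(\sigma)=\sum_{i=1}^N h_i\sigma_i,\qquad \sigma\in\Sigma_N.$$ The number $\beta_c$ is given by the self-consistency equation $$\beta_c=\sqrt{2\Big(\log 2-\big(\beta_c\,\mathbb{E}[h_1\tanh \beta_c h_1]-\mathbb{E}[\log\cosh\beta_c h_1]\big)\Big)}.$$ The Gibbs weights are $G_{\beta,N}(\sigma)=e^{\beta H_N(\sigma)}/Z_N(\beta)$ with $Z_N(\beta)=\sum_{\sigma\in\Sigma_N}e^{\beta H_N(\sigma)}$. The symbol $(\cdot)_\downarrow$ denotes rearrangement in decreasing order; finite sequences are extended by zeros. Convergence in law is that of random elements (under $\mathbb{P}$) of the compact space of mass partitions $\mathcal{S}=\{\vec p=(p_i,i\in\mathbb{N}):1\ge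 p_1\ge p_2\ge\dots\ge0,\ \sum_ip_i\le1\}$ with metric $d(\vec p,\vec p')=\sum_{n\ge1}2^{-n}|p_n-p_n'|$. A Poisson-Dirichlet variable with parameter $\beta_c/\beta\in(0,1)$ is a random sequence $\xi=(\xi_i,i\in\mathbb{N})$ with $\xi_1>\xi_2>\dots>0$, $\sum_i\xi_i=1$, having the same law as $\left(\frac{\exp\beta\eta_i}{\sum_j\exp\beta\eta_j},\ i\in\mathbb{N}\right)_\downarrow$, where $\eta=(\eta_i)$ are the points of a Poisson process on $\mathbb{R}$ with intensity $Ce^{-\beta_c y}\,dy$, $C>0$ a constant (the law does not depend on $C$). *)

(* Defs.v *)
From HB Require Import structures.
From mathcomp Require Import all_boot all_order all_algebra.
From mathcomp Require Import lra.
From mathcomp Require Import all_classical all_reals all_analysis.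
From mathcomp Require Import measurable_realfun.

Set Implicit Arguments.
Unset Strict Implicit.
Unset Printing Implicit Defensive.

Import Order.TTheory GRing.Theory Num.Def Num.Theory.
Import numFieldNormedType.Exports.

Local Open Scope classical_set_scope.
Local Open Scope ring_scope.

(* Indices start at 0: [p i] is the entry p_(i+1) of the partition. *)
Record mass_partition (R : realType) := MassPartition {
  mass :> nat -> R ;
  mass_le1 : mass 0%N <= 1 ;
  mass_ge0 : forall i, 0 <= mass i ;
  mass_noninc : nonincreasing_seq mass ;
  mass_sum_le1 : (\sum_(0 <= i <oo) (mass i)%:E <= 1)%E }.

Lemma mass_inj (R : realType) (p q : mass_partition R) :
  mass p = mass q -> p = q.
Proof.
case: p => p p1 p0 pn ps; case: q => q q1 q0 qn qs /= pq.
by subst q; congr MassPartition; exact: Prop_irrelevance.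
Qed.

HB.instance Definition _ (R : realType) := gen_eqMixin (mass_partition R).
HB.instance Definition _ (R : realType) := gen_choiceMixin (mass_partition R).

Section null_mass_partition.
Variable R : realType.

Let null_noninc : nonincreasing_seq (fun _ : nat => 0 : R).
Proof. by []. Qed.

Let null_sum : (\sum_(0 <= i <oo) ((fun _ : nat => 0 : R) i)%:E <= 1)%E.
Proof. by rewrite eseries0. Qed.

Definition null_mass_partition : mass_partition R :=
  MassPartition ler01 (fun=> lexx 0) null_noninc null_sum.

HB.instance Definition _ := isPointed.Build (mass_partition R)
  null_mass_partition.

End null_mass_partition.

Section mass_partition_metric.
Variable R : realType.
Implicit Types p q r : mass_partition R.

Let term p q : R ^nat := fun n => 2 ^- n.+1 * `|p n - q n|.

(* The weight of index n is 2^-(n+1), because of the shift of indices. *)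
Definition mass_dist p q : R :=
  limn (series (fun n => 2 ^- n.+1 * `|p n - q n|)).

Lemma mass_entry_le1 p i : p i <= 1.
Proof. exact: (le_trans (mass_noninc p (leq0n i)) (mass_le1 p)). Qed.

Let term_ge0 p q n : 0 <= term p q n.
Proof. by rewrite mulr_ge0// invr_ge0 exprn_ge0. Qed.

Lemma is_cvg_mass_dist p q :
  cvgn (series (fun n => 2 ^- n.+1 * `|p n - q n|)).
Proof.
apply: (@series_le_cvg _ _ (geometric 2^-1 2^-1)) => [n|n|n|].
- exact: term_ge0.
- by rewrite /geometric/= mulr_ge0// ?exprn_ge0.
- rewrite /geometric/= -exprS exprVn ler_piMr ?invr_ge0 ?exprn_ge0//.
  have := mass_ge0 p n; have := mass_ge0 q n.
  have := mass_entry_le1 p n; have := mass_entry_le1 q n.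
  by move=> ? ? ? ?; rewrite ler_norml; apply/andP; split; lra.
- by apply: is_cvg_geometric_series; rewrite ger0_norm// invf_lt1// ltr1n.
Qed.

Let mass_distxx p : mass_dist p p = 0.
Proof.
rewrite /mass_dist (_ : series _ = cst 0) ?lim_cst//.
apply/funext => n; rewrite /series/= big1// => i _.
by rewrite subrr normr0 mulr0.
Qed.

Let mass_dist_positivity p q : mass_dist p q = 0 -> p = q.
Proof.
move=> pq0; apply: mass_inj; apply/funext => n.
have hnd : {homo series (term p q) : n m / (n <= m)%N >-> n <= m}.
  by apply/nondecreasing_series => i _ _; exact: term_ge0.
have := nondecreasing_cvgn_le hnd (@is_cvg_mass_dist p q) n.+1.
rewrite [limn _]pq0 /series/= big_nat_recr//= => le0.
have : term p q n <= 0.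
  by apply: le_trans le0; rewrite lerDr sumr_ge0.
have := term_ge0 p q n => ge0 {}le0.
have /eqP : term p q n = 0 by apply/eqP; rewrite eq_le le0.
rewrite /term mulf_eq0 invr_eq0 expf_eq0/= pnatr_eq0/=.
by rewrite normr_eq0 subr_eq0 => /eqP.
Qed.

Let mass_dist_sym p q : mass_dist p q = mass_dist q p.
Proof.
rewrite /mass_dist; congr (limn (series _)).
by apply/funext => n; rewrite distrC.
Qed.

Let mass_dist_triangle q p r : mass_dist p r <= mass_dist p q + mass_dist q r.
Proof.
have cpq := @is_cvg_mass_dist p q; have cqr := @is_cvg_mass_dist q r.
rewrite /mass_dist -lim_seriesD//; apply: lim_series_le.
- exact: is_cvg_mass_dist.
- exact: is_cvg_seriesD.
- move=> n /=; rewrite -[leRHS]mulrDr ler_wpM2l ?invr_ge0 ?exprn_ge0//.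
  exact: ler_distD.
Qed.

HB.instance Definition _ := isMetric.Build R (mass_partition R)
  mass_distxx mass_dist_positivity mass_dist_sym mass_dist_triangle.

End mass_partition_metric.

Definition borel (S : ptopologicalType) := g_sigma_algebraType (@open S).

Definition random_element d (T : measurableType d) (S : ptopologicalType)
    (X : T -> S) :=
  measurable_fun setT (X : T -> borel S).

Definition same_law (R : realType) (S : ptopologicalType)
    d (T : measurableType d) (P : probability T R) (X : T -> S)
    d' (T' : measurableType d') (P' : probability T' R) (X' : T' -> S) :=
  forall A : set (borel S), measurable A -> P (X @^-1` A) = P' (X' @^-1` A).

Definition converges_in_law (R : realType) (S : ptopologicalType)
    d (T : measurableType d) (P : probability T R) (X : nat -> T -> S)
    d' (T' : measurableType d') (P' : probability T' R) (X' : T' -> S) :=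
  [/\ forall n, random_element (X n),
      random_element X' &
      forall f : S -> R, continuous f -> (exists M, forall s, `|f s| <= M) ->
        ('E_P[f \o X n])%E @[n --> \oo] --> ('E_P'[f \o X'])%E].

Definition mutually_independent (R : realType) d (T : measurableType d)
    (P : probability T R) d' (T' : measurableType d') (I : eqType)
    (X : I -> T -> T') :=
  forall (J : seq I) (B : I -> set T'), uniq J ->
    (forall i, measurable (B i)) ->
    P (\bigcap_(i in [set` J]) (X i @^-1` B i)) =
      (\prod_(i <- J) P (X i @^-1` B i))%E.

Definition generated_sigma_algebra d (T : measurableType d)
    d' (T' : measurableType d') I (X : I -> T -> T') : set (set T) :=
  <<s \bigcup_i preimage_set_system setT (X i) measurable >>.

Definition independent_families (R : realType) d (T : measurableType d)
    (P : probability T R) d' (T' : measurableType d') I J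
    (X : I -> T -> T') (Y : J -> T -> T') :=
  forall A B, generated_sigma_algebra X A -> generated_sigma_algebra Y B ->
    P (A `&` B) = (P A * P B)%E.

Definition point_count (R : realType) (eta : nat -> R) (A : set R) : \bar R :=
  (\sum_(0 <= i <oo) (\1_A (eta i))%:E)%E.

(* The random points eta i, counted with multiplicity, form a Poisson process
   on R with intensity measure mu. The library's poisson_pmf is not used since
   it equals 1 when its rate is 0. *)
Definition poisson_process (R : realType) d (T : measurableType d)
    (P : probability T R) (eta : nat -> {RV P >-> R}) (mu : set R -> \bar R) :=
  let N (A : set R) (w : T) := point_count (fun i => eta i w) A in
  [/\ forall (A : set R) (k : nat), measurable A -> (mu A < +oo)%E ->
        P (N A @^-1` [set k%:R%:E]) =
          (expR (- fine (mu A)) * fine (mu A) ^+ k / k`!%:R)%:E,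
      forall A : set R, measurable A -> mu A = +oo%E ->
        P (N A @^-1` [set +oo%E]) = 1%E &
      forall (n : nat) (A : 'I_n -> set R), (forall j, measurable (A j)) ->
        trivIset setT A ->
        mutually_independent P (fun j => N (A j))].

Definition exp_intensity (R : realType) (C b : R) (A : set R) : \bar R :=
  (\int[lebesgue_measure]_(y in A) (C * expR (- b * y))%:E)%E.

Definition decreasing_rearrangement (R : realType) (u v : nat -> R) :=
  nonincreasing_seq v /\
  exists2 s : nat -> nat, bijective s & forall i, v i = u (s i).

Definition normalized_exp (R : realType) (b : R) (eta : nat -> R) (i : nat) :=
  expR (b * eta i) / limn (series (fun j => expR (b * eta j))).

(* xi is a Poisson-Dirichlet variable with parameter beta_c / beta; its law
   depends on (beta_c, beta) only through this ratio, and not on C. The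
   variable zeta is the decreasing rearrangement of the normalized points; it
   may live on another probability space than xi. *)
Definition is_poisson_dirichlet (R : realType) (beta_c beta : R)
    d (T : measurableType d) (P : probability T R)
    (xi : T -> mass_partition R) :=
  [/\ random_element xi,
      {ae P, forall w, [/\ forall i, xi w i.+1 < xi w i,
        forall i, 0 < xi w i & series (xi w) @ \oo --> (1 : R)]} &
      exists (C : R) d' (T' : measurableType d') (P' : probability T' R)
          (eta : nat -> {RV P' >-> R}) (zeta : T' -> mass_partition R),
        [/\ 0 < C,
            poisson_process eta (exp_intensity C beta_c),
            random_element zeta,
            {ae P', forall w, decreasing_rearrangement
              (normalized_exp beta (fun i => eta i w)) (zeta w)} &
            same_law P xi P' zeta]].

(* The boolean b encodes the spin (-1)^b. *)
Definition spins (N : nat) := {ffun 'I_N -> bool}.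

(* [h i] is the field h_(i+1). *)
Definition hamiltonian (R : realType) (N : nat) (X : spins N -> R)
    (h : nat -> R) (sigma : spins N) : R :=
  X sigma + \sum_(i < N) h i * (-1) ^+ sigma i.

Definition partition_function (R : realType) (N : nat) (H : spins N -> R)
    (beta : R) : R :=
  \sum_(sigma : spins N) expR (beta * H sigma).

Definition gibbs_weight (R : realType) (N : nat) (H : spins N -> R)
    (beta : R) (sigma : spins N) : R :=
  expR (beta * H sigma) / partition_function H beta.

(* The Gibbs weights in decreasing order, extended by zeros. *)
Section ordered_gibbs_weights.
Variables (R : realType) (N : nat) (H : spins N -> R) (beta : R).

Definition sorted_weights : seq R :=
  sort >=%R [seq gibbs_weight H beta sigma | sigma <- enum {: spins N}].

Let w (i : nat) : R := nth 0 sorted_weights i.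

Lemma partition_function_gt0 : 0 < partition_function H beta.
Proof.
rewrite /partition_function (bigD1 [ffun=> false])//=.
by rewrite ltr_pwDl ?expR_gt0// sumr_ge0// => s _; exact: expR_ge0.
Qed.

Lemma gibbs_weight_ge0 sigma : 0 <= gibbs_weight H beta sigma.
Proof. by rewrite divr_ge0 ?expR_ge0// ltW// partition_function_gt0. Qed.

Lemma sum_gibbs_weight : \sum_sigma gibbs_weight H beta sigma = 1.
Proof. by rewrite -mulr_suml divff// gt_eqF// partition_function_gt0. Qed.

Let sorted_weights_ge0 x : x \in sorted_weights -> 0 <= x.
Proof. by rewrite mem_sort => /mapP[s _ ->]; exact: gibbs_weight_ge0. Qed.

Let w_ge0 i : 0 <= w i.
Proof.
rewrite /w; have [le_s|lt_s] := leqP (size sorted_weights) i.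
  by rewrite nth_default.
by apply: sorted_weights_ge0; exact: mem_nth.
Qed.

Let w_sum n : \sum_(0 <= i < n) w i <= 1.
Proof.
have -> : 1 = \sum_(0 <= i < size sorted_weights + n) w i :> R.
  rewrite (big_cat_nat (leq0n (size sorted_weights)))/= ?leq_addr//.
  rewrite [X in _ + X]big_nat_cond [X in _ + X]big1 => [|i]; last first.
    by rewrite andbT => /andP[le_s _]; rewrite /w nth_default.
  rewrite addr0 -(big_nth 0 xpredT id) (perm_big _ (permEl (perm_sort _ _)))/=.
  by rewrite big_map big_enum/= sum_gibbs_weight.
rewrite [leRHS](big_cat_nat (leq0n n))/= ?leq_addl// lerDl sumr_ge0//.
Qed.

Let w_noninc : nonincreasing_seq w.
Proof.
move=> i j ij; rewrite /w.
have [le_s|lt_s] := leqP (size sorted_weights) j.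
  by rewrite [leLHS]nth_default//; exact: w_ge0.
apply: (@sorted_leq_nth _ >=%R) => //.
- by move=> x y z xy yz; exact: le_trans yz xy.
- exact: lexx.
- by apply: sort_sorted; exact: ge_total.
- by rewrite inE; exact: leq_ltn_trans lt_s.
Qed.

Let w_le1 : w 0 <= 1.
Proof. by have := w_sum 1; rewrite big_nat1. Qed.

Let w_series : (\sum_(0 <= i <oo) (w i)%:E <= 1)%E.
Proof.
apply: lime_le; first by apply: is_cvg_nneseries => n _ _; rewrite lee_fin.
by apply: nearW => n; rewrite sumEFin lee_fin.
Qed.

Definition ordered_gibbs_weights : mass_partition R :=
  MassPartition w_le1 w_ge0 w_noninc w_series.

End ordered_gibbs_weights.

Definition cosh (R : realType) (x : R) : R := (expR x + expR (- x)) / 2.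

Definition sinh (R : realType) (x : R) : R := (expR x - expR (- x)) / 2.

Definition tanh (R : realType) (x : R) : R := sinh x / cosh x.

(* The equation has exactly one solution, which is positive: at
   beta_c = 0 the right-hand side is Num.sqrt (2 * ln 2). *)
Definition is_critical_beta (R : realType) d (T : measurableType d)
    (P : probability T R) (h1 : T -> R) (beta_c : R) :=
  beta_c = Num.sqrt (2 * (ln 2 -
    (beta_c * fine ('E_P[(fun w => h1 w * tanh (beta_c * h1 w))%R])%E
     - fine ('E_P[(fun w => ln (cosh (beta_c * h1 w)))%R])%E))).

(* Main.v *)
From HB Require Import structures.
Require Import Defs.
From mathcomp Require Import all_boot all_order all_algebra.
From mathcomp Require Import ring lra.
From mathcomp Require Import all_classical all_reals all_analysis.
From mathcomp Require Import measurable_realfun.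
Import Order.TTheory GRing.Theory Num.Theory.
Import numFieldNormedType.Exports.
Local Open Scope classical_set_scope.
Local Open Scope ring_scope.

Set Implicit Arguments.
Unset Strict Implicit.
Unset Printing Implicit Defensive.

(** Fix the field h. The energies are then independent Gaussian variables, and
    the expected number of configurations of energy near y has a density,
    [gibbs_intensity]. Tilting the sum over spins by exp (beta_c Y), where Y is
    the energy in the field, and completing the square shows that this density
    is C * exp (- beta_c y) up to a slowly varying factor of width sqrt N, when
    energies are measured from a suitable level a ([gibbs_intensity_profile],
    [gibbs_intensity_centered]). This works, with a within O (sqrt N) of
    N beta_c plus the tilted mean of Y, as soon as the sum of the [field_excess]
    of the h i is O (sqrt N) and the sum of their squares is O (N). The equation
    for beta_c says that the excess is centred, so that such good fields have
    probability close to 1 ([field_fluctuations]).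

    In a good field, each configuration has probability O (1 / sqrt N) to have
    its centred energy in a given bounded window, and the expected number of
    energies in the cells of a grid converges to the intensity of the Poisson
    process. By the method of Le Cam ([counts_law_poisson]) the numbers of
    energies in the cells converge to independent Poisson variables. Energies
    above the grid are rare, and since beta > beta_c those below it carry little
    of the partition function ([centred_energy_top_le],
    [centred_energy_remainder_le]).

    The ordered Gibbs weights and the ordered normalized exponentials of the
    Poisson points are both determined, up to a small distance, by the numbers of
    points above the levels of the grid, provided that the mass below the grid
    is small: the counts fix the raw weights up to the mesh, and the unknown
    normalization is recovered from the total mass ([coarse_close]). The
    expectation of a Lipschitz function of either partition is therefore close
    to the same finite sum over counts, with nearly the same weights
    ([poisson_side_by_counts], [array_side_by_counts]). This bypasses the
    convergence of point processes and the continuity of the map from points to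
    partitions.

    Averaging over the field uses the independence of the two families
    ([independent_fubini]), and convergence for Lipschitz functions suffices for
    convergence in law ([lipschitz_converges_in_law]). *)

(** * The Borel sets of the space of mass partitions *)

Lemma measurable_set_lt (R : realType) d (T : measurableType d) (g : T -> R)
    (r : R) : measurable_fun setT g -> measurable [set w | g w < r].
Proof.
move=> mg; rewrite (_ : [set _ | _] = setT `&` g @^-1` `]-oo, r[%classic).
  by apply: mg.
by rewrite setTI; apply/seteqP; split => w /=; rewrite in_itv.
Qed.

Lemma measurable_set_gt (R : realType) d (T : measurableType d) (g : T -> R)
    (r : R) : measurable_fun setT g -> measurable [set w | r < g w].
Proof.
move=> mg; rewrite (_ : [set _ | _] = setT `&` g @^-1` `]r, +oo[%classic).
  by apply: mg.
by rewrite setTI; apply/seteqP; split => w /=; rewrite in_itv/= andbT.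
Qed.

Lemma mass_series_le1 (R : realType) (p : mass_partition R) (n : nat) :
  series p n <= 1.
Proof.
rewrite -lee_fin; apply: le_trans (mass_sum_le1 p).
rewrite /series/= -sumEFin; apply: nneseries_lim_ge => i _ _.
by rewrite lee_fin mass_ge0.
Qed.

Lemma mass_dist_le (R : realType) (p q : mass_partition R) (e : R) :
  (forall i, `|p i - q i| <= e) -> mass_dist p q <= e.
Proof.
move=> pqe; have e0 : 0 <= e by exact: le_trans (pqe 0%N).
have half1 : `|2^-1 : R| < 1 by rewrite ger0_norm// invf_lt1// ltr1n.
have <- : limn (series (geometric (e / 2) 2^-1)) = e.
  by rewrite (cvg_lim _ (cvg_geometric_series half1))//; field; lra.
apply: lim_series_le; first exact: is_cvg_mass_dist.
  exact: is_cvg_geometric_series.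
move=> n; rewrite /geometric/= mulrC -mulrA -exprS exprVn.
by rewrite ler_wpM2r// invr_ge0 exprn_ge0.
Qed.

Lemma entry_le_mass_dist (R : realType) (p q : mass_partition R) (i : nat) :
  `|p i - q i| <= 2 ^+ i.+1 * mass_dist p q.
Proof.
rewrite -ler_pdivrMl ?exprn_gt0//.
have nd : {homo series (fun n => 2 ^- n.+1 * `|p n - q n|) :
    n m / (n <= m)%N >-> n <= m}.
  apply/nondecreasing_series => j _ _.
  by rewrite mulr_ge0// invr_ge0 exprn_ge0.
apply: le_trans (nondecreasing_cvgn_le nd (@is_cvg_mass_dist _ p q) i.+1).
by rewrite /series/= big_nat_recr//= lerDr sumr_ge0.
Qed.

Lemma mdist_massE (R : realType) (p q : mass_partition R) :
  mdist p q = mass_dist p q.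
Proof. by []. Qed.

Lemma lipschitz_continuous_mass (R : realType) (f : mass_partition R -> R)
    (K : R) : (forall p q, `|f p - f q| <= K * mass_dist p q) ->
  continuous f.
Proof.
move=> fK p U /nbhs_ballP[e /= e0 eU].
have K1 : 0 < `|K| + 1 by rewrite ltr_wpDl.
apply/nbhs_ballP; exists (e / (`|K| + 1)) => /=; first by rewrite divr_gt0.
move=> q; rewrite ballEmdist/= mdist_massE ltr_pdivlMr// => pq.
apply: eU; apply: le_lt_trans pq; apply: (le_trans (fK _ _)).
have d0 : 0 <= mass_dist p q by exact: (@mdist_ge0 R (mass_partition R)).
by rewrite mulrC ler_wpM2l// (le_trans (ler_norm _))// lerDl.
Qed.

Lemma continuous_random_element (R : realType) d (T : measurableType d)
    (S : ptopologicalType) (X : T -> S) (f : S -> R) :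
  random_element X -> continuous f -> measurable_fun setT (f \o X).
Proof.
move=> mX cf.
apply: (@measurableT_comp _ _ _ _ _ _ (f : borel S -> R)) mX.
apply: (measurability _ (RGenOpens.measurableE R)).
move=> _ [_ [a [b ->]] <-]; rewrite setTI; apply: sub_sigma_algebra.
by apply: open_comp => // x _; exact: cf.
Qed.

Lemma continuous_entry (R : realType) (i : nat) :
  continuous (fun p : mass_partition R => p i).
Proof.
apply: (@lipschitz_continuous_mass _ _ (2 ^+ i.+1)) => p q.
exact: entry_le_mass_dist.
Qed.

Lemma measurable_entry (R : realType) d (T : measurableType d)
    (X : T -> mass_partition R) (i : nat) :
  random_element X -> measurable_fun setT (fun w => X w i).
Proof. by move=> mX; exact: continuous_random_element (@continuous_entry R i). Qed.

(** The weight of the indices from n on is 2 ^- n, so the balls of the metric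
    contain cylinders: open sets are countable unions of cylinders with rational
    data, and measurability can be checked entry by entry. *)
Lemma mass_dist_le_cylinder (R : realType) (p q : mass_partition R)
    (n : nat) (r : R) :
  (forall i, (i < n)%N -> `|p i - q i| <= r) -> 0 <= r ->
  mass_dist p q <= r + 2 ^- n.
Proof.
move=> pqr r0.
have half1 : `|2^-1 : R| < 1 by rewrite ger0_norm// invf_lt1// ltr1n.
have pq1 i : `|p i - q i| <= 1.
  rewrite ler_norml.
  have := mass_ge0 p i; have := mass_ge0 q i.
  have := mass_entry_le1 p i; have := mass_entry_le1 q i.
  by move=> *; apply/andP; split; lra.
apply: limr_le; first exact: is_cvg_mass_dist.
near=> m.
have nm : (n <= m)%N by near: m; exact: nbhs_infty_ge.
rewrite /series/= (big_cat_nat (leq0n n) nm)/= lerD//.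
- apply: (@le_trans _ _ (r * \sum_(0 <= i < n) 2 ^- i.+1)).
    rewrite mulr_sumr ler_sum_nat// => i /andP[_ ni].
    by rewrite mulrC ler_wpM2r ?pqr// invr_ge0 exprn_ge0.
  rewrite ler_piMr//.
  suff -> : forall n, \sum_(0 <= i < n) 2 ^- i.+1 = 1 - 2 ^- n :> R.
    by rewrite gerBl invr_ge0 exprn_ge0.
  elim => [|k IH]; first by rewrite big_geq// expr0 invr1 subrr.
  rewrite big_nat_recr//= IH exprS invfM.
  by set u := 2 ^- k; lra.
- apply: (@le_trans _ _ (\sum_(n <= i < m) 2 ^- i.+1)).
    rewrite ler_sum_nat// => i _.
    by rewrite ler_piMr// invr_ge0 exprn_ge0.
  suff -> : forall m, (n <= m)%N ->
      \sum_(n <= i < m) 2 ^- i.+1 = 2 ^- n - 2 ^- m :> R.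
  - by rewrite gerBl invr_ge0 exprn_ge0.
  - exact: nm.
  elim => [|k IH]; first by rewrite leqn0 => /eqP ->; rewrite big_geq// subrr.
  rewrite leq_eqVlt => /predU1P[->|nk]; first by rewrite big_geq// subrr.
  rewrite big_nat_recr//= IH// exprS invfM.
  by set u := 2 ^- k; lra.
Unshelve. all: by end_near. Qed.

Lemma random_element_entries (R : realType) d (T : measurableType d)
    (X : T -> mass_partition R) :
  (forall i, measurable_fun setT (fun w => X w i)) -> random_element X.
Proof.
move=> mX; apply: (@measurability _ _ T (borel (mass_partition R)) _ _
  (@open (mass_partition R)) erefl) => _ [U oU <-]; rewrite setTI.
pose cyl (s : seq rat * rat) := [set p : mass_partition R |
  forall i, (i < size s.1)%N -> `|p i - ratr (nth 0 s.1 i)| < ratr s.2].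
have -> : X @^-1` U =
    \bigcup_(s : seq rat * rat) [set w | cyl s `<=` U /\ cyl s (X w)].
  apply/seteqP; split => w /=; last by case=> s _ [sU /sU].
  move=> Uw.
  have : nbhs (X w) U by exact: open_nbhs_nbhs.
  move=> /nbhs_ballP[e /= e0 eU].
  have [n n_e] : exists n, 2 ^- n < e / 2 :> R.
    have half1 : `|2^-1 : R| < 1 by rewrite ger0_norm// invf_lt1// ltr1n.
    have /cvgrPdist_lt/(_ (e / 2)) := cvg_expr half1.
    rewrite divr_gt0// => /(_ isT)[n _ /(_ n (leqnn n))] /=.
    rewrite sub0r normrN ger0_norm ?exprn_ge0// => h.
    by exists n; rewrite -exprVn.
  have [r r_e] : exists r : rat, ratr r \in `]0, (e / 4) : R[.
    by apply: rat_in_itvoo; rewrite divr_gt0.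
  move: r_e; rewrite in_itv/= => /andP[r0 r_e].
  have ex i : exists q : rat, `|X w i - ratr q| < ratr r.
    have [q q_in] : exists q : rat,
        ratr q \in `](X w i - ratr r), (X w i + ratr r)[.
      by apply: rat_in_itvoo; lra.
    exists q; move: q_in; rewrite in_itv/= => /andP[? ?].
    by rewrite ltr_norml; apply/andP; split; lra.
  have [q qP] := choice ex.
  exists (mkseq q n, r) => //; split => /=; last first.
    by move=> i; rewrite size_mkseq => ni; rewrite nth_mkseq.
  move=> p /= p_cyl; apply: eU; rewrite ballEmdist/= mdist_massE.
  apply: (@le_lt_trans _ _ (ratr r *+ 2 + 2 ^- n)); last by rewrite mulr2n; lra.
  apply: mass_dist_le_cylinder; last by rewrite mulrn_wge0// ltW.
  move=> i ni; have := p_cyl i; rewrite size_mkseq nth_mkseq// => /(_ ni) h1.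
  have h2 := qP i.
  apply: (le_trans (ler_distD (ratr (q i)) _ _)).
  by rewrite mulr2n lerD// ltW// distrC.
apply: countable_bigcupT_measurable; first exact: countableP.
move=> s.
have [sU|nsU] := pselect (cyl s `<=` U); last first.
  by rewrite (_ : [set _ | _] = set0)//; apply/seteqP; split => // w [].
rewrite (_ : [set _ | _] = \bigcap_(i in `I_(size s.1))
    [set w | `|X w i - ratr (nth 0 s.1 i)| < ratr s.2]); last first.
  by apply/seteqP; split => w /= => [[_ h] i|h]; [exact: h|split].
apply: bigcap_measurableType => i _.
apply: measurable_set_lt; apply: measurableT_comp => //.
exact: measurable_funB.
Qed.

(** * Partitions resolved by the counts above finitely many levels *)

(** The last level j that p i * S reaches is also the last one that p' i * S'
    reaches, and two numbers between c j and c j.+1 differ by a factor at most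
    q. *)
Lemma coarse_close_entry (R : realType) (n : nat) (c : nat -> R)
    (M : nat -> nat) (p p' : nat -> R) (S S' q : R) (i : nat) :
  M n = 0%N -> (forall j, 0 < c j) -> (forall j, (j < n)%N -> c j.+1 <= q * c j) ->
  (forall j i, (j <= n)%N -> (c j <= p i * S) = (i < M j)%N) ->
  (forall j i, (j <= n)%N -> (c j <= p' i * S') = (i < M j)%N) ->
  (i < M 0%N)%N -> p i * S <= q * (p' i * S').
Proof.
move=> Mn c0 cq pM p'M iM0.
(* the last level that the entry i reaches *)
have [j [jn ij ij1]] : exists j, [/\ (j < n)%N, (i < M j)%N & ~~ (i < M j.+1)%N].
  have ex : exists j, (j <= n)%N && ~~ (i < M j)%N by exists n; rewrite leqnn Mn.
  case: (ex_minnP ex) => -[|j] /andP[jn ijM] jmin; first by rewrite iM0 in ijM.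
  exists j; split => //; apply/negPn/negP => h.
  by have := jmin j; rewrite h (ltnW jn) ltnn => /(_ isT).
have q0 : 0 < q.
  by have := lt_le_trans (c0 j.+1) (cq _ jn); rewrite pmulr_lgt0.
apply: (@le_trans _ _ (q * c j)).
  by apply: le_trans (cq _ jn); apply/ltW; rewrite ltNge pM.
by rewrite ler_pM2l// p'M// ltnW.
Qed.

(** The counts fix the entries above c 0 up to the mesh ratio q, but only after
    multiplication by the unknown scales S and S'. Since both partitions have
    almost all of their mass above c 0, summing the entries compares the scales
    up to q / (1 - e), hence the entries themselves up to q ^ 2 / (1 - e). *)
Lemma coarse_close (R : realType) (n : nat) (c : nat -> R)
    (M : nat -> nat) (p p' : mass_partition R) (S S' q e : R) :
  M n = 0%N -> (forall j, 0 < c j) -> (forall j, (j < n)%N -> c j.+1 <= q * c j) ->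
  1 <= q -> 0 <= e < 1 -> 0 < S -> 0 < S' ->
  (forall j i, (j <= n)%N -> (c j <= p i * S) = (i < M j)%N) ->
  (forall j i, (j <= n)%N -> (c j <= p' i * S') = (i < M j)%N) ->
  1 - e <= \sum_(0 <= i < M 0%N) p i ->
  1 - e <= \sum_(0 <= i < M 0%N) p' i ->
  mass_dist p p' <= e + (q ^+ 2 / (1 - e) - 1).
Proof.
move=> Mn c0 cq q1 /andP[e0 e1] S0 S'0 pM p'M sp sp'.
have q0 : 0 < q by exact: lt_le_trans q1.
have sum_le1 (r : mass_partition R) m : \sum_(0 <= i < m) r i <= 1 := mass_series_le1 r m.
have main (a b : mass_partition R) (A B : R) : 0 < A -> 0 < B ->
    (forall j i, (j <= n)%N -> (c j <= a i * A) = (i < M j)%N) ->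
    (forall j i, (j <= n)%N -> (c j <= b i * B) = (i < M j)%N) ->
    1 - e <= \sum_(0 <= i < M 0%N) a i ->
    1 - e <= \sum_(0 <= i < M 0%N) b i ->
    forall i, a i - b i <= e + (q ^+ 2 / (1 - e) - 1).
  move=> A0 B0 aM bM sa sb i.
  have e1' : 0 < 1 - e by rewrite subr_gt0.
  have qe : 1 <= q ^+ 2 / (1 - e).
    rewrite ler_pdivlMr// mul1r; have := exprn_ege1 2 q1; lra.
  have [iM|Mi] := ltnP i (M 0%N); last first.
    suff : a i <= e by have := mass_ge0 b i; lra.
    have := sum_le1 a i.+1; rewrite big_nat_recr//= => h.
    have : \sum_(0 <= k < M 0%N) a k <= \sum_(0 <= k < i) a k.
      rewrite [leRHS](big_cat_nat (leq0n _) Mi)/= lerDl sumr_ge0//.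
      by move=> k _; exact: mass_ge0.
    lra.
  have AB : (1 - e) * B <= q * A.
    apply: (@le_trans _ _ (\sum_(0 <= k < M 0%N) b k * B)).
      by rewrite -mulr_suml ler_wpM2r// ltW.
    apply: (@le_trans _ _ (\sum_(0 <= k < M 0%N) q * (a k * A))).
      apply: ler_sum_nat => k /andP[_ kM].
      exact: (coarse_close_entry Mn c0 cq bM aM kM).
    rewrite -mulr_sumr -mulr_suml ler_pM2l//.
    by rewrite ler_piMl ?sum_le1// ltW.
  have ab : a i * A <= q * (b i * B) := coarse_close_entry Mn c0 cq aM bM iM.
  have : a i <= q ^+ 2 / (1 - e) * b i.
    rewrite -(ler_pM2r A0) (le_trans ab)//.
    rewrite mulrAC -mulrA -[leRHS]mulrA mulrC -[leRHS]mulrA mulrA.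
    have b0 := mass_ge0 b i.
    rewrite -(ler_pM2r e1').
    have -> : q ^+ 2 * ((1 - e)^-1 * (A * b i)) * (1 - e) = q * b i * (q * A).
      by field; rewrite gt_eqF.
    have -> : b i * B * q * (1 - e) = q * b i * ((1 - e) * B) by ring.
    by rewrite ler_wpM2l// mulr_ge0// ltW.
  have b1 := mass_entry_le1 b i; have b0 := mass_ge0 b i.
  have : (q ^+ 2 / (1 - e) - 1) * b i <= q ^+ 2 / (1 - e) - 1.
    by rewrite ler_piMr// subr_ge0.
  lra.
apply: mass_dist_le => i; rewrite ler_norml; apply/andP; split.
  by rewrite lerNl opprB; exact: (main p' p S' S).
exact: (main p p' S S').
Qed.

(** * Bounded integrands and Lipschitz test functions *)

Lemma measurable_integrable_bounded (R : realType) d (T : measurableType d)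
    (P : probability T R) (g : T -> R) (B : R) :
  measurable_fun setT g -> (forall w, `|g w| <= B) ->
  P.-integrable setT (EFin \o g).
Proof.
move=> mg gB; apply: measurable_bounded_integrable => //.
  by rewrite [_ setT]probability_setT ltry.
exists B; split; first exact: num_real.
by move=> x Bx w _; exact: le_trans (gB w) (ltW Bx).
Qed.

Lemma Rintegral_cst_probability (R : realType) d (T : measurableType d)
    (P : probability T R) (r : R) : (\int[P]_w r)%R = r.
Proof.
rewrite Rintegral_cst// [X in fine X](_ : _ = 1%E) ?mulr1//.
exact: probability_setT.
Qed.

Lemma normr_Rintegral_le (R : realType) d (T : measurableType d)
    (P : probability T R) (g : T -> R) (B : R) :
  measurable_fun setT g -> (forall w, `|g w| <= B) -> `|(\int[P]_w g w)%R| <= B.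
Proof.
move=> mg gB; have ig := measurable_integrable_bounded P mg gB.
apply: (le_trans (le_normr_Rintegral measurableT ig)).
rewrite -[leRHS](Rintegral_cst_probability P); apply: le_Rintegral => //.
  exact: (integrable_norm ig).
exact: (@measurable_integrable_bounded _ _ _ P (cst B) `|B|).
Qed.

Lemma expectation_EFin (R : realType) d (T : measurableType d)
    (P : probability T R) (g : T -> R) (B : R) :
  measurable_fun setT g -> (forall w, `|g w| <= B) ->
  ('E_P[g] = (\int[P]_w g w)%:E)%E.
Proof.
move=> mg gB; rewrite unlock /Rintegral fineK//.
exact: integrable_fin_num (measurable_integrable_bounded _ mg gB).
Qed.

Lemma integrable_continuous_mass (R : realType) d (T : measurableType d)
    (P : probability T R) (X : T -> mass_partition R)
    (f : mass_partition R -> R) (B : R) :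
  random_element X -> continuous f -> (forall p, `|f p| <= B) ->
  P.-integrable setT (EFin \o (fun w => f (X w))).
Proof.
move=> mX cf fB.
apply: (measurable_integrable_bounded _ (continuous_random_element mX cf)).
by move=> w; exact: fB.
Qed.

(** Lipschitz functions determine convergence in law: a bounded continuous f is
    the increasing limit of its inf-convolutions with multiples of the
    distance. *)
Section lipschitz_regularization.
Variables (R : realType) (f : mass_partition R -> R) (B : R).
Hypotheses (cf : continuous f) (fB : forall p, `|f p| <= B).

Let g (k : nat) (p : mass_partition R) : R :=
  inf [set f q + k%:R * mass_dist p q | q in setT].

Let fB2 p : - B <= f p <= B. Proof. by rewrite -ler_norml. Qed.

Let d0 p q : 0 <= mass_dist p q :> R.
Proof. exact: (@mdist_ge0 R (mass_partition R)). Qed.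

Let g_lb k p : lbound [set f q + k%:R * mass_dist p q | q in setT] (- B).
Proof.
move=> _ [q _ <-]; have /andP[h _] := fB2 q.
by rewrite -[leLHS]addr0 lerD// mulr_ge0.
Qed.

Let g_le k p q : g k p <= f q + k%:R * mass_dist p q.
Proof. by apply: ge_inf; [exists (- B); exact: g_lb|exists q]. Qed.

Let g_ge k p y : (forall q, y <= f q + k%:R * mass_dist p q) -> y <= g k p.
Proof.
move=> h; apply: lb_le_inf; first by exists (f p + k%:R * mass_dist p p), p.
by move=> _ [q _ <-].
Qed.

Let g_le_f k p : g k p <= f p.
Proof.
by have := g_le k p p; rewrite -mdist_massE mdistxx mulr0 addr0.
Qed.

Let g_lip k p q : `|g k p - g k q| <= k%:R * mass_dist p q.
Proof.
have main a b : g k a <= g k b + k%:R * mass_dist a b.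
  rewrite -lerBlDr; apply: g_ge => r; rewrite lerBlDr (le_trans (g_le k a r))//.
  rewrite -addrA -mulrDr lerD2l// ler_wpM2l// addrC -!mdist_massE.
  exact: metric_triangle.
rewrite ler_norml; apply/andP; split; last by rewrite lerBlDl.
rewrite lerNl opprB lerBlDl (_ : mass_dist p q = mass_dist q p)//.
by rewrite -!mdist_massE metric_sym.
Qed.

Let g_B k p : `|g k p| <= B.
Proof.
have /andP[_ h] := fB2 p; rewrite ler_norml (le_trans (g_le_f k p))// andbT.
by apply: lb_le_inf; [exists (f p + k%:R * mass_dist p p), p|exact: g_lb].
Qed.

Let g_cvg p : g k p @[k --> \oo] --> f p.
Proof.
apply/cvgrPdist_le => e e0.
have : nbhs p (f @^-1` ball (f p) e) by apply: cf; exact: nbhsx_ballx.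
move=> /nbhs_ballP[r /= r0 rf].
near=> k.
rewrite ger0_norm ?subr_ge0// lerBlDr -lerBlDl; apply: g_ge => q.
have [pq|pq] := ltP (mass_dist p q) r.
  have := rf q; rewrite ballEmdist/= mdist_massE => /(_ pq).
  rewrite /ball/= ltr_norml => /andP[_ h].
  by have := mulr_ge0 (ler0n R k) (d0 p q); lra.
have kr : 2 * B <= k%:R * r.
  by rewrite -ler_pdivrMr//; near: k; exact: nbhs_infty_ger.
have : k%:R * r <= k%:R * mass_dist p q by rewrite ler_wpM2l.
have := fB2 p; have := fB2 q; lra.
Unshelve. all: by end_near. Qed.

Lemma lipschitz_lower_approximation d (T : measurableType d)
    (P : probability T R) (X : T -> mass_partition R) (e : R) :
  random_element X -> 0 < e ->
  exists g' K, [/\ forall p q, `|g' p - g' q| <= K * mass_dist p q,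
    forall p, `|g' p| <= B, forall p, g' p <= f p &
    (\int[P]_w f (X w))%R - e <= (\int[P]_w g' (X w))%R].
Proof.
move=> mX e0.
have mfX := continuous_random_element mX cf.
have mgX k : measurable_fun setT (g k \o X).
  exact: continuous_random_element mX (lipschitz_continuous_mass (g_lip k)).
have cvg_ae : {ae P, forall w, setT w ->
    (g k (X w))%:E @[k --> \oo] --> (f (X w))%:E}.
  by apply: aeW => w _; apply: cvg_EFin; [exact: nearW|exact: g_cvg].
have dom_int : P.-integrable setT (cst B%:E).
  by apply: (@measurable_integrable_bounded _ _ _ _ (cst B) `|B|).
have dom_ae : {ae P, forall w k, setT w -> (`|(g k (X w))%:E| <= cst B%:E w)%E}.
  by apply: aeW => w k _ /=; rewrite lee_fin g_B.
have [_ _ cvg_g] :=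
  dominated_convergence measurableT (fun k => (measurable_EFinP _ _).2 (mgX k))
    ((measurable_EFinP _ _).2 mfX) cvg_ae dom_int dom_ae.
have ifX : P.-integrable setT (EFin \o (f \o X)).
  exact: measurable_integrable_bounded mfX (fun w => fB (X w)).
have ifin : (\int[P]_w (f (X w))%:E)%E \is a fin_num.
  exact: integrable_fin_num ifX.
move: cvg_g; rewrite -(fineK ifin) => /fine_cvgP[_].
move=> /cvgrPdist_le/(_ e e0)[k _ /(_ k (leqnn k))/= h].
exists (g k), k%:R; split; [exact: g_lip|exact: g_B|exact: g_le_f|].
move: h; rewrite ler_norml => /andP[_].
by rewrite lerBlDr -lerBlDl.
Qed.

End lipschitz_regularization.

(** Approximation from below gives one inequality for the limit of the
    expectations of f; applied to - f it gives the other one. *)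
Lemma lipschitz_converges_in_law (R : realType) d (T : measurableType d)
    (P : probability T R) (X : nat -> T -> mass_partition R)
    d' (T' : measurableType d') (P' : probability T' R)
    (X' : T' -> mass_partition R) :
  (forall n, random_element (X n)) -> random_element X' ->
  (forall f K B, (forall p q, `|f p - f q| <= K * mass_dist p q) ->
    (forall p, `|f p| <= B) ->
    (\int[P]_w f (X n w))%R @[n --> \oo] --> (\int[P']_w f (X' w))%R) ->
  converges_in_law P X P' X'.
Proof.
move=> mX mX' lipX; split=> // f cf [B fB].
have lower (h : mass_partition R -> R) : continuous h ->
    (forall p, `|h p| <= B) -> forall e, 0 < e ->
    \forall n \near \oo,
      (\int[P']_w h (X' w))%R - e <= (\int[P]_w h (X n w))%R.
  move=> ch hB e e0.
  have e20 : 0 < e / 2 by rewrite divr_gt0.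
  have [g [K [gK gB gh ge]]] := lipschitz_lower_approximation ch hB P' mX' e20.
  have /cvgrPdist_le/(_ _ e20) := lipX g K B gK gB.
  apply: filterS => n; rewrite ler_norml => /andP[_ hn].
  have : (\int[P]_w g (X n w))%R <= (\int[P]_w h (X n w))%R.
    apply: le_Rintegral => //.
    + exact: integrable_continuous_mass (lipschitz_continuous_mass gK) gB.
    + exact: integrable_continuous_mass ch hB.
  lra.
have EE d1 (T1 : measurableType d1) (Q : probability T1 R)
    (Y : T1 -> mass_partition R) : random_element Y ->
    ('E_Q[f \o Y] = (\int[Q]_w f (Y w))%:E)%E.
  move=> mY; apply: (@expectation_EFin _ _ _ _ (f \o Y) B) => [|w /=//].
  exact: continuous_random_element.
rewrite EE// (_ : (fun n => _) = (fun n => (\int[P]_w f (X n w))%:E)); last first.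
  by apply/funext => n; rewrite EE.
apply: cvg_EFin; first exact: nearW.
apply/cvgrPdist_le => e e0.
pose Nf (p : mass_partition R) : R := - f p.
have cNf : continuous Nf by move=> p; exact: (cvgN (cf p)).
have NfB p : `|Nf p| <= B by rewrite normrN.
have NE d1 (T1 : measurableType d1) (Q : probability T1 R)
    (Y : T1 -> mass_partition R) : random_element Y ->
    (\int[Q]_w Nf (Y w))%R = - (\int[Q]_w f (Y w))%R.
  move=> mY; rewrite -mulN1r -RintegralZl//.
    by apply: eq_Rintegral => w _; rewrite mulN1r.
  exact: integrable_continuous_mass cf fB.
near=> n.
have h1 : (\int[P']_w f (X' w))%R - e <= (\int[P]_w f (X n w))%R.
  by near: n; exact: lower.
have : (\int[P']_w Nf (X' w))%R - e <= (\int[P]_w Nf (X n w))%R.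
  by near: n; exact: lower.
rewrite !NE// => h2.
by rewrite ler_norml /=; apply/andP; split; lra.
Unshelve. all: by end_near. Qed.

(** * Expectations computed from counts *)

Lemma measurable_indic_integrable (R : realType) d (T : measurableType d)
    (P : probability T R) (A : set T) : measurable A ->
  P.-integrable setT (EFin \o (\1_A : T -> R)).
Proof.
move=> mA; apply: (@measurable_integrable_bounded _ _ _ _ _ 1) => [|w].
  exact: measurable_indic.
by rewrite indicE; case: (_ \in _); rewrite /= ?normr1 ?normr0.
Qed.

Lemma Rintegral_indic (R : realType) d (T : measurableType d)
    (P : probability T R) (A : set T) : measurable A ->
  (\int[P]_w (\1_A w : R))%R = fine (P A).
Proof. by move=> mA; rewrite /Rintegral integral_indic// setIT. Qed.

Lemma Rintegral_sum (R : realType) d (T : measurableType d)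
    (P : probability T R) (I : Type) (r : seq I) (Q : pred I) (h : I -> T -> R) :
  (forall i, P.-integrable setT (EFin \o h i)) ->
  P.-integrable setT (EFin \o (fun w => \sum_(i <- r | Q i) h i w)) /\
  (\int[P]_w (\sum_(i <- r | Q i) h i w))%R =
    \sum_(i <- r | Q i) (\int[P]_w h i w)%R.
Proof.
move=> ih; elim: r => [|i r [IHi IHe]].
  rewrite big_nil; split.
    have -> : (fun w => \sum_(i <- [::] | Q i) h i w) = cst 0.
      by apply/funext => w; rewrite big_nil.
    exact: integrable0.
  rewrite -[RHS](Rintegral_cst_probability P).
  by apply: eq_Rintegral => w _; rewrite big_nil.
rewrite big_cons; case: ifPn => Qi; last first.
  have E : (fun w => \sum_(i <- (i :: r) | Q i) h i w) =
      (fun w => \sum_(i <- r | Q i) h i w).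
    by apply/funext => w; rewrite big_cons (negbTE Qi).
  by rewrite E.
have E : (fun w => \sum_(i <- (i :: r) | Q i) h i w) =
    (fun w => h i w + \sum_(i <- r | Q i) h i w).
  by apply/funext => w; rewrite big_cons Qi.
rewrite E; split; last by rewrite RintegralD// IHe.
exact: (integrableD measurableT (ih i) IHi).
Qed.

(** S stands for an unnormalized total weight, so that p i * S is a raw weight:
    exp (beta * energy) for the Gibbs weights and exp (beta * point) for the
    Poisson process. Both sides of the limit are compared through this
    predicate, which forgets everything but the counts above the levels. *)
Definition resolves (R : realType) (n : nat) (c : nat -> R) (e : R)
    (m : nat -> nat) (p : mass_partition R) :=
  exists S, [/\ 0 < S,
    forall j i, (j <= n)%N -> (c j <= p i * S) = (i < m j)%N &
    1 - e <= \sum_(0 <= i < m 0%N) p i].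

Lemma Rintegral_le_off_bad (R : realType) d (T : measurableType d)
    (P : probability T R) (u : T -> R) (B e : R) (bad : set T) :
  measurable_fun setT u -> measurable bad -> 0 <= e ->
  (forall w, `|u w| <= B) -> (forall w, ~ bad w -> `|u w| <= e) ->
  `|(\int[P]_w u w)%R| <= e + B * fine (P bad).
Proof.
move=> mu mbad e0 uB ue.
have iu := measurable_integrable_bounded P mu uB.
have ie := @measurable_integrable_bounded _ _ _ P (cst e) `|e| (measurable_cst _)
  (fun _ => lexx _).
have ib : P.-integrable setT (EFin \o (fun w => B * \1_bad w)).
  exact: (integrableZl measurableT B (measurable_indic_integrable P mbad)).
apply: (le_trans (le_normr_Rintegral measurableT iu)).
rewrite -[X in X + _](Rintegral_cst_probability P) -Rintegral_indic//.
rewrite -RintegralZl//; last exact: measurable_indic_integrable.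
rewrite -(RintegralD measurableT ie ib); apply: le_Rintegral => //.
- exact: (integrable_norm iu).
- exact: (integrableD measurableT ie ib).
move=> w _; have [wb|wb] := pselect (bad w).
  by rewrite /= indicE mem_set// mulr1; apply: (le_trans (uB w)); rewrite lerDr.
by rewrite /= indicE memNset// mulr0 addr0; exact: ue.
Qed.

Section expectation_by_counts.
Variables (R : realType) (n : nat) (c : nat -> R) (q e : R).
Hypotheses (c_gt0 : forall j, 0 < c j)
  (c_mesh : forall j, (j < n)%N -> c j.+1 <= q * c j)
  (q_ge1 : 1 <= q) (e01 : 0 <= e < 1).
Variables (K : finType) (m : K -> nat -> nat).
Hypothesis m_top : forall k, m k n = 0%N.

(** Any partition resolved by the counts will do, by [coarse_close]; the default
    value is taken for counts that never occur on a good event. *)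
Definition resolved_representative (k : K) : mass_partition R :=
  xget (null_mass_partition R) [set p | resolves n c e (m k) p].

Lemma resolved_representative_close k p : resolves n c e (m k) p ->
  mass_dist p (resolved_representative k) <= e + (q ^+ 2 / (1 - e) - 1).
Proof.
move=> pk; rewrite /resolved_representative; case: xgetP => [p' _ /= p'k|]; last first.
  by move=> /(_ p).
have [S [S0 Sp Sm]] := pk; have [S' [S'0 Sp' Sm']] := p'k.
exact: (coarse_close (m_top k) c_gt0 c_mesh q_ge1 e01 S0 S'0 Sp Sp' Sm Sm').
Qed.

Variables (f : mass_partition R -> R) (L B : R).
Hypotheses (L_ge0 : 0 <= L)
  (fL : forall p p', `|f p - f p'| <= L * mass_dist p p')
  (fB : forall p, `|f p| <= B).

Let B_ge0 : 0 <= B.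
Proof. exact: le_trans (fB (null_mass_partition R)). Qed.

(** Off the bad event, f (p w) may be replaced by its value at a representative
    that depends on the counts only. The right-hand sum then involves the
    probability space only through the law of the counts: this is what allows
    two partitions defined on unrelated spaces to be compared. *)
Lemma expectation_by_counts d (T : measurableType d) (P : probability T R)
    (p : T -> mass_partition R) (E : K -> set T) (G : pred K) (bad : set T)
    (eta : R) :
  random_element p -> (forall k, measurable (E k)) ->
  (forall k k' w, E k w -> E k' w -> k = k') ->
  measurable bad -> fine (P bad) <= eta ->
  (forall w, ~ bad w -> exists k, [/\ G k, E k w & resolves n c e (m k) (p w)]) ->
  `|(\int[P]_w f (p w))%R
    - \sum_(k | G k) f (resolved_representative k) * fine (P (E k))| <=
  L * (e + (q ^+ 2 / (1 - e) - 1)) + 2 * B * eta.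
Proof.
move=> mp mE dE mbad Pbad good.
set e' := e + _.
pose g w := \sum_(k | G k) f (resolved_representative k) * \1_(E k) w.
have g_uniq k w : E k w -> g w = if G k then f (resolved_representative k) else 0.
  move=> Ekw; rewrite /g big_mkcond (bigD1 k)//= big1 ?addr0.
    by rewrite indicE mem_set// mulr1.
  move=> k' k'k; case: ifP => // _; rewrite indicE memNset ?mulr0// => Ek'w.
  by move: k'k; rewrite (dE _ _ _ Ek'w Ekw) eqxx.
have g0 w : (forall k, ~ E k w) -> g w = 0.
  by move=> h; rewrite /g big1// => k _; rewrite indicE memNset ?mulr0.
have gB w : `|g w| <= B.
  have [[k Ekw]|h] := pselect (exists k, E k w).
    by rewrite (g_uniq k w Ekw); case: ifP => _; rewrite ?normr0.
  by rewrite g0 ?normr0// => k Ekw; apply: h; exists k.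
have ih k : P.-integrable setT
    (EFin \o (fun w => f (resolved_representative k) * \1_(E k) w)).
  exact: (integrableZl measurableT _ (measurable_indic_integrable P (mE k))).
have [ig gE] := Rintegral_sum (index_enum K) G ih.
have -> : \sum_(k | G k) f (resolved_representative k) * fine (P (E k)) =
    (\int[P]_w g w)%R.
  rewrite /g gE; apply: eq_bigr => k _.
  by rewrite RintegralZl ?Rintegral_indic//; exact: measurable_indic_integrable.
have ifp : P.-integrable setT (EFin \o (fun w => f (p w))).
  exact: integrable_continuous_mass mp (lipschitz_continuous_mass fL) fB.
rewrite -RintegralB//.
have e'0 : 0 <= e'.
  move: e01 => /andP[e0 e1]; rewrite /e' addr_ge0// subr_ge0.
  by rewrite ler_pdivlMr ?subr_gt0// mul1r; have := exprn_ege1 2 q_ge1; lra.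
apply: (@le_trans _ _ (L * e' + 2 * B * fine (P bad))); last first.
  by rewrite lerD2l ler_wpM2l// mulr_ge0.
apply: Rintegral_le_off_bad => //.
- apply: measurable_funB.
    exact: continuous_random_element mp (lipschitz_continuous_mass fL).
  by apply/measurable_EFinP; exact: measurable_int ig.
- by rewrite mulr_ge0.
- by move=> w; rewrite (le_trans (ler_normB _ _))// mulr_natl mulr2n lerD.
move=> w bw; have [k [Gk Ekw kp]] := good w bw.
rewrite (g_uniq k w Ekw) Gk (le_trans (fL _ _))// ler_wpM2l//.
exact: resolved_representative_close.
Qed.

End expectation_by_counts.

(** * Equal laws on mass partitions *)

Lemma same_law_Rintegral (R : realType) d (T : measurableType d)
    (P : probability T R) d' (T' : measurableType d') (P' : probability T' R)
    (X : T -> mass_partition R) (X' : T' -> mass_partition R)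
    (f : mass_partition R -> R) (B : R) :
  random_element X -> random_element X' -> same_law P X P' X' ->
  continuous f -> (forall p, `|f p| <= B) ->
  (\int[P]_w f (X w))%R = (\int[P']_w f (X' w))%R.
Proof.
move=> mX mX' XX' cf fB.
have mid : random_element (fun p : borel (mass_partition R) => p).
  exact: measurable_id.
have mf := continuous_random_element mid cf.
pose U : {RV P >-> borel (mass_partition R)} :=
  HB.pack (X : T -> borel (mass_partition R)) (isMeasurableFun.Build _ _ _ _ _ mX).
pose U' : {RV P' >-> borel (mass_partition R)} :=
  HB.pack (X' : T' -> borel (mass_partition R)) (isMeasurableFun.Build _ _ _ _ _ mX').
have iX := integrable_continuous_mass P mX cf fB.
have iX' := integrable_continuous_mass P' mX' cf fB.
have e1 := integral_distribution (X := U) (proj2 (measurable_EFinP _ _) mf) iX.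
have e2 := integral_distribution (X := U') (proj2 (measurable_EFinP _ _) mf) iX'.
rewrite /Rintegral; congr fine; rewrite -[LHS]e1 -[RHS]e2.
by apply: eq_measure_integral => A mA _; exact: XX'.
Qed.

Definition proper (R : realType) (p : mass_partition R) :=
  (forall i, 0 < p i) /\ (series p @ \oo --> (1 : R)).

Lemma mass_series_cvg1 (R : realType) (p : mass_partition R) :
  (series p @ \oo --> (1 : R)) <->
  forall k, exists n, 1 - k.+1%:R^-1 < series p n.
Proof.
split=> [h k|h].
  have k0 : 0 < k.+1%:R^-1 :> R by rewrite invr_gt0.
  have /cvgrPdist_lt /(_ _ k0) [n _ hn] := h.
  exists n; have := hn n (leqnn n).
  by rewrite /= ltr_norml => /andP[_]; rewrite ltrBlDr -ltrBlDl.
apply/cvgrPdist_le => e e0.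
have [k hk] : exists k : nat, k.+1%:R^-1 < e.
  have [k _ hk] := near_infty_natSinv_lt (PosNum e0).
  by exists k; exact: (hk k (leqnn k)).
have [n hn] := h k.
exists n => // m /= nm.
have : series p n <= series p m.
  by move: nm; apply/nondecreasing_series => i _ _; exact: mass_ge0.
have := mass_series_le1 p m => h1 h2.
rewrite ger0_norm ?subr_ge0// lerBlDr -lerBlDl; apply: le_trans h2.
by apply: le_trans (ltW hn); rewrite lerB// ltW.
Qed.

Lemma measurable_proper (R : realType) :
  measurable ([set p | proper p] : set (borel (mass_partition R))).
Proof.
have me i : measurable_fun setT
    (fun p : borel (mass_partition R) => (p : mass_partition R) i).
  by apply: measurable_entry; exact: measurable_id.
rewrite (_ : [set p | proper p] =
    (\bigcap_i [set p : borel (mass_partition R) | 0 < (p : mass_partition R) i]) `&`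
    (\bigcap_k \bigcup_n [set p : borel (mass_partition R) |
       1 - k.+1%:R^-1 < series (p : mass_partition R) n])).
  apply: measurableI; apply: bigcapT_measurable => i; first exact: measurable_set_gt.
  apply: bigcupT_measurable => n; apply: measurable_set_gt.
  by rewrite /series/=; apply: measurable_sum.
apply/seteqP; split => p /=.
  move=> [h1 h2]; split; first by move=> i _; exact: h1.
  move=> k _; have [n hn] := (proj1 (mass_series_cvg1 p) h2) k.
  by exists n.
move=> [h1 h2]; split; first by move=> i; exact: h1.
by apply/mass_series_cvg1 => k; have [n _ hn] := h2 k I; exists n.
Qed.

(** The Poisson side needs positive entries of total mass 1; these are known for
    a partition of the same law, possibly on another space. *)
Lemma same_law_ae (R : realType) (S : ptopologicalType) d (T : measurableType d)
    (P : probability T R) d' (T' : measurableType d') (P' : probability T' R)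
    (X : T -> S) (X' : T' -> S) (A : set S) :
  random_element X -> random_element X' -> same_law P X P' X' ->
  measurable (A : set (borel S)) ->
  {ae P, forall w, A (X w)} -> {ae P', forall w, A (X' w)}.
Proof.
move=> mX mX' XX' mA [N [mN N0 hN]].
exists (X' @^-1` (~` A)); split => //.
  by rewrite -[X in measurable X]setTI; apply: mX' => //; exact: measurableC.
have mP : measurable (X @^-1` (~` A)).
  by rewrite -[X in measurable X]setTI; apply: mX => //; exact: measurableC.
rewrite -XX'; last exact: measurableC.
by apply: (subset_measure0 mP mN) => // w /= hw; exact: hN.
Qed.

(** * Poisson approximation of occupation counts *)

Definition poisson_mass (R : realType) (x : R) (k : nat) : R :=
  expR (- x) * x ^+ k / k`!%:R.

(** The value at k - 1, read as 0 when k = 0: the mass transferred to k from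
    below when a point is added. *)
Definition poisson_mass_pred (R : realType) (x : R) (k : nat) : R :=
  if k is k'.+1 then poisson_mass x k' else 0.

Lemma poisson_mass_ge0 (R : realType) (x : R) k : 0 <= x -> 0 <= poisson_mass x k.
Proof. by move=> x0; rewrite /poisson_mass !mulr_ge0 ?expR_ge0// exprn_ge0. Qed.

Lemma poisson_mass_le1 (R : realType) (x : R) k : 0 <= x -> poisson_mass x k <= 1.
Proof.
move=> x0; rewrite /poisson_mass expRN -mulrA ler_pdivrMl ?expR_gt0// mulr1.
case: k => [|k]; first by rewrite expr0 mul1r invr1 -[leLHS]expR0 ler_expR.
by apply: le_trans (expR_ge1Dxn k x0); rewrite lerDr.
Qed.

Lemma poisson_mass_pred_ge0 (R : realType) (x : R) k : 0 <= x -> 0 <= poisson_mass_pred x k.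
Proof. by case: k => // k; exact: poisson_mass_ge0. Qed.

Lemma poisson_mass_pred_le1 (R : realType) (x : R) k : 0 <= x -> poisson_mass_pred x k <= 1.
Proof. by case: k => // k; exact: poisson_mass_le1. Qed.

Lemma is_derive_poisson_mass (R : realType) (x : R) (k : nat) :
  is_derive x 1 (fun y => poisson_mass y k) (poisson_mass_pred x k - poisson_mass x k).
Proof.
have dexp : is_derive x 1 (fun y : R => expR (- y)) (- expR (- x)).
  have := @is_derive1_comp _ (@expR R) (@GRing.opp R) x (expR (- x)) (-1).
  by rewrite mulrN1; apply.
have dpow : is_derive x 1 (fun y : R => y ^+ k) (k%:R * x ^+ k.-1).
  have := is_deriveX k (is_derive_id x (1 : R)).
  by rewrite exprfctE /GRing.scale/= mulr1.
have dcst : is_derive x 1 (fun=> k`!%:R^-1 : R) 0 by exact: is_derive_cst.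
apply: (is_derive_eq (is_deriveM (is_deriveM dexp dpow) dcst)).
rewrite /GRing.scale/=; case: k {dpow dcst} => [|k] /=.
  by rewrite /poisson_mass expr0 fact0 mul0r invr1; ring.
rewrite factS natrM /poisson_mass factS natrM.
have : (k.+1%:R : R) != 0 by rewrite pnatr_eq0.
have : (k`!%:R : R) != 0 by rewrite pnatr_eq0 -lt0n fact_gt0.
move: (k.+1%:R) (k`!%:R) => u v v0 u0; rewrite exprS.
by field; rewrite u0 v0.
Qed.

Lemma continuous_poisson_mass (R : realType) (k : nat) :
  continuous (fun x : R => poisson_mass x k).
Proof.
move=> x; apply: differentiable_continuous; apply/derivable1_diffP.
by have [] := @is_derive_poisson_mass R x k.
Qed.

Lemma MVT_poisson_mass (R : realType) (k : nat) (a p : R) : 0 <= a -> 0 <= p ->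
  exists2 c, a <= c <= a + p & poisson_mass (a + p) k - poisson_mass a k =
    (poisson_mass_pred c k - poisson_mass c k) * p.
Proof.
move=> a0 p0.
have aap : a <= a + p by rewrite lerDl.
have [|c] := @MVT_segment R (fun y => poisson_mass y k)
    (fun x => poisson_mass_pred x k - poisson_mass x k) a (a + p) aap
    (fun x _ => is_derive_poisson_mass x k).
  by apply: continuous_subspaceT; exact: continuous_poisson_mass.
by rewrite in_itv/= => cP ->; exists c => //; congr (_ * _); lra.
Qed.

Lemma poisson_mass_lipschitz (R : realType) (k : nat) (a p : R) :
  0 <= a -> 0 <= p -> `|poisson_mass (a + p) k - poisson_mass a k| <= p.
Proof.
move=> a0 p0; have [c /andP[ac _] ->] := MVT_poisson_mass k a0 p0.
have c0 : 0 <= c by exact: le_trans ac.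
rewrite normrM (ger0_norm p0) ler_piMl// ler_norml.
have := poisson_mass_ge0 k c0; have := poisson_mass_le1 k c0.
have := poisson_mass_pred_ge0 k c0; have := poisson_mass_pred_le1 k c0.
by move=> *; apply/andP; split; lra.
Qed.

Lemma poisson_mass_pred_lipschitz (R : realType) (k : nat) (a p : R) :
  0 <= a -> 0 <= p ->
  `|poisson_mass_pred (a + p) k - poisson_mass_pred a k| <= p.
Proof.
case: k => [|k]; first by rewrite /= subrr normr0.
exact: poisson_mass_lipschitz.
Qed.

(** Adding a Bernoulli variable of small parameter p to a Poisson variable of
    parameter a is almost the same as increasing a by p; the error is of second
    order by the mean value theorem. *)
Lemma poisson_mass_step (R : realType) (k : nat) (a p : R) : 0 <= a -> 0 <= p ->
  `|poisson_mass (a + p) k - poisson_mass a k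
    - p * (poisson_mass_pred a k - poisson_mass a k)| <= 2 * p ^+ 2.
Proof.
move=> a0 p0; have [c /andP[ac cap] ->] := MVT_poisson_mass k a0 p0.
rewrite [X in _ - X]mulrC -mulrBl normrM (ger0_norm p0) expr2 mulrA ler_wpM2r//.
have ca : 0 <= c - a by rewrite subr_ge0.
have := poisson_mass_lipschitz k a0 ca.
have := poisson_mass_pred_lipschitz k a0 ca.
have -> : a + (c - a) = c by ring.
rewrite ler_norml => /andP[? ?]; rewrite ler_norml => /andP[? ?].
by rewrite ler_norml; apply/andP; split; lra.
Qed.

(** Several cells are treated at once by expanding the product of their Poisson
    masses; the remainder is quadratic in the total size of the increments. *)
Lemma prod_first_order (R : realType) (I : eqType) (r : seq I)
    (a b c p : I -> R) : uniq r ->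
  (forall i, 0 <= a i <= 1) -> (forall i, 0 <= b i <= 1) ->
  (forall i, 0 <= p i) -> (forall i, `|c i| <= p i) ->
  (forall i, `|a i - b i| <= p i) ->
  (forall i, `|a i - b i - c i| <= 2 * p i ^+ 2) ->
  `|\prod_(i <- r) a i - \prod_(i <- r) b i| <= \sum_(i <- r) p i /\
  `|\prod_(i <- r) a i - \prod_(i <- r) b i
    - \sum_(j <- r) c j * \prod_(i <- r | i != j) b i|
  <= 2 * (\sum_(i <- r) p i) ^+ 2.
Proof.
move=> + a01 b01 p0 cp abp abc.
have pb01 s (Q : pred I) : 0 <= \prod_(i <- s | Q i) b i <= 1.
  by rewrite prodr_ge0 ?prodr_ile1// => i _; have /andP[] := b01 i.
have pa01 s : 0 <= \prod_(i <- s) a i <= 1.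
  by rewrite prodr_ge0 ?prodr_ile1// => i _; have /andP[] := a01 i.
elim: r => [_|i r IH /= /andP[ir ur]].
  by rewrite !big_nil subrr subr0 normr0 expr0n mulr0 lexx.
have [IH1 IH2] := IH ur; rewrite !big_cons eqxx /=.
have -> : \sum_(j <- r) c j * \prod_(i0 <- (i :: r) | i0 != j) b i0 =
    b i * \sum_(j <- r) c j * \prod_(i0 <- r | i0 != j) b i0.
  rewrite mulr_sumr; apply: eq_big_seq => j jr; rewrite big_cons.
  rewrite (_ : i != j); last by apply: contraNneq ir => ->.
  by rewrite mulrCA.
have -> : \prod_(j <- r | j != i) b j = \prod_(j <- r) b j.
  rewrite [RHS]big_seq_cond [LHS]big_seq_cond; apply: eq_bigl => j.
  rewrite andbT; case jr: (j \in r) => //=.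
  by apply: contraNneq ir => <-.
move: IH1 IH2; have := pa01 r; have := pb01 r xpredT.
set B := \prod_(_ <- _) _; set A := \prod_(_ <- _) _.
set D := \sum_(_ <- _) c _ * _; set s := \sum_(_ <- _) _.
move=> /andP[B0 B1] /andP[A0 A1] IH1 IH2.
have /andP[ai0 ai1] := a01 i; have /andP[bi0 bi1] := b01 i.
have s0 : 0 <= s by apply: le_trans IH1.
split.
  have -> : a i * A - b i * B = (a i - b i) * A + b i * (A - B) by ring.
  apply: (le_trans (ler_normD _ _)); rewrite !normrM (ger0_norm A0) (ger0_norm bi0).
  apply: lerD; first by apply: le_trans (abp i); rewrite ler_piMr.
  by apply: le_trans IH1; rewrite ler_piMl.
have -> : a i * A - b i * B - (c i * B + b i * D) =
  (a i - b i - c i) * A + b i * (A - B - D) + c i * (A - B) by ring.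
apply: (le_trans (ler_normD _ _)).
apply: (@le_trans _ _ (2 * p i ^+ 2 + 2 * s ^+ 2 + p i * s)); last first.
  have := mulr_ge0 (p0 i) s0; rewrite !expr2; nra.
apply: lerD; last by rewrite normrM ler_pM.
apply: (le_trans (ler_normD _ _)); rewrite !normrM (ger0_norm A0) (ger0_norm bi0).
apply: lerD; first by apply: le_trans (abc i); rewrite ler_piMr.
by apply: le_trans IH2; rewrite ler_piMl.
Qed.

Section le_cam.
Variables (R : realType) (I : Type) (n : nat) (p : I -> 'I_n -> R).
Hypothesis p_ge0 : forall i j, 0 <= p i j.

Let tot i := \sum_j p i j.

Hypothesis tot_le1 : forall i, tot i <= 1.

(** The counts k before a point was put in cell j. *)
Definition decr (k : {ffun 'I_n -> nat}) (j : 'I_n) : {ffun 'I_n -> nat} :=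
  [ffun i => if i == j then (k i).-1 else k i].

(** The independent indices of J fall into cell j with probability p i j, and
    into none of the cells with the remaining probability; conditioning on the
    first index gives the recursion for the law of the occupation numbers. *)
Fixpoint counts_law (J : seq I) (k : {ffun 'I_n -> nat}) : R :=
  if J is i :: J' then
    (1 - \sum_j p i j) * counts_law J' k +
    \sum_j p i j * (if (0 < k j)%N then counts_law J' (decr k j) else 0)
  else (k == [ffun=> 0%N])%:R.

Definition poisson_counts (x : 'I_n -> R) (k : {ffun 'I_n -> nat}) : R :=
  \prod_j poisson_mass (x j) (k j).

Lemma poisson_counts_decr (x : 'I_n -> R) (k : {ffun 'I_n -> nat}) (j : 'I_n) :
  (if (0 < k j)%N then poisson_counts x (decr k j) else 0) =
  poisson_mass_pred (x j) (k j) * \prod_(i | i != j) poisson_mass (x i) (k i).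
Proof.
case: ifPn => [kj|]; last by rewrite -eqn0Ngt => /eqP -> /=; rewrite mul0r.
rewrite /poisson_counts (bigD1 j)//= ffunE eqxx; congr (_ * _).
  by case: (k j) kj.
by apply: eq_bigr => i ij; rewrite ffunE (negbTE ij).
Qed.

Lemma poisson_counts_step (x : 'I_n -> R) i (k : {ffun 'I_n -> nat}) :
  (forall j, 0 <= x j) ->
  `|poisson_counts (fun j => x j + p i j) k - ((1 - tot i) * poisson_counts x k
    + \sum_j p i j * (if (0 < k j)%N then poisson_counts x (decr k j) else 0))|
  <= 2 * tot i ^+ 2.
Proof.
move=> x0.
have := @prod_first_order R 'I_n (index_enum 'I_n)
  (fun j => poisson_mass (x j + p i j) (k j)) (fun j => poisson_mass (x j) (k j))
  (fun j => p i j * (poisson_mass_pred (x j) (k j) - poisson_mass (x j) (k j)))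
  (p i) (index_enum_uniq _).
case => [j|j|//|j|j|j|_].
- by rewrite poisson_mass_ge0 ?poisson_mass_le1// addr_ge0.
- by rewrite poisson_mass_ge0 ?poisson_mass_le1.
- rewrite normrM (ger0_norm (p_ge0 i j)) ler_piMr//.
  have := poisson_mass_ge0 (k j) (x0 j); have := poisson_mass_le1 (k j) (x0 j).
  have := poisson_mass_pred_ge0 (k j) (x0 j).
  have := poisson_mass_pred_le1 (k j) (x0 j).
  by move=> *; rewrite ler_norml; apply/andP; split; lra.
- exact: poisson_mass_lipschitz.
- exact: poisson_mass_step.
apply: le_trans; rewrite le_eqVlt; apply/orP; left; apply/eqP.
congr (`|_|); rewrite -addrA -opprD; congr (_ - _).
under [in LHS]eq_bigr do rewrite poisson_counts_decr.
rewrite mulrBl mul1r -addrA; congr (_ + _).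
rewrite /tot mulr_suml -sumrN -big_split/=; apply: eq_bigr => j _.
by rewrite /poisson_counts [in LHS](bigD1 j)//=; ring.
Qed.

(** The method of Le Cam: the product of Poisson laws almost solves the recursion
    that defines [counts_law], with an error 2 * tot i ^ 2 at each step, and the
    recursion is a contraction for the uniform norm, so that the errors add
    up. *)
Lemma counts_law_poisson (J : seq I) (k : {ffun 'I_n -> nat}) :
  `|counts_law J k - poisson_counts (fun j => \sum_(i <- J) p i j) k| <=
  2 * \sum_(i <- J) (\sum_j p i j) ^+ 2.
Proof.
elim: J k => [|i J IH] k /=.
  rewrite big_nil mulr0 (_ : _ - _ = 0) ?normr0//.
  apply/eqP; rewrite subr_eq0 /poisson_counts; apply/eqP.
  have pm0 m : poisson_mass (0 : R) m = (m == 0%N)%:R.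
    rewrite /poisson_mass oppr0 expR0 mul1r expr0n; case: m => [|m] /=.
      by rewrite fact0 divr1.
    by rewrite mul0r.
  under eq_bigr do rewrite big_nil pm0.
  case: eqP => [->|/eqP]; first by rewrite big1// => j _; rewrite ffunE eqxx.
  move=> /eqP k0; have [j kj] : exists j, k j != 0%N.
    apply/existsP; rewrite -negb_forall; apply/negP => /forallP h.
    by apply: k0; apply/ffunP => j; rewrite ffunE; exact/eqP.
  by rewrite (bigD1 j)//= (negbTE kj) mul0r.
set x := fun j => \sum_(i <- J) p i j.
have x0 j : 0 <= x j by apply: sumr_ge0.
have := poisson_counts_step i k x0.
have -> : (fun j => \sum_(i <- (i :: J)) p i j) = (fun j => x j + p i j).
  by apply/funext => j; rewrite big_cons addrC.
rewrite big_cons mulrDr.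
set E := 2 * \sum_(_ <- _) _.
move=> h; set L := (1 - _) * _ + _; move: h.
set Q := poisson_counts _ k; set K := (1 - _) * _ + _; rewrite distrC => h.
have -> : L - Q = (L - K) + (K - Q) by rewrite addrA subrK.
apply: (le_trans (ler_normD _ _)); rewrite addrC; apply: lerD => //.
have -> : L - K = (1 - tot i) * (counts_law J k - poisson_counts x k) +
  \sum_j p i j * (if (0 < k j)%N then
    counts_law J (decr k j) - poisson_counts x (decr k j) else 0).
  rewrite /L /K opprD addrACA -mulrBr; congr (_ + _).
  rewrite -sumrB; apply: eq_bigr => j _; rewrite -mulrBr.
  by case: ifP; rewrite ?subrr.
have E0 : 0 <= E by rewrite mulr_ge0// sumr_ge0// => j _; exact: sqr_ge0.
have t1 : 0 <= 1 - tot i by rewrite subr_ge0.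
apply: (le_trans (ler_normD _ _)).
apply: (@le_trans _ _ ((1 - tot i) * E + \sum_j p i j * E)); last first.
  by rewrite -mulr_suml -mulrDl subrK mul1r.
apply: lerD; first by rewrite normrM (ger0_norm t1) ler_wpM2l// IH.
apply: (le_trans (ler_norm_sum _ _ _)); apply: ler_sum => j _.
rewrite normrM (ger0_norm (p_ge0 i j)) ler_wpM2l//.
by case: ifP => _; [exact: IH|rewrite normr0].
Qed.

End le_cam.

(** * Counts of independent variables in disjoint cells *)

Lemma probability_bigcup_fintype (R : realType) d (T : measurableType d)
    (P : probability T R) (I : finType) (F : I -> set T) :
  (forall i, measurable (F i)) -> (forall i j w, F i w -> F j w -> i = j) ->
  (P (\bigcup_i F i) = \sum_i P (F i))%E.
Proof.
move=> mF dF; rewrite measure_fin_bigcup//.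
- rewrite [X in _ = X](@fsbig_seq _ _ _ I (index_enum I) (fun i => P (F i)))//.
    by apply: eq_fsbigl; apply/seteqP; split => i //= _; rewrite mem_index_enum.
  exact: index_enum_uniq.
- exact: finite_finset.
- by move=> i j _ _ [w [Fi Fj]]; exact: dF Fi Fj.
Qed.

Lemma big_option (R : nmodType) (I : finType) (F : option I -> R) :
  \sum_(o : option I) F o = F None + \sum_(i : I) F (Some i).
Proof.
rewrite (bigD1 None)//=; congr (_ + _).
rewrite (reindex_omap Some id) => [|[]]//.
by apply: eq_bigl => i; rewrite /= eqxx.
Qed.

Section counts_of_independent_family.
Variables (R : realType) (d : measure_display) (T : measurableType d).
Variables (P : probability T R) (I : choiceType) (X : I -> T -> R) (n : nat).
Variable A : 'I_n -> set R.
Hypotheses (mX : forall i, measurable_fun setT (X i))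
  (indX : mutually_independent P X) (mA : forall j, measurable (A j))
  (disjA : forall x j j', A j x -> A j' x -> j = j').

Definition counts_event (J : seq I) (k : {ffun 'I_n -> nat}) : set T :=
  [set w | forall j, count (fun i => `[< A j (X i w) >]) J = k j].

Definition cell_prob (i : I) (j : 'I_n) : R := fine (P (X i @^-1` A j)).

Let C (o : option 'I_n) : set R :=
  if o is Some j then A j else ~` \bigcup_j A j.

Let mC o : measurable (C o).
Proof.
case: o => [j|] /=; first exact: mA.
by apply: measurableC; apply: countable_bigcupT_measurable => //; exact: countableP.
Qed.

Let CN x : C None x <-> forall j, ~ A j x.
Proof.
by split => [h j jx|h [j _ jx]]; [apply: h; exists j|exact: h jx].
Qed.

Let mXC i B : measurable B -> measurable (X i @^-1` B).
Proof. by move=> mB; rewrite -[_ @^-1` _]setTI; exact: mX. Qed.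

Let C_disj x o o' : C o x -> C o' x -> o = o'.
Proof.
case: o => [j|]; case: o' => [j'|] //.
- by move=> h h'; congr Some; exact: disjA h h'.
- by move=> h /CN /(_ j).
- by move=> /CN h /h.
Qed.

Let C_cover x : exists o, C o x.
Proof.
have [[j jx]|h] := pselect (exists j, A j x); first by exists (Some j).
by exists None; apply/CN => j jx; apply: h; exists j.
Qed.

Let prob_split i (F : set T) : measurable F ->
  P F = (\sum_(o : option 'I_n) P (F `&` X i @^-1` C o))%E.
Proof.
move=> mF.
transitivity (P (\bigcup_(o : option 'I_n) (F `&` X i @^-1` C o))).
  congr (P _); apply/seteqP; split => w; last by case=> o _ [].
  by move=> Fw; have [c cP] := C_cover (X i w); exists c.
apply: probability_bigcup_fintype.
- by move=> o; apply: measurableI => //; exact: mXC.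
- by move=> o o' w [_ h] [_ h']; exact: C_disj h h'.
Qed.

Let cell (i : I) (o : option 'I_n) : R := fine (P (X i @^-1` C o)).

Let cellE i o : P (X i @^-1` C o) = (cell i o)%:E.
Proof. by rewrite /cell fineK// fin_num_measure//; exact: mXC. Qed.

Let cell_None i : cell i None = 1 - \sum_j cell_prob i j.
Proof.
have := @prob_split i setT measurableT; rewrite [X in X = _]probability_setT.
under eq_bigr do rewrite setTI cellE.
by rewrite sumEFin big_option/= => -[->]; rewrite addrK.
Qed.

Let rest (J : seq I) (k : {ffun 'I_n -> nat}) (o : option 'I_n) : set T :=
  if o is Some j then (if (0 < k j)%N then counts_event J (decr k j) else set0)
  else counts_event J k.

Let counts_event_cons i J k o :
  counts_event (i :: J) k `&` X i @^-1` C o = rest J k o `&` X i @^-1` C o.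
Proof.
apply/seteqP; split => w [h Cw]; (split; last exact: Cw).
- case: o Cw h => [j|] /= Cw h.
    have hj := h j; rewrite /= (asboolT Cw) in hj.
    have kj : (0 < k j)%N by rewrite -hj.
    rewrite kj => j'; rewrite ffunE; case: eqP => [->|/eqP jj'].
      by rewrite -hj.
    rewrite -h /=; case: asboolP => // h'.
    by move: jj'; rewrite (disjA h' Cw) eqxx.
  move=> j; rewrite -h /=; case: asboolP => // h'.
  by move/CN : Cw => /(_ j h').
- case: o Cw h => [j|] /= Cw.
    case: ifPn => // kj h j'; have := h j'; rewrite ffunE.
    case: eqP => [-> hj|/eqP jj' hj].
      by rewrite /= (asboolT Cw) hj; case: (k j) kj.
    rewrite /= hj; case: asboolP => // h'.
    by move: jj'; rewrite (disjA h' Cw) eqxx.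
  move=> h j; rewrite /= h; case: asboolP => // h'.
  by move/CN : Cw => /(_ j h').
Qed.

Lemma measurable_counts_event J k : measurable (counts_event J k).
Proof.
elim: J k => [|i J IH] k.
  have [h|h] := pselect (forall j, 0%N = k j).
    by rewrite (_ : counts_event _ _ = setT)//; apply/seteqP; split.
  by rewrite (_ : counts_event _ _ = set0)//; apply/seteqP; split => // w.
have -> : counts_event (i :: J) k =
    \bigcup_(o : option 'I_n) (counts_event (i :: J) k `&` X i @^-1` C o).
  apply/seteqP; split => w; last by case=> o _ [].
  by move=> Fw; have [c cP] := C_cover (X i w); exists c.
apply: countable_bigcupT_measurable => [|o]; first exact: countableP.
rewrite counts_event_cons; apply: measurableI; last exact: mXC.
by case: o => [j|] /=; [case: ifP|].
Qed.

(** The induction adds the indices of J one by one, and needs the events of the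
    indices J' that are still to be added in the intersection. *)
Lemma probability_counts_event_joint J k J' B : uniq (J ++ J') ->
  (forall i, measurable (B i)) ->
  P (counts_event J k `&` \bigcap_(i in [set` J']) (X i @^-1` B i)) =
  ((counts_law cell_prob J k)%:E * \prod_(i <- J') P (X i @^-1` B i))%E.
Proof.
elim: J k J' B => [|i J IH] k J' B /=.
  move=> uJ' mB; rewrite -(indX uJ' mB); case: eqP => [->|k0].
    rewrite mul1e; congr (P _); apply/seteqP; split => w; first by case.
    by move=> h; split => // j; rewrite ffunE.
  rewrite mul0e (_ : _ `&` _ = set0) ?measure0//.
  apply/seteqP; split => w // -[h _]; apply: k0.
  by apply/ffunP => j; rewrite ffunE -h.
move=> /andP[iJ uJ] mB.
have /andP[iJ1 iJ'] : (i \notin J) && (i \notin J').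
  by rewrite -negb_or -mem_cat.
have mBig : measurable (\bigcap_(i in [set` J']) (X i @^-1` B i)).
  by apply: fin_bigcap_measurable => [|i1 _]; [exact: finite_seq|exact: mXC].
rewrite (@prob_split i); last by apply: measurableI => //; exact: measurable_counts_event.
pose B' o i' := if i' == i then C o else B i'.
have mB' o i' : measurable (B' o i') by rewrite /B'; case: ifP.
have u' : uniq (J ++ (i :: J')).
  by rewrite -(perm_uniq (permEl (perm_catCA [:: i] J J'))) /= iJ.
have stepE o : (P (counts_event (i :: J) k `&`
      \bigcap_(i in [set` J']) (X i @^-1` B i) `&` X i @^-1` C o) =
    P (rest J k o `&` \bigcap_(i' in [set` i :: J']) (X i' @^-1` B' o i')))%E.
  rewrite setIAC counts_event_cons -setIA; congr (P (_ `&` _)).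
  apply/seteqP; split => w.
    move=> [h1 h2] i' /=; rewrite inE /B'; case: eqP => [-> //|_ /= i'J'].
    exact: h2.
  move=> h; split.
    by have := h i; rewrite /= inE eqxx /B' eqxx; apply.
  move=> i' /= i'J'; have := h i'; rewrite /= inE i'J' orbT /B'.
  by case: eqP => [i'i|_]; [move: iJ'; rewrite -i'i i'J'|apply].
have prodE o : (\prod_(i' <- (i :: J')) P (X i' @^-1` B' o i') =
    (cell i o)%:E * \prod_(i' <- J') P (X i' @^-1` B i'))%E.
  rewrite big_cons /B' eqxx cellE; congr (_ * _)%E.
  apply: eq_big_seq => i' i'J'; case: eqP => // i'i.
  by move: iJ'; rewrite -i'i i'J'.
set Q := (\prod_(i' <- J') _)%E.
have [q qE] : exists q, Q = q%:E.
  exists (fine Q); rewrite fineK// /Q; apply: prode_fin_num => i' _.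
  by rewrite fin_num_measure//; exact: mXC.
have restE o : P (rest J k o `&` \bigcap_(i' in [set` i :: J']) (X i' @^-1` B' o i'))
  = ((if o is Some j then if (0 < k j)%N then counts_law cell_prob J (decr k j) else 0
     else counts_law cell_prob J k) * cell i o * q)%:E.
  case: o => [j|] /=; last first.
    by rewrite (IH _ _ _ u' (mB' None)) prodE -/Q qE -!EFinM mulrA.
  case: ifP => _; last by rewrite set0I measure0 !mul0r.
  by rewrite (IH _ _ _ u' (mB' (Some j))) prodE -/Q qE -!EFinM mulrA.
rewrite (eq_bigr _ (fun c _ => etrans (stepE c) (restE c))).
rewrite sumEFin qE -EFinM big_option/= cell_None mulrDl; congr (_ + _)%:E.
  by rewrite [_ * (1 - _)]mulrC.
rewrite mulr_suml; apply: eq_bigr => j _; congr (_ * _).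
by rewrite mulrC.
Qed.

Lemma probability_counts_event J k : uniq J ->
  P (counts_event J k) = (counts_law cell_prob J k)%:E.
Proof.
move=> uJ; have := @probability_counts_event_joint J k [::] (fun=> setT).
rewrite cats0 big_nil mule1 => /(_ uJ) <-//.
congr (P _); apply/seteqP; split => w //; last by case.
Qed.

End counts_of_independent_family.

(** * The intensity of the energies in a fixed field *)

Lemma cosh_gt0 (R : realType) (x : R) : 0 < cosh x.
Proof. by rewrite /cosh divr_gt0// addr_gt0 ?expR_gt0. Qed.

(** Under a product measure, centred functions of distinct coordinates are
    uncorrelated, so only the diagonal terms of the square survive. *)
Lemma product_weight_variance (R : realType) (n : nat)
    (w x : 'I_n -> bool -> R) :
  (forall i, \sum_s w i s = 1) -> (forall i, \sum_s w i s * x i s = 0) ->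
  \sum_(sigma : spins n) (\prod_i w i (sigma i)) * (\sum_i x i (sigma i)) ^+ 2 =
  \sum_i \sum_s w i s * x i s ^+ 2.
Proof.
move=> w1 wx.
pose G i j l (s : bool) := w l s * (if l == i then x l s else 1) *
  (if l == j then x l s else 1).
have GE i j : \sum_(sigma : spins n) (\prod_l w l (sigma l)) *
    (x i (sigma i) * x j (sigma j)) = \prod_l \sum_s G i j l s.
  rewrite bigA_distr_bigA; apply: eq_bigr => sigma _.
  rewrite /G !big_split/= -mulrA; congr (_ * (_ * _)).
    by rewrite -big_mkcond big_pred1_eq.
  by rewrite -big_mkcond big_pred1_eq.
have E : \sum_(sigma : spins n) (\prod_i w i (sigma i)) * (\sum_i x i (sigma i)) ^+ 2
    = \sum_i \sum_j \sum_(sigma : spins n) (\prod_l w l (sigma l)) *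
        (x i (sigma i) * x j (sigma j)).
  transitivity (\sum_(sigma : spins n) \sum_i \sum_j (\prod_l w l (sigma l)) *
        (x i (sigma i) * x j (sigma j))).
    apply: eq_bigr => sigma _; rewrite expr2 mulr_suml mulr_sumr.
    by apply: eq_bigr => i _; rewrite mulr_sumr mulr_sumr.
  rewrite exchange_big/=; apply: eq_bigr => i _.
  by rewrite exchange_big.
rewrite E; apply: eq_bigr => i _.
rewrite (bigD1 i)//= [X in _ + X]big1 ?addr0 => [|j ji]; rewrite GE (bigD1 i)//=.
  rewrite [X in _ * X]big1 ?mulr1 => [|l li].
    by apply: eq_bigr => s _; rewrite /G eqxx -mulrA expr2.
  by rewrite -[RHS](w1 l); apply: eq_bigr => s _; rewrite /G (negbTE li) !mulr1.
rewrite [X in X * _](_ : _ = 0) ?mul0r//.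
rewrite -[RHS](wx i); apply: eq_bigr => s _.
by rewrite /G eqxx eq_sym (negbTE ji) mulr1.
Qed.

Lemma is_derive_gauss (R : realType) (x : R) :
  is_derive x 1 (fun y : R => expR (- (y ^+ 2 / 2))) (- x * expR (- (x ^+ 2 / 2))).
Proof.
have dg : is_derive x 1 (fun y : R => - (y ^+ 2 / 2)) (- x).
  have := is_deriveZ (- 2^-1) (is_deriveX 2 (is_derive_id x (1 : R))).
  rewrite exprfctE (_ : _ \*: _ = fun y : R => - (y ^+ 2 / 2)); last first.
    apply/funext => y /=; rewrite -[LHS]/(- 2^-1 * y ^+ 2); ring.
  move=> h; apply: (is_derive_eq h).
  by rewrite -[LHS]/(- 2^-1 * (2 * x ^+ 1 * 1)); field.
have := @is_derive1_comp _ (@expR R) (fun y : R => - (y ^+ 2 / 2)) x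
  (expR (- (x ^+ 2 / 2))) (- x) (is_derive_expR _) dg.
by rewrite [X in is_derive _ _ _ X]mulrC.
Qed.

(** The derivative is at most |x| exp (- x^2 / 2), and |x| <= 1 + x^2 / 2. *)
Lemma gauss_lipschitz (R : realType) (s t : R) :
  `|expR (- (s ^+ 2 / 2)) - expR (- (t ^+ 2 / 2))| <= `|s - t|.
Proof.
wlog st : s t / s <= t.
  move=> H; have [|/ltW ts] := leP s t; first exact: H.
  by rewrite distrC (distrC s); exact: H.
have [|c _ ] := @MVT_segment R (fun y : R => expR (- (y ^+ 2 / 2)))
    (fun x => - x * expR (- (x ^+ 2 / 2))) s t st (fun x _ => is_derive_gauss x).
  apply: continuous_subspaceT => x; apply: differentiable_continuous.
  by apply/derivable1_diffP; have [] := is_derive_gauss x.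
rewrite distrC => ->; rewrite (distrC s) normrM ler_piMl//.
rewrite normrM normrN (ger0_norm (expR_ge0 _)) expRN ler_pdivrMr ?expR_gt0// mul1r.
apply: le_trans (expR_ge1Dx _).
by rewrite -(real_normK (num_real c)); have := sqr_ge0 (`|c| - 1); rewrite !expr2; nra.
Qed.

Section tilted_field.
Variables (R : realType) (N : nat) (h : nat -> R) (b : R).
Hypothesis (N_gt0 : (0 < N)%N).

Definition field_energy (sigma : spins N) : R :=
  \sum_(i < N) h i * (-1) ^+ sigma i.

Definition field_mean : R := \sum_(i < N) h i * tanh (b * h i).

(** The summand of the exponential rate of the number of configurations near
    the typical energy; the equation for the critical parameter says that its
    expectation vanishes. *)
Definition field_excess (x : R) : R :=
  ln 2 + ln (cosh (b * x)) - b * (x * tanh (b * x)) - b ^+ 2 / 2.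

Let w (i : 'I_N) (s : bool) : R :=
  expR (b * (h i * (-1) ^+ s)) / (2 * cosh (b * h i)).

Let nu (sigma : spins N) := \prod_i w i (sigma i).

Let nu_ge0 sigma : 0 <= nu sigma.
Proof.
by apply: prodr_ge0 => i _; rewrite divr_ge0 ?expR_ge0// mulr_ge0// ltW// cosh_gt0.
Qed.

Let two_cosh (x : R) : 2 * cosh x = expR x + expR (- x).
Proof. by rewrite /cosh mulrC divfK. Qed.

Let sumbool (F : bool -> R) : \sum_s F s = F false + F true.
Proof. by rewrite big_bool addrC. Qed.

Let w1 i : \sum_s w i s = 1.
Proof.
rewrite sumbool /w expr0 expr1 mulr1 mulrN1 mulrN -mulrDl two_cosh divff//.
by rewrite gt_eqF// addr_gt0 ?expR_gt0.
Qed.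

Let nu1 : \sum_sigma nu sigma = 1.
Proof.
by rewrite -(bigA_distr_bigA w) big1// => i _; exact: w1.
Qed.

Let x (i : 'I_N) (s : bool) : R := h i * ((-1) ^+ s - tanh (b * h i)).

Let wx i : \sum_s w i s * x i s = 0.
Proof.
rewrite sumbool /w /x expr0 expr1 mulr1 mulrN1 mulrN /tanh /sinh /cosh.
have := expR_gt0 (b * h i); have := expR_gt0 (- (b * h i)).
move: (expR _) (expR _) => u v u0 v0; field.
by rewrite gt_eqF// addr_gt0.
Qed.

Let wx2 i : \sum_s w i s * x i s ^+ 2 <= h i ^+ 2.
Proof.
rewrite sumbool /w /x expr0 expr1 mulr1 mulrN1 mulrN /tanh /sinh /cosh.
have := expR_gt0 (b * h i); have := expR_gt0 (- (b * h i)).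
move: (expR _) (expR _) => u v u0 v0.
have uv : 0 < v + u by rewrite addr_gt0.
rewrite [leLHS](_ : _ = h i ^+ 2 * (1 - ((v - u) / (v + u)) ^+ 2)).
  by rewrite ler_piMr ?sqr_ge0// gerBl sqr_ge0.
by field; rewrite gt_eqF.
Qed.

Let W sigma := field_energy sigma - field_mean.

Let W_var : \sum_sigma nu sigma * W sigma ^+ 2 <= \sum_(i < N) h i ^+ 2.
Proof.
rewrite (eq_bigr (fun sigma => nu sigma * (\sum_i x i (sigma i)) ^+ 2)).
  rewrite product_weight_variance//; apply: ler_sum => i _; exact: wx2.
move=> sigma _; congr (_ * _ ^+ 2); rewrite /W /field_energy /field_mean.
by rewrite -sumrB; apply: eq_bigr => i _; rewrite /x mulrBr.
Qed.

Let W_mean : \sum_sigma nu sigma * W sigma = 0.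
Proof.
rewrite (eq_bigr (fun sigma => \sum_i nu sigma * x i (sigma i))); last first.
  move=> sigma _; rewrite -mulr_sumr; congr (_ * _); rewrite /W /field_energy.
  by rewrite /field_mean -sumrB; apply: eq_bigr => i _; rewrite /x mulrBr.
rewrite exchange_big/= big1// => i _.
pose G l (s : bool) := w l s * (if l == i then x l s else 1).
rewrite (eq_bigr (fun sigma : spins N => \prod_l G l (sigma l))).
  rewrite -bigA_distr_bigA (bigD1 i)//=.
  rewrite [X in X * _](_ : _ = 0) ?mul0r// -[RHS](wx i).
  by apply: eq_bigr => s _; rewrite /G eqxx.
move=> sigma _; rewrite /G big_split/=; congr (_ * _).
by rewrite -big_mkcond big_pred1_eq.
Qed.

Let NR0 : 0 < N%:R :> R. Proof. by rewrite ltr0n. Qed.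

Let gauss_avg (u : R) : R :=
  \sum_sigma nu sigma * expR (- ((u - W sigma) ^+ 2 / (2 * N%:R))).

Let gauss_avg_le1 u : gauss_avg u <= 1.
Proof.
rewrite -nu1; apply: ler_sum => sigma _; rewrite ler_piMr//.
by rewrite expR_le1 oppr_le0 divr_ge0 ?sqr_ge0// mulr_ge0.
Qed.

(** Jensen's inequality, in the form of the tangent of the exponential at the
    mean - v: the mean square of u - W is u^2 plus the variance of W. *)
Let gauss_avg_ge u :
  expR (- ((u ^+ 2 + \sum_(i < N) h i ^+ 2) / (2 * N%:R))) <= gauss_avg u.
Proof.
set V := \sum_(i < N) _; set v := _ / _.
have v_ge : \sum_sigma nu sigma * ((u - W sigma) ^+ 2 / (2 * N%:R)) <= v.
  rewrite (eq_bigr (fun sigma => nu sigma * (u - W sigma) ^+ 2 * (2 * N%:R)^-1)).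
    rewrite -mulr_suml /v ler_wpM2r// ?invr_ge0 ?mulr_ge0//.
    rewrite (eq_bigr (fun sigma => nu sigma * u ^+ 2 +
        (- 2 * u) * (nu sigma * W sigma) + nu sigma * W sigma ^+ 2)); last first.
      by move=> sigma _; ring.
    rewrite !big_split/= -mulr_suml nu1 -mulr_sumr W_mean mulr0 addr0 mul1r.
    by rewrite lerD2l.
  by move=> sigma _; rewrite mulrA.
have point sigma : expR (- v) * (1 + (v - (u - W sigma) ^+ 2 / (2 * N%:R))) <=
    expR (- ((u - W sigma) ^+ 2 / (2 * N%:R))).
  set z := _ / _; have -> : expR (- z) = expR (- v) * expR (v - z).
    by rewrite -expRD; congr expR; ring.
  by rewrite ler_wpM2l ?expR_ge0// expR_ge1Dx.
apply: (@le_trans _ _ (\sum_sigma nu sigma *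
    (expR (- v) * (1 + (v - (u - W sigma) ^+ 2 / (2 * N%:R)))))); last first.
  by apply: ler_sum => sigma _; rewrite ler_wpM2l.
rewrite (eq_bigr (fun sigma => expR (- v) * (nu sigma * (1 + v) -
    nu sigma * ((u - W sigma) ^+ 2 / (2 * N%:R))))); last first.
  by move=> sigma _; ring.
rewrite -mulr_sumr ler_peMr ?expR_ge0// sumrB -mulr_suml nu1 mul1r.
by rewrite -addrA lerDl subr_ge0.
Qed.

Let gauss_lip (s t : R) :
  `|expR (- (s ^+ 2 / (2 * N%:R))) - expR (- (t ^+ 2 / (2 * N%:R)))| <=
  `|s - t| / Num.sqrt N%:R.
Proof.
have sN0 : 0 < Num.sqrt N%:R :> R by rewrite sqrtr_gt0.
have E (z : R) : z ^+ 2 / (2 * N%:R) = (z / Num.sqrt N%:R) ^+ 2 / 2.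
  by rewrite expr_div_n sqr_sqrtr ?ltW//; field; rewrite gt_eqF.
rewrite !E; apply: (le_trans (gauss_lipschitz _ _)).
by rewrite -mulrBl normrM [X in _ * X]ger0_norm// invr_ge0 ltW.
Qed.

Let gauss_avg_lip u u' : `|gauss_avg u - gauss_avg u'| <= `|u - u'| / Num.sqrt N%:R.
Proof.
rewrite /gauss_avg -sumrB; apply: (le_trans (ler_norm_sum _ _ _)).
have -> : `|u - u'| / Num.sqrt N%:R =
    \sum_sigma nu sigma * (`|u - u'| / Num.sqrt N%:R).
  by rewrite -mulr_suml nu1 mul1r.
apply: ler_sum => sigma _.
rewrite -mulrBr normrM (ger0_norm (nu_ge0 _)) ler_wpM2l//.
have := gauss_lip (u - W sigma) (u' - W sigma).
rewrite (_ : _ - (u' - W sigma) = u - u') => [|]; [exact: id|by ring].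
Qed.

(** The density of the expected number of configurations with energy near y, for
    Gaussian energies of variance N in the field h. *)
Definition gibbs_intensity (y : R) : R :=
  \sum_sigma normal_pdf 0 (Num.sqrt N%:R) (y - field_energy sigma).

Let Z := \prod_(i < N) (2 * cosh (b * h i)).

Let nuE sigma : expR (b * field_energy sigma) = Z * nu sigma.
Proof.
rewrite /nu /Z -big_split/= /field_energy mulr_sumr expR_sum.
apply: eq_bigr => i _; by rewrite /w [RHS]mulrC divfK// gt_eqF// mulr_gt0// cosh_gt0.
Qed.

Let gibbs_intensity_tilt u :
  gibbs_intensity (field_mean + N%:R * b + u) =
  normal_peak (Num.sqrt N%:R) * expR (\sum_(i < N) field_excess (h i) - b * u) *
  gauss_avg u.
Proof.
have sN0 : Num.sqrt N%:R != 0 :> R by rewrite gt_eqF// sqrtr_gt0.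
have ZE : Z = expR (\sum_(i < N) (ln 2 + ln (cosh (b * h i)))).
  rewrite expR_sum; apply: eq_bigr => i _.
  by rewrite -lnM ?posrE ?cosh_gt0// lnK// posrE mulr_gt0 ?cosh_gt0.
have sE : \sum_(i < N) field_excess (h i) = \sum_(i < N) (ln 2 + ln (cosh (b * h i)))
    - b * field_mean - N%:R * (b ^+ 2 / 2).
  have -> : N%:R * (b ^+ 2 / 2) = \sum_(i < N) (b ^+ 2 / 2).
    by rewrite mulr_natl sumr_const card_ord.
  rewrite /field_mean mulr_sumr -sumrB -sumrB.
  by apply: eq_bigr => i _; rewrite /field_excess.
rewrite /gibbs_intensity /gauss_avg mulr_sumr; apply: eq_bigr => sigma _.
rewrite normal_pdfE// /normal_fun subr0 -mulrA; congr (_ * _).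
have nuE' : nu sigma = expR (b * field_energy sigma -
    \sum_(i < N) (ln 2 + ln (cosh (b * h i)))).
  by rewrite expRB nuE -ZE mulrC mulKf// gt_eqF// ZE expR_gt0.
rewrite nuE' sE -!expRD sqr_sqrtr ?ltW// -(mulr_natl N%:R); congr expR; rewrite /W.
move: (\sum_(i < N) _) field_mean (field_energy sigma) => A m Y.
by field; rewrite gt_eqF.
Qed.

(** Completing the square. With Y the field energy, the product of the Gaussian
    weight at distance y - Y and the factor exp (b y) is, up to constants, the
    product of exp (b Y), which after normalization is a product measure nu on
    the spins, and of a Gaussian weight recentred at y = Y + N b. Under nu, Y is
    centred at [field_mean] with variance at most the sum of h i ^ 2. The
    intensity is thus exponential with rate b near [field_mean] + N b, up to
    an average g of Gaussian weights of width sqrt N, which varies slowly. *)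
Lemma gibbs_intensity_profile : exists g : R -> R,
  [/\ forall u, gibbs_intensity (field_mean + N%:R * b + u) =
        normal_peak (Num.sqrt N%:R) *
        expR (\sum_(i < N) field_excess (h i) - b * u) * g u,
      forall u, g u <= 1,
      forall u, expR (- ((u ^+ 2 + \sum_(i < N) h i ^+ 2) / (2 * N%:R))) <= g u &
      forall u u', `|g u - g u'| <= `|u - u'| / Num.sqrt N%:R].
Proof.
by exists gauss_avg; split; [exact: gibbs_intensity_tilt|exact: gauss_avg_le1|
  exact: gauss_avg_ge|exact: gauss_avg_lip].
Qed.

End tilted_field.

Lemma normal_peak_sqrt (R : realType) (N : nat) :
  normal_peak (Num.sqrt N%:R) = (Num.sqrt (pi *+ 2) * Num.sqrt N%:R)^-1 :> R.
Proof.
by rewrite /normal_peak sqr_sqrtr// -mulrnAr mulrC sqrtrM// mulrn_wge0// pi_ge0.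
Qed.

Lemma sqrt_2pi_ge1 (R : realType) : 1 <= Num.sqrt (pi *+ 2) :> R.
Proof.
have pi2 := pi_ge2 R; have pi0 := pi_ge0 R.
rewrite -[leLHS]sqrtr1 ler_sqrt; first by rewrite mulr2n; lra.
exact: mulrn_wge0.
Qed.

(** The profile multiplies exp (- b u) by a function bounded above and below on
    the scale sqrt N, while the prefactor is exp (O (sqrt N)): for a
    suitable k2 and N large, the intensity is above C at u = - k2 * sqrt N and
    below C at u = k2 * sqrt N. The centring a is then given by the intermediate value
    theorem, so that the intensity seen from a is close to C * exp (- b y) on
    compact sets. That a lies within O (sqrt N) of the centre of the profile
    keeps the average of Gaussian weights away from 0, whence the bound K'. *)
Lemma gibbs_intensity_centered (R : realType) (b C K : R) :
  0 < b -> 0 < C -> 0 <= K ->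
  exists N0 K', 0 <= K' /\ forall N (h : nat -> R), (N0 <= N)%N -> (0 < N)%N ->
    `|\sum_(i < N) field_excess b (h i)| <= K * Num.sqrt N%:R ->
    \sum_(i < N) h i ^+ 2 <= K * N%:R ->
    exists a, forall y,
      expR (b * y) * gibbs_intensity N h (a + y) <= K' /\
      `|expR (b * y) * gibbs_intensity N h (a + y) - C| <=
        K' * (`|y| / Num.sqrt N%:R).
Proof.
move=> b0 C0 K0.
(* b * k2 = K + 1 dominates the fluctuation K * sqrt N of the excess *)
pose k2 := (K + 1) / b.
have k20 : 0 <= k2 by rewrite divr_ge0 ?ltW// ltr_wpDl.
pose E := expR ((k2 ^+ 2 + K) / 2).
have E0 : 0 < E by exact: expR_gt0.
pose k := Num.sqrt (pi *+ 2) : R.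
have k1 : 1 <= k by exact: sqrt_2pi_ge1.
have k0 : 0 < k by exact: lt_le_trans k1.
pose A := C^-1 + 2 * k * C * E.
have A0 : 0 < A by rewrite addr_gt0 ?invr_gt0// !mulr_gt0.
have [N0 _ N0P] : \forall N \near \oo, A ^+ 2 <= N%:R :> R by exact: nbhs_infty_ger.
exists N0, (C * E); split; first by rewrite mulr_ge0 ?ltW.
move=> N h N0N N_gt0 FK VK.
have NR : 0 < N%:R :> R by rewrite ltr0n.
set s := Num.sqrt N%:R in FK *.
have s0 : 0 < s by rewrite sqrtr_gt0.
have s2 : s ^+ 2 = N%:R by rewrite sqr_sqrtr// ltW.
have As : A <= s.
  rewrite -(ger0_norm (ltW A0)) -sqrtr_sqr ler_sqrt.
    exact: (N0P N).
  exact: ltW.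
have [g [rhoE g1 g_ge g_lip]] := gibbs_intensity_profile h b N_gt0.
set F := \sum_(i < N) field_excess b (h i) in FK rhoE.
set V := \sum_(i < N) h i ^+ 2 in VK g_ge.
set pk := normal_peak _ in rhoE.
have pkE : pk = (k * s)^-1 by exact: normal_peak_sqrt.
have pk0 : 0 < pk by rewrite pkE invr_gt0 mulr_gt0.
have pk_le : pk <= s^-1.
  by rewrite pkE lef_pV2 ?posrE ?mulr_gt0// ler_peMl// ltW.
pose Phi u := pk * expR (F - b * u) * g u.
have g0 u : 0 < g u by apply: lt_le_trans (g_ge u); exact: expR_gt0.
have g_geE u : `|u| <= k2 * s -> E^-1 <= g u.
  move=> uk; apply: le_trans (g_ge u); rewrite /E -expRN ler_expR lerN2.
  rewrite ler_pdivrMr ?mulr_gt0//.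
  have -> : (k2 ^+ 2 + K) / 2 * (2 * N%:R) = k2 ^+ 2 * N%:R + K * N%:R by field.
  rewrite lerD// -s2 -exprMn -real_normK ?num_real//.
  by rewrite ler_pXn2r ?nnegrE// mulr_ge0// ltW.
have g_cont : continuous g.
  move=> u; apply/cvgrPdist_le => e e0; near=> v.
  apply: (le_trans (g_lip u v)); rewrite ler_pdivrMr//.
  near: v; apply: cvgr_dist_le; [exact: cvg_id|by rewrite mulr_gt0].
have Phi_cont : continuous Phi.
  move=> u; apply: cvgM; last exact: g_cont.
  apply: cvgM; first exact: cvg_cst.
  apply: (continuous_comp (f := fun u => F - b * u)); last exact: continuous_expR.
  by apply: cvgB; [exact: cvg_cst|apply: cvgM; [exact: cvg_cst|exact: cvg_id]].
have bk2 : b * k2 = K + 1 by rewrite /k2 mulrC divfK// gt_eqF.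
have hi : Phi (k2 * s) <= C.
  rewrite /Phi (@le_trans _ _ (pk * expR (F - b * (k2 * s))))//.
    by rewrite ler_piMr// mulr_ge0 ?expR_ge0// ltW.
  rewrite (@le_trans _ _ pk)//.
    apply: ler_piMr; first exact: ltW.
    rewrite expR_le1 mulrA bk2.
    by move: FK; rewrite ler_norml => /andP[_]; nra.
  apply: (le_trans pk_le); rewrite -[leRHS]invrK lef_pV2 ?posrE ?invr_gt0//.
  apply: le_trans As; rewrite /A lerDl; apply: ltW; by rewrite !mulr_gt0.
have lo : C <= Phi (- (k2 * s)).
  have gE : E^-1 <= g (- (k2 * s)).
    by apply: g_geE; rewrite normrN ger0_norm// mulr_ge0// ltW.
  have eF : s ^+ 2 / 2 <= expR (F - b * - (k2 * s)).
    apply: (@le_trans _ _ (expR s)).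
      by apply: le_trans (expR_ge1Dxn 1 (ltW s0)); rewrite lerDr.
    rewrite ler_expR mulrN opprK mulrA bk2.
    by move: FK; rewrite ler_norml => /andP[]; nra.
  rewrite /Phi (@le_trans _ _ (pk * (s ^+ 2 / 2) * E^-1))//; last first.
    apply: ler_pM => //; [|by rewrite invr_ge0 ltW|].
      by rewrite mulr_ge0 ?divr_ge0 ?sqr_ge0// ltW.
    by rewrite ler_wpM2l// ltW.
  rewrite ler_pdivlMr// pkE (_ : (k * s)^-1 * (s ^+ 2 / 2) = s / (2 * k)).
    rewrite ler_pdivlMr ?mulr_gt0//; apply: le_trans As.
    rewrite /A (_ : C * E * (2 * k) = 2 * k * C * E); last by ring.
    by rewrite lerDr invr_ge0 ltW.
  by field; rewrite !gt_eqF.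
have [|||d /[!in_itv]/= /andP[d1 d2] Phid] :=
    @IVT R Phi (- (k2 * s)) (k2 * s) C _ _ _.
- have : 0 <= k2 * s by rewrite mulr_ge0// ltW.
  by lra.
- exact: continuous_subspaceT.
- by rewrite ge_min hi orbT /= le_max lo.
exists (field_mean N h b + N%:R * b + d) => y.
rewrite -addrA rhoE.
have DE : expR (b * y) * (pk * expR (F - b * (d + y)) * g (d + y)) =
    pk * expR (F - b * d) * g (d + y).
  have -> : F - b * d = b * y + (F - b * (d + y)) by ring.
  by rewrite [expR (b * y + _)]expRD; ring.
rewrite DE; set D := pk * expR (F - b * d).
have D0 : 0 <= D by rewrite mulr_ge0 ?expR_ge0// ltW.
have DC : D * g d = C by exact: Phid.
have gd : E^-1 <= g d by apply: g_geE; rewrite ler_norml d1.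
have DCE : D <= C * E.
  rewrite -DC -mulrA ler_peMr// -ler_pdivrMr// div1r//.
split; first by apply: le_trans DCE; rewrite ler_piMr.
rewrite -{1}DC -mulrBr normrM (ger0_norm D0) ler_pM//.
by apply: (le_trans (g_lip _ _)); rewrite addrAC subrr add0r.
Unshelve. all: by end_near. Qed.

(** * Independence and iterated integrals *)

Section independent_fubini.
Variables (R : realType) (d : measure_display) (T : measurableType d).
Variables (P : probability T R) (d1 d2 : measure_display).
Variables (T1 : measurableType d1) (T2 : measurableType d2).
Variables (U : T -> T1) (V : T -> T2).
Hypotheses (mU : measurable_fun setT U) (mV : measurable_fun setT V).
Hypothesis indep : forall A B, measurable A -> measurable B ->
  (P (U @^-1` A `&` V @^-1` B) = P (U @^-1` A) * P (V @^-1` B))%E.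

Let U' : {RV P >-> T1} := HB.pack U (isMeasurableFun.Build _ _ _ _ _ mU).
Let V' : {RV P >-> T2} := HB.pack V (isMeasurableFun.Build _ _ _ _ _ mV).
Let mUV : measurable_fun setT (fun w => (U w, V w)).
Proof. exact: measurable_fun_pair. Qed.
Let UV : {RV P >-> (T1 * T2)%type} :=
  HB.pack (fun w => (U w, V w)) (isMeasurableFun.Build _ _ _ _ _ mUV).

(** Independence says that the law of (U, V) is a product measure. *)
Lemma independent_fubini (F : T1 * T2 -> R) (B : R) :
  measurable_fun setT F -> (forall z, `|F z| <= B) ->
  measurable_fun setT (fun y => (\int[P]_w F (U w, y))%R) /\
  (\int[P]_w F (U w, V w))%R = (\int[P]_w' (\int[P]_w F (U w, V w')))%R.
Proof.
move=> mF FB.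
have mFe : measurable_fun setT (EFin \o F) by exact/measurable_EFinP.
have B0 : 0 <= B by apply: le_trans (FB (point, point)).
have mFV y : measurable_fun setT (fun x => F (x, y)) by exact: measurable_fun_pair1.
have mFU y : measurable_fun setT (fun w => F (U w, y)).
  exact: (measurableT_comp (mFV y) mU).
have iFU y : P.-integrable setT (EFin \o (fun w => F (U w, y))).
  exact: (measurable_integrable_bounded P (mFU y) (fun w => FB _)).
have inner y : (\int[distribution P U']_x (F (x, y))%:E =
    (\int[P]_w F (U w, y))%R%:E)%E.
  rewrite (integral_distribution (X := U') ((measurable_EFinP _ _).2 (mFV y)) (iFU y)).
  by rewrite /Rintegral fineK//; exact: integrable_fin_num (iFU y).
have iF (Q : probability (T1 * T2)%type R) : Q.-integrable setT (EFin \o F).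
  exact: measurable_integrable_bounded mF FB.
have prod1 : ((distribution P U' \x distribution P V') setT = 1)%E.
  rewrite -setXTT product_measure1E// -[RHS]mule1.
  congr (_ * _)%E; exact: probability_setT.
have iprod : (distribution P U' \x distribution P V')%E.-integrable setT (EFin \o F).
  apply: measurable_bounded_integrable => //; first by rewrite [X in (X < _)%E]prod1 ltry.
  exists B; split; first exact: num_real.
  by move=> x Bx z _; exact: le_trans (FB z) (ltW Bx).
have mG : measurable_fun setT (fun y => (\int[P]_w F (U w, y))%R).
  apply/measurable_EFinP.
  rewrite (_ : _ \o _ = fun y => (\int[distribution P U']_x (F (x, y))%:E)%E).
    exact: (measurable_fubini_G iprod).
  by apply/funext => y /=; rewrite inner.
split => //.
have GB y : `|(\int[P]_w F (U w, y))%R| <= B.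
  exact: (normr_Rintegral_le P (mFU y) (fun w => FB _)).
have : (\int[P]_w (F (U w, V w))%:E = \int[P]_w' (\int[P]_w F (U w, V w'))%R%:E)%E.
  transitivity (\int[distribution P UV]_z (EFin \o F) z)%E.
    rewrite (integral_distribution (X := UV))//.
    apply: (@measurable_integrable_bounded _ _ _ _ (fun w => F (U w, V w)) B) => //.
    exact: (measurableT_comp mF mUV).
  transitivity (\int[distribution P V']_y (\int[P]_w F (U w, y))%R%:E)%E; last first.
    rewrite (integral_distribution (X := V'))//; first exact/measurable_EFinP.
    apply: (@measurable_integrable_bounded _ _ _ _
      (fun w' => (\int[P]_w F (U w, V w'))%R) B) => //.
    exact: (measurableT_comp mG mV).
  under [RHS]eq_integral do rewrite -inner.
  rewrite (integral21_prod_meas1 iprod).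
  apply: eq_measure_integral => A mA _.
  apply/esym; apply: (product_measure_unique (m1 := distribution P U')
  (m2 := distribution P V') (m' := distribution P UV)).
  by move=> A1 B1 mA1 mB1; exact: indep.
exact: mA.
by move=> h; rewrite /Rintegral h.
Qed.

End independent_fubini.

(** * Fluctuations of the field *)

Lemma expR_norm_cosh (R : realType) (y : R) :
  expR `|y| + expR (- `|y|) = 2 * cosh y.
Proof.
rewrite /cosh mulrC divfK//; have [y0|y0] := leP 0 y.
  by rewrite ger0_norm.
by rewrite ltr0_norm// opprK addrC.
Qed.

Lemma ln_cosh_le (R : realType) (y : R) : ln (cosh y) <= `|y|.
Proof.
rewrite -[leRHS]expRK ler_ln ?posrE ?cosh_gt0 ?expR_gt0//.
have := expR_norm_cosh y; have : expR (- `|y|) <= expR `|y|.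
  by rewrite ler_expR; have := normr_ge0 y; lra.
lra.
Qed.

Lemma ln_cosh_ge (R : realType) (y : R) : `|y| - ln 2 <= ln (cosh y).
Proof.
rewrite -[X in X - _]expRK -ln_div ?posrE ?expR_gt0//.
rewrite ler_ln ?posrE ?cosh_gt0 ?divr_gt0 ?expR_gt0//.
by have := expR_norm_cosh y; have := expR_gt0 (- `|y|); lra.
Qed.

Lemma ln_cosh_ge0 (R : realType) (y : R) : 0 <= ln (cosh y).
Proof.
apply: ln_ge0; have := expR_norm_cosh y; have := expR_gt0 `|y|.
rewrite expRN; set u := expR _ => u0 h.
suff : 2 <= u + u^-1 by lra.
have : 0 <= (u - 1) ^+ 2 / u by rewrite divr_ge0 ?sqr_ge0// ltW.
have -> : (u - 1) ^+ 2 / u = u + u^-1 - 2 by field; rewrite gt_eqF.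
lra.
Qed.

Lemma mul_tanh_norm (R : realType) (y : R) : y * tanh y = `|y| * tanh `|y|.
Proof.
have [y0|y0] := leP 0 y; first by rewrite ger0_norm.
rewrite ltr0_norm// /tanh /sinh /cosh opprK.
rewrite (addrC (expR (- y)) (expR y)) -(opprB (expR y)); ring.
Qed.

Lemma mul_tanh_bounds (R : realType) (y : R) : `|y| - 1 <= y * tanh y <= `|y|.
Proof.
rewrite mul_tanh_norm; move: `|y| (normr_ge0 y) => {}y y0.
have c0 := cosh_gt0 y; have := expR_gt0 y; have := expR_gt0 (- y).
move: c0; rewrite /tanh /sinh /cosh.
have : 1 + 2 * y <= expR y / expR (- y).
  by rewrite -expRB opprK (le_trans (expR_ge1Dx _))// ler_expR; lra.
move: (expR y) (expR (- y)) => u v + c0 v0 u0.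
rewrite ler_pdivlMr// => yuv.
have uv0 : 0 < u + v by rewrite addr_gt0.
have -> : (u - v) / 2 / ((u + v) / 2) = 1 - 2 * v / (u + v).
  by field; rewrite gt_eqF.
apply/andP; split.
  rewrite mulrBr mulr1 lerD2l lerN2 mulrA ler_pdivrMr// mul1r; nra.
by rewrite ler_piMr// gerBl divr_ge0 ?mulr_ge0// ltW.
Qed.

(** ln (cosh y) and y * tanh y both differ from |y| by a bounded quantity, so the
    excess is bounded although the field is not. *)
Lemma field_excess_bounded (R : realType) (b x : R) :
  `|field_excess b x| <= 2 + b ^+ 2 / 2.
Proof.
rewrite /field_excess (_ : b * (x * tanh (b * x)) = b * x * tanh (b * x)); last by ring.
have := ln_cosh_le (b * x); have := ln_cosh_ge (b * x).
have /andP[] := mul_tanh_bounds (b * x).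
have l2 : ln 2 <= 1 :> R.
  by have := @le_ln1Dx R 1; rewrite -natr1; apply; lra.
have : 0 <= ln 2 :> R by rewrite ln_ge0//; lra.
have := sqr_ge0 b.
by move=> *; rewrite ler_norml; apply/andP; split; lra.
Qed.

Lemma measurable_cosh (R : realType) : measurable_fun setT (@cosh R).
Proof.
apply: measurable_funM => //; apply: measurable_funD.
  exact: measurable_expR.
by apply: measurableT_comp => //; exact: measurable_expR.
Qed.

Lemma measurable_tanh (R : realType) : measurable_fun setT (@tanh R).
Proof.
apply: continuous_measurable_fun => x.
apply: cvgM.
  apply: cvgM; last exact: cvg_cst.
  apply: cvgB; first exact: continuous_expR.
  by apply: continuous_comp; [exact: opp_continuous|exact: continuous_expR].
apply: cvgV; first by rewrite gt_eqF// cosh_gt0.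
apply: cvgM; last exact: cvg_cst.
apply: cvgD; first exact: continuous_expR.
by apply: continuous_comp; [exact: opp_continuous|exact: continuous_expR].
Qed.

Lemma measurable_ln_cosh (R : realType) : measurable_fun setT (fun x : R => ln (cosh x)).
Proof. by apply: measurableT_comp => //; exact: measurable_cosh. Qed.

Lemma measurable_field_excess (R : realType) (b : R) :
  measurable_fun setT (field_excess b).
Proof.
apply: measurable_funB => //; apply: measurable_funB.
  apply: measurable_funD => //.
  apply: (measurableT_comp (@measurable_ln_cosh R)); exact: measurable_funM.
apply: measurable_funM => //; apply: measurable_funM => //.
apply: (measurableT_comp (@measurable_tanh R)); exact: measurable_funM.
Qed.

Lemma markov_Rintegral (R : realType) d (T : measurableType d)
    (P : probability T R) (g : T -> R) (t : R) :
  (forall w, 0 <= g w) -> P.-integrable setT (EFin \o g) ->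
  measurable_fun setT g -> 0 < t ->
  fine (P [set w | t < g w]) <= (\int[P]_w g w)%R / t.
Proof.
move=> g0 ig mg t0.
have mA : measurable [set w | t < g w] by exact: measurable_set_gt.
have iA := measurable_indic_integrable P mA.
rewrite ler_pdivlMr// mulrC -Rintegral_indic// -RintegralZl//.
apply: le_Rintegral => //; first exact: (integrableZl measurableT t iA).
move=> w _; rewrite indicE; case: (boolP (_ \in _)) => [|_]; last by rewrite mulr0.
by rewrite inE mulr1 => /= /ltW.
Qed.

Lemma abs_le_expR (R : realType) (x : R) : `|x| <= expR x + expR (- x).
Proof.
have := expR_ge1Dx x; have := expR_ge1Dx (- x).
have := expR_ge0 x; have := expR_ge0 (- x).
by move=> *; rewrite ler_norml; apply/andP; split; lra.
Qed.

Lemma sqr_le_expR (R : realType) (x : R) : x ^+ 2 <= 2 * (expR x + expR (- x)).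
Proof.
have -> : expR x + expR (- x) = expR `|x| + expR (- `|x|).
  by rewrite expR_norm_cosh /cosh mulrC divfK.
have := expR_ge1Dxn 1 (normr_ge0 x); rewrite -(real_normK (num_real x)).
rewrite (_ : (2`!%:R : R) = 2)//.
have := expR_ge0 (- `|x|); lra.
Qed.

Section field_fluctuations.
Variables (R : realType) (d : measure_display) (T : measurableType d).
Variables (P : probability T R) (h : nat -> {RV P >-> R}) (b : R).
Hypotheses (h_indep : mutually_independent P (fun i => h i : T -> R))
  (h_ident : forall (i : nat) (A : set R), measurable A ->
     distribution P (h i) A = distribution P (h 0%N) A)
  (h_exp_moments : forall t : R,
     ('E_P[(fun w => expR (t * h 0%N w))%R] < +oo)%E)
  (bE : is_critical_beta P (h 0%N) b).

Lemma critical_beta_gt0 : 0 < b.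
Proof.
rewrite lt_def; apply/andP; split; last by rewrite bE sqrtr_ge0.
apply/eqP => b0; move: bE; rewrite /is_critical_beta b0 !mul0r.
have -> : (fun w => ln (cosh (0 * h 0%N w))) = cst 0.
  apply/funext => w; rewrite mul0r /cosh oppr0 expR0.
  by rewrite (_ : (1 + 1) / 2 = 1 :> R) ?ln1//; field.
rewrite expectation_cst/= subr0 subr0 => /esym/eqP.
rewrite sqrtr_eq0 leNgt => /negP; apply.
by rewrite mulr_gt0// ln_gt0// ltr1n.
Qed.

Let mh i : measurable_fun setT (h i).
Proof. exact: measurable_funP. Qed.

Let iexp (t : R) : P.-integrable setT (EFin \o (fun w => expR (t * h 0%N w))).
Proof.
apply/integrableP; split.
  apply/measurable_EFinP; apply: (measurableT_comp (@measurable_expR R)).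
  exact: measurable_funM.
have := h_exp_moments t; rewrite unlock; apply: le_lt_trans.
by under eq_integral do rewrite /= ger0_norm ?expR_ge0//.
Qed.

Let iexp2 : P.-integrable setT (EFin \o (fun w => expR (h 0%N w) + expR (- h 0%N w))).
Proof.
have := integrableD measurableT (iexp 1) (iexp (-1)).
rewrite (_ : (_ \+ _)%E = EFin \o (fun w => expR (h 0%N w) + expR (- h 0%N w)))//.
by apply/funext => w /=; rewrite mul1r mulN1r.
Qed.

Let integrable_dominated (g : T -> R) (c : R) : measurable_fun setT g ->
  (forall w, `|g w| <= c * (expR (h 0%N w) + expR (- h 0%N w))) ->
  P.-integrable setT (EFin \o g).
Proof.
move=> mg gc.
apply: (le_integrable measurableT _ _ (integrableZl measurableT c iexp2)).
  exact/measurable_EFinP.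
move=> w _ /=; rewrite lee_fin (le_trans (gc w))//.
exact: ler_norm.
Qed.

Lemma integrable_sqr_field : P.-integrable setT (EFin \o (fun w => h 0%N w ^+ 2)).
Proof.
apply: (@integrable_dominated _ 2); first exact: measurable_funX.
by move=> w; rewrite ger0_norm ?sqr_ge0// sqr_le_expR.
Qed.

Let mbh : measurable_fun setT (fun w => b * h 0%N w).
Proof. exact: measurable_funM. Qed.

(** Once squared, the equation for the critical parameter is this identity. *)
Lemma field_excess_centred : (\int[P]_w field_excess b (h 0%N w))%R = 0.
Proof.
have b0 := critical_beta_gt0.
have itanh : P.-integrable setT (EFin \o (fun w => h 0%N w * tanh (b * h 0%N w))).
  apply: (@integrable_dominated _ 1).
    by apply: measurable_funM => //; exact: (measurableT_comp (@measurable_tanh R)).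
  move=> w; rewrite mul1r; apply: le_trans (abs_le_expR _).
  rewrite normrM ler_piMr// /tanh /sinh /cosh.
  have := expR_gt0 (b * h 0%N w); have := expR_gt0 (- (b * h 0%N w)).
  move: (expR (b * _)) (expR (- _)) => v u u0 v0.
  have uv : 0 < v + u by rewrite addr_gt0.
  rewrite (_ : (v - u) / 2 / _ = (v - u) / (v + u)); last by field; rewrite gt_eqF.
  rewrite normrM normfV (gtr0_norm uv) ler_pdivrMr// mul1r ler_norml.
  by apply/andP; split; lra.
have iln : P.-integrable setT (EFin \o (fun w => ln (cosh (b * h 0%N w)))).
  apply: (@integrable_dominated _ b).
    exact: (measurableT_comp (@measurable_ln_cosh R)).
  move=> w; rewrite ger0_norm ?ln_cosh_ge0// (le_trans (ln_cosh_le _))//.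
  by rewrite normrM (gtr0_norm b0) ler_wpM2l ?abs_le_expR// ltW.
have icst (r : R) : P.-integrable setT (EFin \o cst r).
  exact: (@measurable_integrable_bounded _ _ _ P (cst r) `|r|).
have -> : (\int[P]_w field_excess b (h 0%N w))%R =
    ln 2 + (\int[P]_w ln (cosh (b * h 0%N w)))%R
    - b * (\int[P]_w (h 0%N w * tanh (b * h 0%N w)))%R - b ^+ 2 / 2.
  have i1 := integrableD measurableT (icst (ln 2)) iln.
  have i2 := integrableZl measurableT b itanh.
  have i3 := integrableB measurableT i1 i2.
  rewrite /field_excess (RintegralB measurableT i3 (icst _)).
  rewrite (RintegralB measurableT i1 i2) (RintegralD measurableT (icst _) iln).
  by rewrite !Rintegral_cst_probability RintegralZl.
move: bE; rewrite /is_critical_beta unlock.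
rewrite -/(Rintegral P setT _) -/(Rintegral P setT _).
set t := Rintegral _ _ _; set l := Rintegral _ _ _ => bE'.
have sqb : b ^+ 2 = 2 * (ln 2 - (b * t - l)).
  rewrite {1}bE' sqr_sqrtr// leNgt; apply/negP => /ltW neg.
  by move: b0; rewrite bE' ler0_sqrtr// ltxx.
by rewrite sqb; field.
Qed.

Let integral_ident (i : nat) (g : R -> R) : measurable_fun setT g ->
  P.-integrable setT (EFin \o (fun w => g (h 0%N w))) ->
  P.-integrable setT (EFin \o (fun w => g (h i w))) /\
  (\int[P]_w g (h i w))%R = (\int[P]_w g (h 0%N w))%R.
Proof.
move=> mg ig.
have mge : measurable_fun setT (EFin \o g) by exact/measurable_EFinP.
have ii : P.-integrable setT (EFin \o (fun w => g (h i w))).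
  apply/integrableP; split.
    by apply/measurable_EFinP; exact: (measurableT_comp mg).
  have ma : measurable_fun setT (fun x : R => (`|g x|)%:E).
    by apply/measurable_EFinP; exact: measurableT_comp.
  rewrite -[X in (X < _)%E](@ge0_integral_distribution _ _ _ _ _ P (h i) _ ma) => [|y];
    last by rewrite lee_fin.
  rewrite (eq_measure_integral (distribution P (h 0%N))); last first.
    by move=> A mA _; exact: h_ident.
  rewrite (@ge0_integral_distribution _ _ _ _ _ P (h 0%N) _ ma) => [|y];
    last by rewrite lee_fin.
  by case/integrableP : ig.
split => //; rewrite /Rintegral; congr fine.
rewrite -(@integral_distribution _ _ _ _ _ P (h i) _ mge ii).
rewrite -(@integral_distribution _ _ _ _ _ P (h 0%N) _ mge ig).
by apply: eq_measure_integral => A mA _; exact: h_ident.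
Qed.

Let L i w := field_excess b (h i w).
Let B := 2 + b ^+ 2 / 2.

Let mL i : measurable_fun setT (L i).
Proof. exact: (measurableT_comp (@measurable_field_excess R b)). Qed.

Let LB i w : `|L i w| <= B. Proof. exact: field_excess_bounded. Qed.

Let iL i : P.-integrable setT (EFin \o L i).
Proof. exact: measurable_integrable_bounded (mL i) (LB i). Qed.

Let L0 i : (\int[P]_w L i w)%R = 0.
Proof.
rewrite -field_excess_centred.
by have [] := @integral_ident i _ (@measurable_field_excess R b) (iL 0%N).
Qed.

Let B0 : 0 <= B. Proof. by rewrite addr_ge0// divr_ge0// sqr_ge0. Qed.

Let LL_B i j w : `|L i w * L j w| <= B ^+ 2.
Proof. by rewrite normrM expr2 ler_pM. Qed.

Let iLL i j : P.-integrable setT (EFin \o (fun w => L i w * L j w)).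
Proof.
apply: (@measurable_integrable_bounded _ _ _ _ _ (B ^+ 2)); last exact: LL_B.
exact: measurable_funM.
Qed.

Let LL0 i j : i != j -> (\int[P]_w (L i w * L j w))%R = 0.
Proof.
move=> ij.
have ind A C : measurable A -> measurable C ->
    (P (h i @^-1` A `&` h j @^-1` C) = P (h i @^-1` A) * P (h j @^-1` C))%E.
  move=> mA mC.
  pose D k := if k == i then A else C.
  have uij : uniq [:: i; j] by rewrite /= inE ij.
  have mD k : measurable (D k) by rewrite /D; case: ifP.
  have := h_indep uij mD; rewrite !big_cons big_nil mule1 /D eqxx.
  rewrite eq_sym (negbTE ij) => <-.
  congr (P _); apply/seteqP; split => w.
    by move=> [wi wj] k /=; rewrite !inE => /orP[/eqP ->|/eqP ->];
      rewrite ?eqxx// eq_sym (negbTE ij).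
  move=> H; split; first by have := H i; rewrite /= inE eqxx; apply.
  by have := H j; rewrite /= !inE eqxx orbT eq_sym (negbTE ij); apply.
have mF : measurable_fun setT (fun z : R * R => field_excess b z.1 * field_excess b z.2).
  apply: measurable_funM.
    exact: (measurableT_comp (@measurable_field_excess R b)).
  exact: (measurableT_comp (@measurable_field_excess R b)).
have FB (z : R * R) : `|field_excess b z.1 * field_excess b z.2| <= B ^+ 2.
  by rewrite normrM expr2 ler_pM ?field_excess_bounded.
have [_ ->] := independent_fubini (mh i) (mh j) ind mF FB.
rewrite /= -[RHS](Rintegral_cst_probability P); apply: eq_Rintegral => w _.
rewrite RintegralZr//; first by rewrite [X in X * _]L0 mul0r.
exact: iL.
Qed.

Let var_bound N : P.-integrable setT (EFin \o (fun w => (\sum_(i < N) L i w) ^+ 2)) /\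
  (\int[P]_w ((\sum_(i < N) L i w) ^+ 2))%R <= N%:R * B ^+ 2.
Proof.
have E : (fun w => (\sum_(i < N) L i w) ^+ 2) =
    (fun w => \sum_(i < N) \sum_(j < N) L i w * L j w).
  apply/funext => w; rewrite expr2 mulr_suml; apply: eq_bigr => i _.
  by rewrite mulr_sumr.
rewrite E.
have inn (i : 'I_N) := Rintegral_sum (index_enum 'I_N) xpredT (iLL i).
have [i1 e1] := @Rintegral_sum _ _ _ P 'I_N (index_enum 'I_N) xpredT
  (fun i w => \sum_(j < N) L i w * L j w) (fun i => (inn i).1).
split => //; rewrite e1 (le_trans (y := \sum_(i < N) B ^+ 2))//.
  apply: ler_sum => i _; rewrite (inn i).2.
  rewrite (bigD1 i)//= big1 ?addr0 => [|j ji]; last by rewrite LL0// eq_sym.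
  rewrite -[leRHS](Rintegral_cst_probability P); apply: le_Rintegral => //.
    exact: (@measurable_integrable_bounded _ _ _ P (cst (B ^+ 2)) `|B ^+ 2|).
  by move=> w _; apply: le_trans (LL_B i i w); exact: ler_norm.
by rewrite sumr_const card_ord mulr_natl.
Qed.

(** Chebyshev and Markov inequalities: the summands of the first sum are bounded,
    centred and pairwise uncorrelated; those of the second have a finite
    expectation. *)
Lemma field_fluctuations : exists c : R, 0 <= c /\
  forall (N : nat) (K : R), (0 < N)%N -> 1 <= K ->
  fine (P [set w | K * Num.sqrt N%:R < `|\sum_(i < N) field_excess b (h i w)|]) <= c / K /\
  fine (P [set w | K * N%:R < \sum_(i < N) h i w ^+ 2]) <= c / K.
Proof.
pose h2 := (\int[P]_w (h 0%N w ^+ 2))%R.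
have h20 : 0 <= h2 by apply: Rintegral_ge0 => w _; exact: sqr_ge0.
exists (B ^+ 2 + h2); split; first by rewrite addr_ge0// sqr_ge0.
move=> N K N0 K1; have K0 : 0 < K by exact: lt_le_trans K1.
have NR : 0 < N%:R :> R by rewrite ltr0n.
split.
  have [iS vS] := var_bound N.
  have -> : [set w | K * Num.sqrt N%:R < `|\sum_(i < N) field_excess b (h i w)|] =
      [set w | K ^+ 2 * N%:R < (\sum_(i < N) L i w) ^+ 2].
    have eqv (x : R) : (K * Num.sqrt N%:R < `|x|) = (K ^+ 2 * N%:R < x ^+ 2).
      rewrite -(real_normK (num_real x)) -[X in K ^+ 2 * X](sqr_sqrtr (ltW NR)).
      by rewrite -exprMn ltr_pXn2r// nnegrE mulr_ge0 ?sqrtr_ge0// ltW.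
    by apply/seteqP; split => w /=; rewrite eqv.
  have mS : measurable_fun setT (fun w => (\sum_(i < N) L i w) ^+ 2).
    by apply: measurable_funX; apply: measurable_sum => i; exact: mL.
  have KN : 0 < K ^+ 2 * N%:R by rewrite mulr_gt0// exprn_gt0.
  apply: (le_trans (markov_Rintegral (fun w => sqr_ge0 _) iS mS KN)).
  rewrite ler_pdivrMr ?mulr_gt0 ?exprn_gt0//; apply: (le_trans vS).
  have -> : (B ^+ 2 + h2) / K * (K ^+ 2 * N%:R) = N%:R * (B ^+ 2 * K + h2 * K).
    by field; rewrite gt_eqF.
  rewrite ler_wpM2l//; have := sqr_ge0 B; nra.
have msq : measurable_fun setT (fun x : R => x ^+ 2) by exact: measurable_funX.
have isq i := @integral_ident i _ msq integrable_sqr_field.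
have [iS eS] := Rintegral_sum (index_enum 'I_N) xpredT (fun i : 'I_N => (isq i).1).
have mS : measurable_fun setT (fun w => \sum_(i < N) h i w ^+ 2).
  by apply: measurable_sum => i; exact: measurable_funX.
have S0 w : 0 <= \sum_(i < N) h i w ^+ 2 by apply: sumr_ge0 => i _; exact: sqr_ge0.
have KN : 0 < K * N%:R by rewrite mulr_gt0.
apply: (le_trans (markov_Rintegral S0 iS mS KN)).
rewrite eS (eq_bigr (fun=> h2)) => [|i _]; last by rewrite (isq i).2.
rewrite sumr_const card_ord -[h2 *+ N]mulr_natl ler_pdivrMr ?mulr_gt0//.
have -> : (B ^+ 2 + h2) / K * (K * N%:R) = N%:R * (B ^+ 2 + h2) by field; rewrite gt_eqF.
by rewrite ler_wpM2l// lerDr sqr_ge0.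
Qed.

End field_fluctuations.

(** * Exponential and Gaussian integrals *)

Local Notation mu := lebesgue_measure.

Lemma lebesgue_measure_translate (R : realType) (t : R) (A : set R) : measurable A ->
  pushforward mu ((fun x => x + t) : R -> measurableTypeR R) A = mu A.
Proof.
move=> mA; apply/esym.
have mt : measurable_fun setT ((fun x => x + t) : measurableTypeR R -> measurableTypeR R).
  exact: measurable_funD.
apply: (@lebesgue_measure_unique R (pushforward mu
  ((fun x => x + t) : measurableTypeR R -> measurableTypeR R))) => //= _ [[a b]] _ <-.
rewrite /pushforward.
have -> : (fun x => x + t) @^-1` `]a, b]%classic = `]a - t, b - t]%classic.
  by apply/seteqP; split => x /=; rewrite !in_itv/= ltrBlDr lerBrDr.
rewrite !lebesgue_measure_itv/= !lte_fin ltrD2r; case: ifP => // _.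
by rewrite -!EFinB; congr EFin; ring.
Qed.

Lemma ge0_integral_translate (R : realType) (t : R) (f : R -> \bar R) :
  measurable_fun [set: R] f -> (forall r, (0 <= f r)%E) ->
  (\int[mu]_x f (x + t)%R = \int[mu]_x f x)%E.
Proof.
move=> mf f0.
have mt : measurable_fun setT ((fun x => x + t) : measurableTypeR R -> measurableTypeR R).
  exact: measurable_funD.
rewrite -[LHS](@ge0_integral_pushforward _ _ _ _ _ _ mt mu setT f)//.
by apply: eq_measure_integral => A mA _; exact: lebesgue_measure_translate.
Qed.

Lemma ge0_integral_opp (R : realType) (f : R -> \bar R) :
  measurable_fun [set: R] f -> (forall r, (0 <= f r)%E) ->
  (\int[mu]_x f (- x)%R = \int[mu]_x f x)%E.
Proof.
move=> mf f0.
have mt : measurable_fun setT ((fun x => - x) : measurableTypeR R -> measurableTypeR R).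
  exact: oppr_measurable.
rewrite -[LHS](@ge0_integral_pushforward _ _ _ _ _ _ mt mu setT f)//.
by apply: eq_measure_integral => A mA _; exact: lebesgue_measureN.
Qed.

Lemma integral_exp_tail (R : realType) (c L : R) : 0 < c ->
  (\int[mu]_(y in `[L, +oo[) (expR (- c * y))%:E = (expR (- c * L) / c)%:E)%E.
Proof.
move=> c0.
pose F (y : R) := - (c^-1 * expR (- c * y)).
have dlin (y : R) : is_derive y 1 (fun z : R => - c * z) (- c).
  have h := is_deriveZ (- c) (is_derive_id y (1 : R)).
  apply: (is_derive_eq h); exact: mulr1.
have dexp (y : R) : is_derive y 1 (fun z : R => expR (- c * z)) (expR (- c * y) * - c).
  exact: (@is_derive1_comp _ (@expR R) (fun z : R => - c * z) y).
have cexp (y : R) : {for y, continuous (fun z : R => expR (- c * z))}.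
  apply: differentiable_continuous; apply/derivable1_diffP.
  by have [] := dexp y.
have dF (y : R) : is_derive y 1 F (expR (- c * y)).
  have h := is_deriveZ (- c^-1) (dexp y).
  rewrite (_ : F = - c^-1 \*: (fun z : R => expR (- c * z))); last first.
    by apply/funext => z; rewrite /F -mulNr.
  apply: (is_derive_eq h); rewrite -[LHS]/(- c^-1 * (expR (- c * y) * - c)).
  by field; rewrite gt_eqF.
have cF (y : R) : {for y, continuous F}.
  by apply: differentiable_continuous; apply/derivable1_diffP; have [] := dF y.
rewrite (@ge0_continuous_FTC2y _ _ F L 0).
- by rewrite /F EFinN add0e oppeK mulrC.
- by move=> x _; exact: expR_ge0.
- by apply: continuous_subspaceT => y; exact: cexp.
- rewrite -oppr0 -(mulr0 c^-1); apply: cvgN; apply: cvgM; first exact: cvg_cst.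
  rewrite (_ : (fun x => expR (- c * x)) =
               (fun z => expR (- z)) \o (fun z => c * z)); last first.
    by apply: eq_fun => x; rewrite mulNr.
  apply: (@cvg_comp _ _ _ _ _ _ (pinfty_nbhs R)); last exact: cvgr_expR.
  exact: gt0_cvgMry.
- by move=> x _; have [] := dF x.
- by apply: cvg_at_right_filter; exact: cF.
- by move=> x _; rewrite derive1E; have [_ ->] := dF x.
Qed.

(** Reflection of [integral_exp_tail]. *)
Lemma integral_exp_tail_left (R : realType) (c L : R) : 0 < c ->
  (\int[mu]_(y in `]-oo, (- L)%R]) (expR (c * y))%:E = (expR (- c * L) / c)%:E)%E.
Proof.
move=> c0; rewrite -integral_exp_tail// integral_mkcond [RHS]integral_mkcond.
rewrite -[RHS]ge0_integral_opp.
- apply: eq_integral => y _; rewrite !patchE mulrNN.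
  have -> : (- y \in `[L, +oo[%classic) = (y \in `]-oo, - L]%classic) => //.
  apply/idP/idP; rewrite !inE/= !in_itv/= ?andbT; lra.
- apply/(measurable_restrictT _ _).1 => //.
  apply/measurable_EFinP; apply: (measurableT_comp (@measurable_expR R)).
  exact: measurable_funM.
- by move=> r; rewrite patchE; case: ifP => // _; rewrite lee_fin expR_ge0.
Qed.

Lemma integral_normal_prob (R : realType) (m s : R) (f : R -> \bar R) :
  measurable_fun setT f -> (normal_prob m s).-integrable setT f ->
  (\int[normal_prob m s]_x f x = \int[mu]_x (f x * (normal_pdf m s x)%:E))%E.
Proof.
move=> mf finf.
have dom := normal_prob_dominates m s.
rewrite -(Radon_Nikodym_change_of_variables dom)//=.
apply: ae_eq_integral => //.
- by apply: emeasurable_funM.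
- apply: emeasurable_funM => //; apply/measurable_EFinP.
  exact: (measurable_normal_pdf m s).
- apply: ae_eqe_mul2l => /=.
  rewrite Radon_NikodymE//=.
  case: cid => /= h [h1 h2 h3].
  apply: integral_ae_eq => //=.
  + by apply/measurable_EFinP; exact: (measurable_normal_pdf m s).
  + by move=> E E01 mE; rewrite -h3.
Qed.

Lemma gaussian_translate (R : realType) d (T : measurableType d)
    (P : probability T R) (X : {RV P >-> R}) (s t B : R) (phi : R -> R) :
  (forall A, measurable A -> distribution P X A = normal_prob 0 s A) ->
  measurable_fun setT phi -> (forall x, 0 <= phi x <= B) ->
  (\int[P]_w (phi (X w + t))%:E =
   \int[mu]_y (phi y * normal_pdf 0 s (y - t))%:E)%E.
Proof.
move=> Xs mphi phiB.
have mphit : measurable_fun setT (fun x : R => phi (x + t)).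
  by apply: (measurableT_comp mphi); exact: measurable_funD.
have mphite : measurable_fun setT (fun x : R => (phi (x + t))%:E) by exact/measurable_EFinP.
(* the law of X, read on the copy of R that carries the Lebesgue measure *)
have mX : measurable_fun setT (X : T -> measurableTypeR R) by exact: (measurable_funP X).
pose X' : {RV P >-> measurableTypeR R} :=
  HB.pack (X : T -> measurableTypeR R) (isMeasurableFun.Build _ _ _ _ _ mX).
transitivity (\int[distribution P X']_y (phi (y + t))%:E)%E.
  rewrite (@ge0_integral_distribution _ _ _ _ _ P X' (fun y => (phi (y + t))%:E))//.
  by move=> y; rewrite lee_fin; have /andP[] := phiB (y + t).
transitivity (\int[normal_prob 0 s]_y (phi (y + t))%:E)%E.
  by apply: eq_measure_integral => A mA _; exact: Xs.
rewrite integral_normal_prob//; last first.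
  apply: (@measurable_integrable_bounded _ _ _ (normal_prob 0 s) _ B) => // x.
  by rewrite ger0_norm; have /andP[] := phiB (x + t).
rewrite -[RHS](@ge0_integral_translate _ t).
- by apply: eq_integral => x _; rewrite addrK EFinM.
- apply/measurable_EFinP; apply: measurable_funM => //.
  apply: (measurableT_comp (measurable_normal_pdf _ _)); exact: measurable_funB.
- by move=> x; rewrite lee_fin mulr_ge0 ?normal_pdf_ge0//; have /andP[] := phiB x.
Qed.

(** * The centred energies *)

Section centred_energies.
Variables (R : realType) (d : measure_display) (T : measurableType d).
Variables (P : probability T R) (N : nat) (X : spins N -> {RV P >-> R}).
Variables (h : nat -> R) (a : R).
Hypotheses (N_gt0 : (0 < N)%N)
  (X_gaussian : forall sigma A, measurable A ->
     distribution P (X sigma) A = normal_prob 0 (Num.sqrt N%:R) A).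

(** The Hamiltonian, with the field fixed and the energies measured from a. *)
Definition centred_energy (sigma : spins N) (w : T) : R :=
  X sigma w + (field_energy h sigma - a).

Let H := centred_energy.

Lemma measurable_centred_energy sigma : measurable_fun setT (H sigma).
Proof. by apply: measurable_funD => //; exact: measurable_funP. Qed.

Let pdf (sigma : spins N) (y : R) : R :=
  normal_pdf 0 (Num.sqrt N%:R) (y - (field_energy h sigma - a)).

Let rho (y : R) : R := gibbs_intensity N h (a + y).

Let rhoE y : rho y = \sum_sigma pdf sigma y.
Proof. by apply: eq_bigr => sigma _; rewrite /pdf; congr normal_pdf; ring. Qed.

Let pdf_ge0 sigma y : 0 <= pdf sigma y. Proof. exact: normal_pdf_ge0. Qed.

Let rho_ge0 y : 0 <= rho y. Proof. by rewrite rhoE sumr_ge0. Qed.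

Let mpdf sigma : measurable_fun setT (pdf sigma).
Proof.
apply: (measurableT_comp (measurable_normal_pdf _ _)); exact: measurable_funB.
Qed.

Let mrho : measurable_fun setT rho.
Proof.
rewrite (_ : rho = fun y => \sum_sigma pdf sigma y); last exact/funext/rhoE.
by apply: measurable_sum => sigma; exact: mpdf.
Qed.

Let single (E : set R) (phi : R -> R) (B : R) sigma : measurable E ->
  measurable_fun setT phi -> (forall x, 0 <= phi x) -> (forall x, E x -> phi x <= B) ->
  (\int[P]_w (phi (H sigma w) * \1_E (H sigma w))%:E =
   \int[mu]_(y in E) (phi y * pdf sigma y)%:E)%E.
Proof.
move=> mE mphi phi0 phiB.
rewrite (@gaussian_translate _ _ _ _ (X sigma) (Num.sqrt N%:R) _ `|B|
  (fun y => phi y * \1_E y)).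
- rewrite [RHS]integral_mkcond; apply: eq_integral => y _.
  rewrite patchE indicE; case: ifP => _; first by rewrite mulr1.
  by rewrite mulr0 mul0r.
- by move=> A; exact: X_gaussian.
- by apply: measurable_funM => //; exact: measurable_indic.
- move=> x; rewrite indicE; case: (boolP (_ \in _)) => [|_] /=.
    rewrite inE mulr1 => /phiB h1; rewrite phi0/=; apply: (le_trans h1); exact: ler_norm.
  by rewrite mulr0 lexx normr_ge0.
Qed.

Lemma sum_expectation_energies (E : set R) (phi : R -> R) (B : R) : measurable E ->
  measurable_fun setT phi -> (forall x, 0 <= phi x) -> (forall x, E x -> phi x <= B) ->
  (\sum_sigma \int[P]_w (phi (H sigma w) * \1_E (H sigma w))%:E =
   \int[mu]_(y in E) (phi y * gibbs_intensity N h (a + y))%:E)%E.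
Proof.
move=> mE mphi phi0 phiB.
under eq_bigr do rewrite (single _ mE mphi phi0 phiB).
rewrite -ge0_integral_sum//.
- apply: eq_integral => y _; rewrite sumEFin -/(rho y) rhoE mulr_sumr; by [].
- move=> sigma; apply/measurable_EFinP/measurable_funTS.
  by apply: measurable_funM => //; exact: mpdf.
- by move=> sigma y _; rewrite lee_fin mulr_ge0.
Qed.

Let prob_cell sigma (E : set R) : measurable E ->
  P (H sigma @^-1` E) = (\int[mu]_(y in E) (pdf sigma y)%:E)%E.
Proof.
move=> mE; have := @single E (cst 1) 1 sigma mE (measurable_cst _) (fun=> ler01)
  (fun _ _ => lexx 1).
under [in RHS]eq_integral do rewrite mul1r.
move=> <-; transitivity (\int[P]_w (\1_(H sigma @^-1` E) w : R)%:E)%E.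
  rewrite integral_indic ?setIT//.
  by rewrite -[_ @^-1` _]setTI; exact: measurable_centred_energy.
apply: eq_integral => w _; rewrite mul1r !indicE; by [].
Qed.

Let sum_prob_cell (E : set R) : measurable E ->
  (\sum_sigma P (H sigma @^-1` E) = \int[mu]_(y in E) (rho y)%:E)%E.
Proof.
move=> mE; under eq_bigr do rewrite (prob_cell _ mE).
rewrite -ge0_integral_sum//.
- by apply: eq_integral => y _; rewrite sumEFin rhoE.
- by move=> sigma; apply/measurable_EFinP/measurable_funTS; exact: mpdf.
- by move=> sigma y _; rewrite lee_fin.
Qed.

Let sqrtN_gt0 : 0 < Num.sqrt N%:R :> R.
Proof. by rewrite sqrtr_gt0 ltr0n. Qed.

(** The Gaussian density of variance N is at most 1 / sqrt N: a single
    configuration is rarely seen in a bounded window, which makes the Poisson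
    approximation effective. *)
Lemma centred_energy_prob_le sigma (u v : R) : u <= v ->
  fine (P (H sigma @^-1` `[u, v[%classic)) <= (v - u) / Num.sqrt N%:R.
Proof.
move=> uv; rewrite prob_cell//.
have : (\int[mu]_(y in `[u, v[%classic) (pdf sigma y)%:E <=
    ((v - u) / Num.sqrt N%:R)%:E)%E.
  apply: (@le_trans _ _ (\int[mu]_(y in `[u, v[%classic) (Num.sqrt N%:R)^-1%:E)%E).
    apply: ge0_le_integral => //.
    - by move=> y _; rewrite lee_fin.
    - by apply/measurable_EFinP/measurable_funTS; exact: mpdf.
    - move=> y _; rewrite lee_fin; apply: le_trans (normal_pdf_ub _ _ _) _.
        by rewrite gt_eqF.
      have k0 : 0 < Num.sqrt (pi *+ 2) :> R by exact: lt_le_trans (sqrt_2pi_ge1 R).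
      rewrite normal_peak_sqrt lef_pV2 ?posrE ?(mulr_gt0 k0)//.
      by apply: ler_peMl; [exact: ltW|exact: sqrt_2pi_ge1].
  rewrite integral_cst//= lebesgue_measure_itv/= lte_fin; case: ifPn => uv'.
    by rewrite -EFinB -EFinM lee_fin mulrC.
  by rewrite mule0 lee_fin divr_ge0 ?subr_ge0// ltW.
rewrite -prob_cell//.
have /fineK <- : P (H sigma @^-1` `[u, v[%classic) \is a fin_num.
  rewrite fin_num_measure// -[_ @^-1` _]setTI; exact: measurable_centred_energy.
by rewrite lee_fin.
Qed.

Variables (b C K : R).
Hypotheses (b_gt0 : 0 < b) (C_gt0 : 0 < C)
  (K_bound : forall y, expR (b * y) * gibbs_intensity N h (a + y) <= K /\
      `|expR (b * y) * gibbs_intensity N h (a + y) - C| <=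
        K * (`|y| / Num.sqrt N%:R)).

Let rho_le y : rho y <= K * expR (- b * y).
Proof.
have [h1 _] := K_bound y.
by rewrite mulNr expRN ler_pdivlMr ?expR_gt0// mulrC.
Qed.

Let K_ge0 : 0 <= K.
Proof.
have [h1 _] := K_bound 0; apply: le_trans h1.
by rewrite mulr_ge0 ?expR_ge0// rho_ge0.
Qed.

Let mexp (c : R) : measurable_fun setT (fun y : R => expR (c * y)).
Proof. by apply: (measurableT_comp (@measurable_expR R)); exact: measurable_funM. Qed.

(** First moment: with high probability no energy exceeds a large level. *)
Lemma centred_energy_top_le (L : R) :
  (\sum_sigma P (H sigma @^-1` `[L, +oo[%classic) <= (K / b * expR (- b * L))%:E)%E.
Proof.
rewrite sum_prob_cell//.
apply: (@le_trans _ _ (\int[mu]_(y in `[L, +oo[%classic) (K%:E * (expR (- b * y))%:E))%E).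
  apply: ge0_le_integral => //.
  - by move=> y _; rewrite lee_fin.
  - exact/measurable_EFinP/measurable_funTS.
  - apply/measurable_EFinP/measurable_funTS; apply: measurable_funM => //; exact: mexp.
  - by move=> y _; rewrite lee_fin.
rewrite ge0_integralZl//; last first.
  by apply/measurable_EFinP/measurable_funTS; exact: mexp.
by rewrite integral_exp_tail// -EFinM lee_fin mulrA mulrAC.
Qed.

(** The weights exp (c * energy) with c > b have a summable expectation at the
    low energies, because the intensity grows only like exp (- b y) there. This
    is where c > b, hence low temperature, matters: the Gibbs measure is carried
    by finitely many configurations near the top. *)
Lemma centred_energy_remainder_le (c L : R) : b < c ->
  (\sum_sigma \int[P]_w (expR (c * H sigma w) *
     \1_(`]-oo, (- L)%R]%classic) (H sigma w))%:E <=
   (K / (c - b) * expR (- (c - b) * L))%:E)%E.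
Proof.
move=> bc; have cb0 : 0 < c - b by rewrite subr_gt0.
have c0 : 0 < c by exact: lt_trans bc.
have bnd (y : R) : `]-oo, (- L)%R]%classic y -> expR (c * y) <= expR (c * - L).
  by rewrite /= in_itv/= => yL; rewrite ler_expR ler_wpM2l// ltW.
rewrite (sum_expectation_energies (measurable_itv _) (mexp c) (fun y => expR_ge0 _) bnd).
apply: (@le_trans _ _ (\int[mu]_(y in `]-oo, (- L)%R]%classic)
    (K%:E * (expR ((c - b) * y))%:E))%E).
  apply: ge0_le_integral => //.
  - by move=> y _; rewrite lee_fin mulr_ge0 ?expR_ge0// rho_ge0.
  - by apply/measurable_EFinP/measurable_funTS; apply: measurable_funM => //; exact: mexp.
  - apply/measurable_EFinP/measurable_funTS; apply: measurable_funM => //; exact: mexp.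
  - move=> y _; rewrite lee_fin (_ : (c - b) * y = c * y + - b * y); last by ring.
    by rewrite expRD mulrCA ler_wpM2l ?expR_ge0// rho_le.
rewrite ge0_integralZl//; last first.
  by apply/measurable_EFinP/measurable_funTS; exact: mexp.
by rewrite integral_exp_tail_left// -EFinM lee_fin mulrA mulrAC.
Qed.

Lemma centred_energy_cell_mean (L u v : R) : 0 <= L -> - L <= u -> u <= v -> v <= L ->
  `|\sum_sigma fine (P (H sigma @^-1` `[u, v[%classic)) -
    fine (exp_intensity C b `[u, v[%classic)| <=
  expR (b * L) * K * L * (2 * L) / Num.sqrt N%:R.
Proof.
move=> L0 Lu uv vL.
set E := `[u, v[%classic.
have mE : measurable E by exact: measurable_itv.
have muE : mu E = (v - u)%:E.
  rewrite lebesgue_measure_itv/= lte_fin; case: ifPn => // uv'.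
  suff -> : u = v by rewrite subrr.
  by apply/eqP; rewrite eq_le uv leNgt.
have muE_fin : (mu E < +oo)%E by rewrite muE ltry.
have EL y : E y -> `|y| <= L.
  rewrite /E/= in_itv/= => /andP[uy yv]; rewrite ler_norml.
  by apply/andP; split; lra.
pose eta := expR (b * L) * K * L / Num.sqrt N%:R.
have eta0 : 0 <= eta.
  by rewrite divr_ge0 ?(ltW sqrtN_gt0)// mulr_ge0// mulr_ge0// expR_ge0.
have close y : E y -> `|rho y - C * expR (- b * y)| <= eta.
  move=> Ey; have [_ h1] := K_bound y.
  have -> : rho y - C * expR (- b * y) = expR (- b * y) * (expR (b * y) * rho y - C).
    rewrite mulrBr mulrA -expRD (_ : - b * y + b * y = 0); last by ring.
    by rewrite expR0 mul1r mulrC.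
  rewrite normrM (ger0_norm (expR_ge0 _)) /eta -!mulrA ler_pM ?expR_ge0//.
    rewrite ler_expR; have := EL y Ey; rewrite ler_norml => /andP[h2 _].
    by rewrite mulNr -mulrN ler_pM2l//; lra.
  apply: (le_trans h1); rewrite ler_wpM2l// ler_wpM2r ?invr_ge0 ?(ltW sqrtN_gt0)//.
  exact: EL.
have bnd_int (g : R -> R) (B : R) : measurable_fun setT g ->
    (forall y, E y -> `|g y| <= B) -> mu.-integrable E (EFin \o g).
  move=> mg gB; apply: measurable_bounded_integrable => //.
    exact: measurable_funTS.
  exists B; split; first exact: num_real.
  by move=> x Bx y Ey; exact: le_trans (gB y Ey) (ltW Bx).
have exp_bnd y : E y -> expR (- b * y) <= expR (b * L).
  move=> /EL; rewrite ler_norml => /andP[h2 _].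
  by rewrite ler_expR mulNr -mulrN ler_pM2l//; lra.
have irho : mu.-integrable E (EFin \o rho).
  apply: (bnd_int _ (K * expR (b * L))) => // y Ey.
  rewrite ger0_norm// (le_trans (rho_le y))// ler_wpM2l//; exact: exp_bnd.
have iexp : mu.-integrable E (EFin \o (fun y => C * expR (- b * y))).
  apply: (bnd_int _ (C * expR (b * L))) => [|y Ey].
    by apply: measurable_funM => //; exact: mexp.
  rewrite ger0_norm; last by rewrite mulr_ge0 ?expR_ge0// ltW.
  by rewrite ler_pM2l// exp_bnd.
have -> : \sum_sigma fine (P (H sigma @^-1` E)) = (\int[mu]_(y in E) rho y)%R.
  rewrite /Rintegral -sum_prob_cell// sum_fine// => sigma _.
  rewrite fin_num_measure// -[_ @^-1` _]setTI; exact: measurable_centred_energy.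
rewrite -/(Rintegral mu E (fun y => C * expR (- b * y))) -RintegralB//.
have mE' : measurable (E : set (measurableTypeR R)) by [].
have idiff : mu.-integrable E (EFin \o (fun y => rho y - C * expR (- b * y))).
  exact: (integrableB mE' irho iexp).
apply: (le_trans (le_normr_Rintegral mE' idiff)).
apply: (@le_trans _ _ (\int[mu]_(y in E) eta)%R).
  apply: le_Rintegral => //.
  - exact: (integrable_abse idiff).
  - by apply: (bnd_int _ `|eta|).
rewrite Rintegral_cst// [X in fine X](_ : _ = (v - u)%:E) //=.
have -> : expR (b * L) * K * L * (2 * L) / Num.sqrt N%:R = eta * (2 * L).
  by rewrite /eta; ring.
by rewrite ler_wpM2l//; lra.
Qed.

End centred_energies.

(** * Ordered Gibbs weights *)

Lemma ge_path_below (R : realType) (x c : R) (t : seq R) :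
  path >=%R x t -> x < c -> all (fun z => z < c) t.
Proof.
have ge_trans : transitive (>=%R : rel R) by move=> a y z ay yz; exact: le_trans yz ay.
move=> /(order_path_min ge_trans)/allP xt xc; apply/allP => z /xt zx.
exact: le_lt_trans xc.
Qed.

Lemma ge_path_count (R : realType) (x c : R) (t : seq R) :
  path >=%R x t -> x < c -> count (fun z => (c <= z)%R) t = 0%N.
Proof.
move=> pt xc; rewrite (eq_in_count (a2 := pred0)) ?count_pred0// => z zt /=.
by apply/negbTE; rewrite -ltNge (allP (ge_path_below pt xc)).
Qed.

(** Only levels c > 0 behave well: the sequence is read as extended by zeros. *)
Lemma le_nth_sort (R : realType) (s : seq R) (c : R) (i : nat) : 0 < c ->
  (c <= nth 0 (sort >=%R s) i) = (i < count (fun x => (c <= x)%R) s)%N.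
Proof.
move=> c0; rewrite -(permP (permEl (perm_sort >=%R s)) (fun x => (c <= x)%R)).
have : sorted >=%R (sort >=%R s) by apply: sort_sorted; exact: ge_total.
elim: (sort _ _) i => [|x t IH] i; first by rewrite nth_nil leNgt c0.
move=> /= pt; have [cx|xc] := leP c x.
  by case: i => [|i] /=; [rewrite cx|rewrite IH ?(path_sorted pt)].
have t0 := ge_path_count pt xc.
rewrite t0 addn0 ltn0; case: i => [|i] /=; first by rewrite leNgt xc.
by rewrite IH ?(path_sorted pt)// t0.
Qed.

Lemma sum_nth_sort (R : realType) (s : seq R) (c : R) :
  \sum_(0 <= i < count (fun x => (c <= x)%R) s) nth 0 (sort >=%R s) i =
  \sum_(x <- s | c <= x) x.
Proof.
rewrite -(permP (permEl (perm_sort >=%R s)) (fun x => (c <= x)%R)).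
rewrite -(perm_big _ (permEl (perm_sort >=%R s)))/=.
have : sorted >=%R (sort >=%R s) by apply: sort_sorted; exact: ge_total.
elim: (sort _ _) => [|x t IH]; first by rewrite /= big_geq// big_nil.
move=> /= pt; have [cx|xc] := leP c x.
  by rewrite add1n big_nat_recl//= big_cons cx IH ?(path_sorted pt).
have t0 := ge_path_count pt xc.
rewrite t0 addn0 big_geq// big_cons leNgt xc /=.
by rewrite -[in RHS]big_filter (size0nil (etrans (size_filter _ _) t0)) big_nil.
Qed.

Definition cumulative (n : nat) (k : nat -> nat) (j : nat) : nat :=
  \sum_(j <= l < n) k l.

Lemma cumulative_top n k : cumulative n k n = 0%N.
Proof. by rewrite /cumulative big_geq. Qed.

Lemma cumulative_cells (R : realType) (y : nat -> R) (n j : nat) (x : R) :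
  (forall l, (l < n)%N -> y l <= y l.+1) -> x < y n -> (j <= n)%N ->
  \sum_(j <= l < n) ((y l <= x < y l.+1)%R : nat) = (y j <= x)%R :> nat.
Proof.
move=> yS xn jn.
rewrite -(subKn jn); move: (n - j)%N (leq_subr j n) => m.
elim: m => [_|m IH mn]; first by rewrite subn0 big_geq// leNgt xn.
have nm : (n - m.+1 < n)%N by rewrite -subSn// subSS leq_subr.
rewrite big_ltn// subnSK// IH; last exact: ltnW.
have := yS _ nm; rewrite subnSK// => ym.
have [h1|h1] := leP (y (n - m.+1)%N) x; have [h2|h2] := leP (y (n - m)%N) x => //=.
by move: (le_lt_trans (le_trans ym h2) h1); rewrite ltxx.
Qed.

Lemma gibbs_weight_shift (R : realType) (N : nat) (H : spins N -> R) (beta a : R) sigma :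
  gibbs_weight H beta sigma = gibbs_weight (fun sigma => H sigma - a) beta sigma.
Proof.
rewrite /gibbs_weight /partition_function.
have E s : expR (beta * (H s - a)) = expR (beta * H s) * expR (- (beta * a)).
  by rewrite -expRD; congr expR; ring.
rewrite E; under [in RHS]eq_bigr do rewrite E.
rewrite -mulr_suml invfM mulrACA divff ?mulr1//.
by rewrite gt_eqF ?expR_gt0.
Qed.

Section ordered_gibbs_weights_resolved.
Variables (R : realType) (N : nat) (H u : spins N -> R) (a beta e : R).
Variables (y : nat -> R) (n : nat) (k : nat -> nat).
Hypotheses (Hu : forall sigma, u sigma = H sigma - a) (beta_gt0 : 0 < beta)
  (y_nd : forall l, (l < n)%N -> y l <= y l.+1)
  (u_count : forall l, (l < n)%N ->
    count (fun sigma => y l <= u sigma < y l.+1) (enum {: spins N}) = k l)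
  (u_top : forall sigma, u sigma < y n)
  (u_low : \sum_(sigma | u sigma < y 0%N) expR (beta * u sigma) <=
    e * \sum_sigma expR (beta * u sigma)).

Let S := \sum_sigma expR (beta * u sigma).

Let S_gt0 : 0 < S. Proof. exact: partition_function_gt0. Qed.

Let weightE sigma : gibbs_weight H beta sigma = expR (beta * u sigma) / S.
Proof.
rewrite (gibbs_weight_shift _ _ a) /gibbs_weight /S /partition_function -Hu.
by congr (_ / _); apply: eq_bigr => s _; rewrite Hu.
Qed.

Let above j sigma : (expR (beta * y j) / S <= gibbs_weight H beta sigma) =
  (y j <= u sigma).
Proof. by rewrite weightE ler_pM2r ?invr_gt0// ler_expR ler_pM2l. Qed.

Let count_above j : (j <= n)%N ->
  count (fun x => expR (beta * y j) / S <= x)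
    [seq gibbs_weight H beta sigma | sigma <- enum {: spins N}] = cumulative n k j.
Proof.
move=> jn; rewrite count_map (eq_count (a2 := fun sigma => y j <= u sigma)); last first.
  by move=> sigma /=; rewrite above.
rewrite /cumulative -[RHS](eq_big_nat _ _ (F1 := fun l =>
  count (fun sigma => y l <= u sigma < y l.+1) (enum {: spins N}))); last first.
  by move=> l /andP[_ ln]; exact: u_count.
rewrite -sum1_count; under [in RHS]eq_bigr do rewrite -sum1_count big_mkcond.
rewrite exchange_big/= [LHS]big_mkcond; apply: eq_bigr => sigma _.
transitivity (nat_of_bool (y j <= u sigma)); first by case: (y j <= u sigma).
rewrite -(cumulative_cells y_nd (u_top sigma) jn).
by apply: eq_bigr => l _; case: (_ <= _ < _).
Qed.

(** With S the sum of the raw weights, p i * S is the raw weight of rank i, and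
    the levels are crossed by the configurations counted in the cells above;
    the mass below the lowest level is the neglected remainder. *)
Lemma ordered_gibbs_weights_resolved :
  resolves n (fun j => expR (beta * y j)) e (cumulative n k)
    (ordered_gibbs_weights H beta).
Proof.
exists S; split => //.
  move=> j i jn; rewrite -ler_pdivrMr// -count_above//.
  by rewrite -le_nth_sort ?divr_gt0 ?expR_gt0.
have -> : \sum_(0 <= i < cumulative n k 0) ordered_gibbs_weights H beta i =
    \sum_(sigma | y 0%N <= u sigma) gibbs_weight H beta sigma.
  rewrite -count_above// [LHS]sum_nth_sort big_map big_enum_cond/=.
  by apply: eq_bigl => sigma; rewrite above.
rewrite -(sum_gibbs_weight H beta) (bigID (fun sigma => y 0%N <= u sigma))/=.
rewrite -addrA gerDl subr_le0.
under eq_bigr do rewrite weightE; rewrite -mulr_suml ler_pdivrMr//.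
by under eq_bigl do rewrite -ltNge.
Qed.

End ordered_gibbs_weights_resolved.

(** The rank i weight reaches c exactly when more than i weights do, which
    is a condition on a finite sum of indicators. *)
Lemma measurable_ordered_weights (R : realType) d (T : measurableType d) (N : nat)
    (H : spins N -> T -> R) (beta : R) :
  (forall sigma, measurable_fun setT (H sigma)) ->
  random_element (fun w => ordered_gibbs_weights (fun sigma => H sigma w) beta).
Proof.
move=> mH.
have mexp sigma : measurable_fun setT (fun w => expR (beta * H sigma w)).
  by apply: (measurableT_comp (@measurable_expR R)); exact: measurable_funM.
have mg sigma : measurable_fun setT
    (fun w => gibbs_weight (fun sigma => H sigma w) beta sigma).
  pose Z w : R := \sum_(s : spins N) expR (beta * H s w).
  have Z0 w : 0 < Z w by exact: (partition_function_gt0 (fun sigma => H sigma w) beta).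
  rewrite (_ : (fun w => _) = (fun w => expR (beta * H sigma w) * expR (- ln (Z w)))).
    apply: measurable_funM; first exact: mexp.
    apply: (measurableT_comp (@measurable_expR R)); apply: measurableT_comp => //.
    by apply: measurableT_comp => //; apply: measurable_sum => s; exact: mexp.
  by apply/funext => w; rewrite expRN lnK// posrE.
apply: random_element_entries => i.
apply: (measurability _ (RGenCInfty.measurableE R)).
move=> _ [_ [c ->] <-]; rewrite setTI.
have [c0|c0] := ltP 0 c; last first.
  rewrite (_ : _ @^-1` _ = setT)//; apply/seteqP; split => // w _ /=.
  rewrite in_itv/= andbT; apply: (le_trans c0).
  exact: (mass_ge0 (ordered_gibbs_weights (fun s => H s w) beta) i).
pose g w := gibbs_weight (fun sigma => H sigma w) beta.
have cntE w : \sum_(sigma : spins N) \1_(`[c, +oo[%classic) (g w sigma) =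
    (count (fun x => (c <= x)%R) [seq g w sigma | sigma <- enum {: spins N}])%:R :> R.
  rewrite count_map -sum1_count natr_sum -big_enum/=.
  rewrite [RHS]big_mkcond; apply: eq_bigr => s _.
  by rewrite indicE mem_setE in_itv/= andbT; case: (c <= _).
rewrite (_ : _ @^-1` _ = [set w | (i%:R : R) <
    \sum_(sigma : spins N) \1_(`[c, +oo[%classic) (g w sigma)]).
  apply: measurable_set_gt; apply: measurable_sum => sigma.
  by apply: (measurableT_comp _ (mg sigma)); exact: measurable_indic.
by apply/seteqP; split => w /=; rewrite in_itv/= andbT (le_nth_sort _ _ c0) cntE ltr_nat.
Qed.

(** * Point configurations and their normalized exponentials *)

Lemma point_count_reindex (R : realType) (eta : nat -> R) (s : nat -> nat) (A : set R) :
  bijective s -> point_count (fun i => eta (s i)) A = point_count eta A.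
Proof.
move=> bs; rewrite /point_count nneseries_esumT; last by move=> i; rewrite lee_fin.
rewrite [RHS]nneseries_esumT; last by move=> i; rewrite lee_fin.
rewrite [RHS](@reindex_esum _ _ _ setT setT s)//.
by rewrite setTT_bijective.
Qed.

Lemma point_count_cells (R : realType) (eta y : nat -> R) (k : nat -> nat) (n j : nat) :
  (forall l, (l < n)%N -> y l <= y l.+1) -> (forall i, eta i < y n) -> (j <= n)%N ->
  (forall l, (l < n)%N -> point_count eta `[y l, y l.+1[%classic = (k l)%:R%:E) ->
  point_count eta `[y j, +oo[%classic = (cumulative n k j)%:R%:E.
Proof.
move=> ynd etan jn kE.
have -> : point_count eta `[y j, +oo[%classic =
    (\sum_(0 <= i <oo) \sum_(j <= l < n) (\1_(`[y l, y l.+1[%classic) (eta i))%:E)%E.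
  apply: eq_eseriesr => i _.
  rewrite sumEFin; congr EFin.
  rewrite indicE mem_setE in_itv/= andbT -(cumulative_cells ynd (etan i) jn).
  rewrite natr_sum; apply: eq_bigr => l _.
  by rewrite indicE mem_setE in_itv.
rewrite (@nneseries_sum_nat R j n
  (fun l i => (\1_(`[y l, y l.+1[%classic) (eta i))%:E) 0%N); last first.
  by move=> l i; rewrite lee_fin.
rewrite (eq_big_nat _ _ (F2 := fun l => (k l)%:R%:E)) => [|l /andP[_ ln]]; last exact: kE.
by rewrite sumEFin -natr_sum.
Qed.

Lemma point_count_ge (R : realType) (v : nat -> R) (c : R) (i : nat) :
  nonincreasing_seq v -> c <= v i ->
  (i.+1%:R%:E <= point_count v `[c, +oo[%classic)%E.
Proof.
move=> vni cv.
apply: (@le_trans _ _ (\sum_(0 <= l < i.+1) (\1_(`[c, +oo[%classic) (v l))%:E)%E).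
  rewrite sumEFin lee_fin (_ : i.+1%:R = \sum_(0 <= l < i.+1) (1 : R)); last first.
    by rewrite sumr_const_nat subn0.
  apply: ler_sum_nat => l /andP[_ li]; rewrite indicE mem_setE in_itv/= andbT.
  by rewrite (le_trans cv)//; exact: vni.
by apply: nneseries_lim_ge => l _ _; rewrite lee_fin.
Qed.

Lemma nonincreasing_above (R : realType) (v : nat -> R) (c : R) (M i : nat) :
  nonincreasing_seq v -> point_count v `[c, +oo[%classic = M%:R%:E ->
  (c <= v i) = (i < M)%N.
Proof.
move=> vni vM; apply/idP/idP => [cv|iM].
  by have := point_count_ge vni cv; rewrite vM lee_fin ler_nat.
rewrite leNgt; apply/negP => vc.
have : ((M%:R%:E : \bar R) <= i%:R%:E)%E.
  rewrite -vM; apply: lime_le; first by apply: is_cvg_nneseries => l _ _; rewrite lee_fin.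
  apply: nearW => m; rewrite sumEFin lee_fin.
  have zero l : (i <= l)%N -> \1_(`[c, +oo[%classic) (v l) = 0 :> R.
    move=> il; rewrite indicE mem_setE in_itv/= andbT leNgt.
    by rewrite (le_lt_trans _ vc)//; exact: vni.
  have one l : \1_(`[c, +oo[%classic) (v l) <= 1 :> R by rewrite indicE; case: (_ \in _).
  have bnd p : \sum_(0 <= l < p) \1_(`[c, +oo[%classic) (v l) <= p%:R :> R.
    rewrite (_ : p%:R = \sum_(0 <= l < p) (1 : R)); first exact: ler_sum_nat.
    by rewrite sumr_const_nat subn0.
  have [mi|im] := leqP m i; first by rewrite (le_trans (bnd m))// ler_nat.
  rewrite (big_cat_nat (leq0n i) (ltnW im))/= [X in _ + X]big_nat_cond.
  by rewrite [X in _ + X]big1 ?addr0// => l /andP[/andP[il _] _]; exact: zero.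
by rewrite lee_fin ler_nat leqNgt iM.
Qed.

(** If the series of the weights diverged its limit would be the default value 0,
    and the normalized weights would vanish. *)
Lemma normalized_exp_cvg (R : realType) (eta : nat -> R) (beta : R)
    (zeta : mass_partition R) :
  decreasing_rearrangement (normalized_exp beta eta) zeta -> 0 < zeta 0%N ->
  exists S : R, [/\ 0 < S, forall i, \sum_(0 <= j < i) expR (beta * eta j) <= S &
    exists2 s : nat -> nat, bijective s & forall i, zeta i * S = expR (beta * eta (s i))].
Proof.
move=> [_ [s bs zE]] z0; set S := limn (series (fun j => expR (beta * eta j))).
have zS i : zeta i = expR (beta * eta (s i)) / S by rewrite zE.
have S0 : 0 < S by move: z0; rewrite zS pmulr_rgt0 ?expR_gt0// invr_gt0.
exists S; split => //; last by exists s => // i; rewrite zS divfK// gt_eqF.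
have cS : cvgn (series (fun j => expR (beta * eta j))).
  apply: contrapT => /dvgP; rewrite -/(limn _) => h; move: S0; rewrite /S h.
  by rewrite (_ : point = 0 :> R)// ltxx.
move=> i; apply: (nondecreasing_cvgn_le _ cS i).
by apply/nondecreasing_series => j _ _; exact: expR_ge0.
Qed.

(** The analogue of [ordered_gibbs_weights_resolved] for a point configuration:
    the ordered normalized exponentials enumerate the points in decreasing
    order. *)
Lemma rearranged_points_resolved (R : realType) (eta y : nat -> R) (k : nat -> nat)
    (n : nat) (beta e : R) (zeta : mass_partition R) :
  0 < beta -> decreasing_rearrangement (normalized_exp beta eta) zeta ->
  0 < zeta 0%N ->
  (forall l, (l < n)%N -> y l <= y l.+1) -> (forall i, eta i < y n) ->
  (forall l, (l < n)%N -> point_count eta `[y l, y l.+1[%classic = (k l)%:R%:E) ->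
  1 - e <= \sum_(0 <= i < cumulative n k 0) zeta i ->
  resolves n (fun j => expR (beta * y j)) e (cumulative n k) zeta.
Proof.
move=> beta0 zr z0 ynd etan kE ze.
have [S [S0 _ [s bs zS]]] := normalized_exp_cvg zr z0.
exists S; split => // j i jn; rewrite zS ler_expR ler_pM2l//.
apply: (nonincreasing_above (v := fun i => eta (s i))).
  move=> a b ab; have := mass_noninc zeta ab.
  by rewrite -(ler_pM2r S0) !zS ler_expR ler_pM2l.
by rewrite point_count_reindex// (point_count_cells ynd etan jn kE).
Qed.

(** The partial counts are nondecreasing natural numbers, so they are eventually
    constant when they are bounded. *)
Lemma point_count_nat (R : realType) (eta : nat -> R) (A : set R) :
  (point_count eta A < +oo)%E -> exists k, point_count eta A = k%:R%:E.
Proof.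
move=> fin.
pose g m : nat := (\sum_(0 <= i < m) (eta i \in A))%N.
have gE m : (\sum_(0 <= i < m) (\1_A (eta i) : R)%:E = (g m)%:R%:E)%E.
  by rewrite sumEFin natr_sum; congr EFin; apply: eq_bigr => i _; rewrite indicE.
have [B B_ge] : exists B : nat, forall m, (g m <= B)%N.
  have pc0 : (0 <= point_count eta A)%E by apply: nneseries_ge0 => i _ _; rewrite lee_fin.
  have pcf : point_count eta A \is a fin_num by rewrite ge0_fin_numE.
  have [B BP] : exists B : nat, fine (point_count eta A) <= B%:R.
    exists (Num.bound (fine (point_count eta A))); apply/ltW.
    apply: le_lt_trans (archi_boundP _); [exact: lexx|exact: fine_ge0].
  exists B => m; rewrite -(ler_nat R) -lee_fin -gE.
  apply: le_trans (_ : (point_count eta A <= B%:R%:E)%E); last by rewrite -(fineK pcf) lee_fin.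
  by apply: nneseries_lim_ge => i _ _; rewrite lee_fin.
have g_nd m m' : (m <= m')%N -> (g m <= g m')%N.
  by move=> mm'; rewrite /g (big_cat_nat (leq0n m) mm')/= leq_addr.
have ex : exists k, `[< exists m, g m = k >] by exists (g 0%N); apply/asboolP; exists 0%N.
have bnd k : `[< exists m, g m = k >] -> (k <= B)%N by move=> /asboolP[m <-].
case: (ex_maxnP ex bnd) => k /asboolP[m gm] kmax; exists k.
apply: cvg_lim => //; apply: cvg_near_cst; near=> m'.
rewrite gE; congr (_%:R%:E); apply/eqP; rewrite eqn_leq kmax ?andTb; last first.
  by apply/asboolP; exists m'.
by rewrite -gm; apply: g_nd; near: m'; exact: nbhs_infty_ge.
Unshelve. all: by end_near. Qed.

(** * Grids of the line *)

Lemma measurable_set_ge_e (R : realType) d (T : measurableType d) (g : T -> \bar R)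
    (r : \bar R) : measurable_fun setT g -> measurable [set w | (r <= g w)%E].
Proof.
move=> mg; rewrite (_ : [set _ | _] = setT `&` g @^-1` `[r, +oo%E]%classic).
  by apply: mg => //; exact: emeasurable_itv.
by rewrite setTI; apply/seteqP; split => w /=; rewrite in_itv/= leey andbT.
Qed.

Lemma measurable_set_le_e (R : realType) d (T : measurableType d) (g : T -> \bar R)
    (r : \bar R) : measurable_fun setT g -> measurable [set w | (g w <= r)%E].
Proof.
move=> mg; rewrite (_ : [set _ | _] = setT `&` g @^-1` `[-oo%E, r]%classic).
  by apply: mg => //; exact: emeasurable_itv.
by rewrite setTI; apply/seteqP; split => w /=; rewrite in_itv/= leNye.
Qed.

Lemma ae_increasing_union (R : realType) d (T : measurableType d)
    (P : probability T R) (G : nat -> set T) (e : R) :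
  (forall m, measurable (G m)) -> (forall m w, G m w -> G m.+1 w) ->
  {ae P, forall w, exists m, G m w} -> 0 < e ->
  exists m0, forall m, (m0 <= m)%N -> fine (P (~` G m)) <= e.
Proof.
move=> mG Gnd aeG e0.
have mCG m : measurable (~` G m) by exact: measurableC.
have cap0 : P (\bigcap_m ~` G m) = 0%E.
  apply/eqP; rewrite -measure_le0; case: aeG => A [mA A0 sub].
  rewrite -A0; apply: le_measure; rewrite ?inE//; first exact: bigcapT_measurable.
  apply: subset_trans sub => w h [m Gm]; exact: (h m I Gm).
have ni : nonincreasing_seq (fun m => ~` G m).
  apply/nonincreasing_seqP => m; apply/subsetPset => w h Gw; exact: h (Gnd _ _ Gw).
have fin0 : (P (~` G 0%N) < +oo)%E by rewrite ltey_eq fin_num_measure.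
have cvgG : (fun m => P (~` G m)) @ \oo --> 0%E.
  by rewrite -cap0; exact: nonincreasing_cvg_mu fin0 mCG (bigcapT_measurable mCG) ni.
move: cvgG => /fine_cvgP[_ /cvgrPdist_le/(_ e e0)[m0 _ h]].
exists m0 => m m0m; have := h m m0m; rewrite /= sub0r normrN.
by move=> /(le_trans (ler_norm _)).
Qed.

(** The point j of the subdivision of [- m, m] with step 1 / p. *)
Definition grid (R : realType) (m p j : nat) : R := - m%:R + j%:R / p%:R.

Definition grid_cell (R : realType) (m p j : nat) : set R :=
  `[grid R m p j, grid R m p j.+1[%classic.

Lemma grid_top (R : realType) (m p : nat) : (0 < p)%N -> grid R m p (2 * m * p) = m%:R.
Proof.
move=> p0; rewrite /grid !natrM mulfK; first ring.
by rewrite pnatr_eq0 -lt0n.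
Qed.

Lemma grid_nd (R : realType) (m p j : nat) : grid R m p j <= grid R m p j.+1.
Proof. by rewrite lerD2l ler_wpM2r ?invr_ge0// ler_nat. Qed.

(** Counts capped at b form a finite type; as a function on the natural numbers
    they vanish outside the grid. *)
Definition extend_counts (n b : nat) (kappa : {ffun 'I_n -> 'I_b.+1}) (l : nat) : nat :=
  if insub l is Some j then kappa j else 0%N.

Lemma extend_countsE n b (kappa : {ffun 'I_n -> 'I_b.+1}) (l : nat) (ln : (l < n)%N) :
  extend_counts kappa l = kappa (Ordinal ln).
Proof. by rewrite /extend_counts insubT. Qed.

(** A point in the cells above the level tau makes the total raw weight at least
    tau, so that a remainder of size e * tau is negligible. The level is fixed
    before the depth m of the grid. *)
Definition hits (R : realType) (beta tau : R) (m p n b : nat)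
    (kappa : {ffun 'I_n -> 'I_b.+1}) : bool :=
  [exists j : 'I_n.+1, (tau <= expR (beta * grid R m p j)) &&
    (0 < cumulative n (extend_counts kappa) j)%N].

Lemma mesh_error (R : realType) (e : R) : 0 <= e <= 2^-1 ->
  e + ((1 + e) ^+ 2 / (1 - e) - 1) <= 8 * e.
Proof.
move=> /andP[e0 e1].
have e1' : 0 < 1 - e by lra.
suff : (1 + e) ^+ 2 / (1 - e) <= 1 + 7 * e by lra.
by rewrite ler_pdivrMr//; rewrite expr2; nra.
Qed.

Lemma grid_mesh (R : realType) (beta q : R) (m p j : nat) :
  expR (beta / p%:R) <= q ->
  expR (beta * grid R m p j.+1) <= q * expR (beta * grid R m p j).
Proof.
move=> pq; have -> : beta * grid R m p j.+1 = beta / p%:R + beta * grid R m p j.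
  by rewrite /grid -natr1; ring.
by rewrite expRD ler_wpM2r ?expR_ge0.
Qed.

Lemma grid_le (R : realType) (m p j j' : nat) : (j <= j')%N ->
  grid R m p j <= grid R m p j'.
Proof. by move=> jj'; rewrite lerD2l ler_wpM2r ?invr_ge0// ler_nat. Qed.

Lemma grid_cell_disjoint (R : realType) (m p j j' : nat) (x : R) :
  grid_cell m p j x -> grid_cell m p j' x -> j = j'.
Proof.
wlog jj' : j j' / (j <= j')%N.
  by move=> H; have [|/ltnW] := leqP j j'; [exact: H|move=> h a b; apply/esym/H].
rewrite /grid_cell/= !in_itv/= => /andP[_ x1] /andP[x2 _].
apply/eqP; rewrite eqn_leq jj' leqNgt; apply/negP => lt.
by have := le_lt_trans (le_trans (grid_le R m p lt) x2) x1; rewrite ltxx.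
Qed.

Lemma exp_intensity_itv_fin (R : realType) (C b u v : R) :
  (exp_intensity C b `[u, v[%classic < +oo)%E.
Proof.
have mexp : measurable_fun setT (fun y : R => C * expR (- b * y)).
  apply: measurable_funM => //; apply: (measurableT_comp (@measurable_expR R)).
  exact: measurable_funM.
have fin : (lebesgue_measure (`[u, v[%classic : set R) < +oo)%E.
  by rewrite lebesgue_measure_itv/= lte_fin; case: ifP => _; rewrite ?ltry// -EFinB ltry.
have : lebesgue_measure.-integrable `[u, v[%classic
    (EFin \o (fun y : R => C * expR (- b * y))).
  apply: measurable_bounded_integrable => //; first exact: measurable_funTS.
  exists (`|C| * expR (`|b| * (`|u| + `|v|))); split; first exact: num_real.
  move=> x Bx y /=; rewrite in_itv/= => /andP[uy yv]; apply: le_trans (ltW Bx).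
  rewrite normrM ler_wpM2l// ger0_norm ?expR_ge0// ler_expR.
  apply: (le_trans (ler_norm _)); rewrite normrM normrN ler_wpM2l//.
  have := ler_norm v; have := ler_norm (- u); rewrite normrN.
  have := normr_ge0 u; have := normr_ge0 v.
  by move=> *; rewrite ler_norml; apply/andP; split; lra.
move=> /integrable_fin_num; rewrite fin_numE => /(_ (measurable_itv _))/andP[_].
by rewrite ltey.
Qed.

Lemma exp_intensity_ge0 (R : realType) (C b : R) (A : set R) : 0 <= C ->
  (0 <= exp_intensity C b A)%E.
Proof.
by move=> C0; apply: integral_ge0 => y _; rewrite lee_fin mulr_ge0// expR_ge0.
Qed.

Lemma fine_probability_setU (R : realType) d (T : measurableType d)
    (P : probability T R) (A B : set T) : measurable A -> measurable B ->
  fine (P (A `|` B)) <= fine (P A) + fine (P B).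
Proof.
move=> mA mB; rewrite -lee_fin EFinD !fineK ?fin_num_measure//.
  exact: measureU2.
exact: measurableU.
Qed.

(** * The Poisson process seen through its cell counts *)

Section poisson_side.
Variables (R : realType) (d : measure_display) (T : measurableType d).
Variables (P : probability T R) (eta : nat -> {RV P >-> R}).
Variables (zeta : T -> mass_partition R) (C b beta : R).
Hypotheses (beta_gt0 : 0 < beta)
  (eta_poisson : poisson_process eta (exp_intensity C b))
  (mzeta : random_element zeta)
  (zeta_rearranged : {ae P, forall w, decreasing_rearrangement
     (normalized_exp beta (fun i => eta i w)) (zeta w)})
  (zeta_proper : {ae P, forall w, proper (zeta w)}).

Let pts w i : R := eta i w.

Let mpts i : measurable_fun setT (fun w => pts w i).
Proof. exact: measurable_funP. Qed.

Let mcount (A : set R) : measurable A ->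
  measurable_fun setT (fun w => point_count (pts w) A).
Proof.
move=> mA; apply: (@ge0_emeasurable_sum _ _ _ _ (fun i w => (\1_A (pts w i))%:E) xpredT).
  by move=> i w _ _; rewrite lee_fin.
move=> i _; apply/measurable_EFinP; apply: (measurableT_comp _ (mpts i)).
exact: measurable_indic.
Qed.

Let hit (l : nat) : set T := \bigcup_i [set w | - l%:R < pts w i].

Let mhit l : measurable (hit l).
Proof. by apply: bigcupT_measurable => i; exact: measurable_set_gt. Qed.

Let top (m : nat) : set T := \bigcap_i [set w | pts w i < m%:R].

Let mtop m : measurable (top m).
Proof. by apply: bigcapT_measurable => i; exact: measurable_set_lt. Qed.

Let half (m : nat) : set R := `[- m%:R, +oo[%classic.

Let low (e : R) (m : nat) : set T := \bigcup_M [set w |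
  (M%:R%:E <= point_count (pts w) (half m))%E /\
  1 - e <= \sum_(0 <= i < M) zeta w i].

Let mlow e m : measurable (low e m).
Proof.
apply: bigcupT_measurable => M; rewrite [X in measurable X](_ : _ =
  [set w | (M%:R%:E <= point_count (pts w) (half m))%E] `&`
  ~` [set w | \sum_(0 <= i < M) zeta w i < 1 - e]).
  apply: measurableI; first by apply: measurable_set_ge_e; apply: mcount; exact: measurable_itv.
  apply: measurableC; apply: measurable_set_lt; apply: measurable_sum => i.
  exact: measurable_entry.
apply/seteqP; split => w /= [h1 h2]; split => //.
  by move=> /= h; move: h2; rewrite leNgt h.
by rewrite leNgt; apply/negP => h; exact: h2.
Qed.

Let few (m p n c : nat) : set T := \bigcap_(j in `I_n) [set w |
  (point_count (pts w) (grid_cell (R := R) m p j) <= c%:R%:E)%E].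

Let mfew m p n c : measurable (few m p n c).
Proof.
apply: bigcap_measurableType => j _; apply: measurable_set_le_e; apply: mcount.
exact: measurable_itv.
Qed.

Let good_pt w := decreasing_rearrangement (normalized_exp beta (pts w)) (zeta w) /\
  proper (zeta w).

Let ae_good : {ae P, forall w, good_pt w}.
Proof. by apply: filterS2 zeta_rearranged zeta_proper => w. Qed.

Let nat_above (x : R) : exists m : nat, x < m%:R.
Proof.
exists (Num.bound `|x|); apply: le_lt_trans (ler_norm x) (archi_boundP (normr_ge0 x)).
Qed.

Let hit_ae : {ae P, forall w, exists l, hit l w}.
Proof.
apply: aeW => w; have [l hl] := nat_above (- pts w 0%N).
by exists l, 0%N => //=; rewrite ltrNl.
Qed.

Let pts_bounded w : good_pt w -> exists S : R, forall n m,
  \sum_(0 <= i < n) \1_(half m) (pts w i) <= S * expR (beta * m%:R) /\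
  (forall i, expR (beta * pts w i) <= S).
Proof.
move=> [gr [zpos _]]; have [S [S0 Sub _]] := normalized_exp_cvg gr (zpos 0%N).
exists S => n m; split; last first.
  move=> i; apply: le_trans (Sub i.+1); rewrite big_nat_recr//= lerDr.
  by apply: sumr_ge0 => j _; exact: expR_ge0.
apply: (@le_trans _ _ (\sum_(0 <= i < n) expR (beta * pts w i) * expR (beta * m%:R))).
  apply: ler_sum => i _; rewrite indicE mem_setE in_itv/= andbT -expRD -mulrDr.
  have [h|_] := leP (- m%:R) (pts w i); last exact: expR_ge0.
  rewrite -[leLHS]expR0 ler_expR mulr_ge0 ?(ltW beta_gt0)//.
  by rewrite -lerBlDr sub0r.
by rewrite -mulr_suml ler_wpM2r ?expR_ge0.
Qed.

(** The weights of the points are summable, hence bounded. *)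
Let top_ae : {ae P, forall w, exists m, top m w}.
Proof.
apply: filterS ae_good => w gw; have [S SP] := pts_bounded gw.
have [_ SP'] := SP 0%N 0%N.
have S0 : 0 < S by apply: lt_le_trans (SP' 0%N); exact: expR_gt0.
have [m hm] := nat_above (ln S / beta); exists m => i _ /=; apply: le_lt_trans hm.
rewrite ler_pdivlMr// mulrC -ler_expR lnK ?posrE//; exact: SP'.
Qed.

(** Finitely many entries carry the mass 1 - e, and they come from finitely many
    points. *)
Let low_ae e : 0 < e -> {ae P, forall w, exists m, low e m w}.
Proof.
move=> e0; apply: filterS ae_good => w [gr [zpos zsum]].
have [S [S0 _ [s bs zS]]] := normalized_exp_cvg gr (zpos 0%N).
have /cvgrPdist_le/(_ e e0)[n _ hn] := zsum.
have [m hm] := nat_above (- pts w (s n)).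
exists m, n.+1 => //=; split; last first.
  have := hn n.+1 (leqnSn n); rewrite /series/= ler_norml => /andP[_].
  by rewrite lerBlDr addrC -lerBlDr.
rewrite -(point_count_reindex _ _ bs); apply: point_count_ge; last first.
  by rewrite lerNl ltW.
move=> i j ij; have := mass_noninc (zeta w) ij.
by rewrite -(ler_pM2r S0) !zS ler_expR ler_pM2l.
Qed.

Let count_nat w m p j : good_pt w ->
  exists k : nat, point_count (pts w) (grid_cell (R := R) m p j) = k%:R%:E.
Proof.
move=> gw; have [S SP] := pts_bounded gw.
apply: point_count_nat; apply: (@le_lt_trans _ _ (S * expR (beta * m%:R))%:E); last exact: ltry.
apply: lime_le; first by apply: is_cvg_nneseries => i _ _; rewrite lee_fin.
apply: nearW => n; rewrite sumEFin lee_fin; apply: le_trans (SP n m).1.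
apply: ler_sum => i _; rewrite !indicE !mem_setE !in_itv/= andbT ler_nat.
case h1 : (- m%:R <= pts w i); first by case: (_ && _).
case: andP => // -[h2 _]; move: h1; rewrite (le_trans _ h2)//.
by rewrite /grid lerDl divr_ge0.
Qed.

Let few_ae m p n : {ae P, forall w, exists c, few m p n c w}.
Proof.
apply: filterS ae_good => w gw.
have [k kP] := choice (fun j => count_nat m p j gw).
exists (\sum_(i < n) k i)%N => j /= jn; rewrite kP lee_fin ler_nat.
by rewrite (bigD1 (Ordinal jn))//= leq_addr.
Qed.

(** Off a null set, each of the four conditions holds with probability close to 1
    once its parameter is large, and together they make the configuration
    resolved by capped counts. *)
Let good_resolved w e m p c l : (0 < p)%N -> (l <= m)%N ->
  good_pt w -> hit l w -> top m w -> low e m w -> few m p (2 * m * p) c w ->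
  let n := (2 * m * p)%N in
  exists kappa : {ffun 'I_n -> 'I_c.+1},
   [/\ hits beta (expR (- (beta * l%:R))) m p kappa,
       forall j : 'I_n, point_count (pts w) (grid_cell (R := R) m p j) = (kappa j)%:R%:E &
       resolves n (fun j => expR (beta * grid R m p j)) e
         (cumulative n (extend_counts kappa)) (zeta w)].
Proof.
move=> p0 lm gw [i0 _ hi0] tw [M _ [lowM sumM]] fw n.
have [k kP] := choice (fun j => count_nat m p j gw).
have kc (j : 'I_n) : (k j < c.+1)%N.
  by have := fw j (ltn_ord j); rewrite /= kP lee_fin ler_nat ltnS.
pose kappa := [ffun j : 'I_n => Ordinal (kc j)].
have extE j : (j < n)%N -> extend_counts kappa j = k j.
  by move=> jn; rewrite (extend_countsE kappa jn) ffunE.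
have cumE j : cumulative n (extend_counts kappa) j = cumulative n k j.
  by apply: eq_big_nat => i /andP[_]; exact: extE.
have ptn i : pts w i < grid R m p n by rewrite grid_top//; exact: tw.
have gnd j : (j < n)%N -> grid R m p j <= grid R m p j.+1 by move=> _; exact: grid_nd.
have kE j : (j < n)%N -> point_count (pts w) (grid_cell (R := R) m p j) = (k j)%:R%:E by [].
have cumP j : (j <= n)%N -> point_count (pts w) `[grid R m p j, +oo[%classic =
    (cumulative n k j)%:R%:E by move=> jn; exact: (point_count_cells gnd ptn jn kE).
have [gr [zpos _]] := gw.
exists kappa; split.
- (* the grid point number (m - l) * p is - l *)
  have jn : ((m - l) * p <= n)%N.
    by rewrite leq_mul2r (leq_trans (leq_subr _ _)) ?orbT// leq_pmull.
  have gridj : grid R m p ((m - l) * p) = - l%:R.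
    rewrite /grid natrM mulfK ?pnatr_eq0 -?lt0n// natrB//; ring.
  apply/existsP; exists (Ordinal (jn : ((m - l) * p < n.+1)%N)).
  rewrite /= gridj mulrN lexx/= cumE lt0n; apply/eqP => cum0.
  have := cumP _ jn; rewrite cum0 gridj => pc0.
  have : ((\1_(`[- l%:R, +oo[%classic) (pts w i0))%:E <= (0%:R%:E : \bar R))%E.
    rewrite -pc0; apply: (@le_trans _ _ (\sum_(0 <= i < i0.+1)
        (\1_(`[- l%:R, +oo[%classic) (pts w i))%:E)%E).
      by rewrite big_nat_recr//= leeDr// sume_ge0// => i _; rewrite lee_fin.
    by apply: nneseries_lim_ge => i _ _; rewrite lee_fin.
  by rewrite indicE mem_setE in_itv/= andbT (ltW hi0) lee_fin ler10.
- by move=> j; rewrite ffunE kP.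
- have -> : cumulative n (extend_counts kappa) = cumulative n k by apply/funext => j.
  apply: (rearranged_points_resolved beta_gt0 gr (zpos 0%N) gnd ptn kE).
  apply: (le_trans sumM).
  have MM : (M <= cumulative n k 0)%N.
    have := cumP 0%N (leq0n _); rewrite /grid mul0r addr0 => h.
    by move: lowM; rewrite /half h lee_fin ler_nat.
  rewrite [leRHS](big_cat_nat (leq0n M) MM)/= lerDl sumr_ge0// => i _.
  exact: mass_ge0.
Qed.

Let cell_mean (m p j : nat) : R := fine (exp_intensity C b (grid_cell (R := R) m p j)).

Let counts_set m p n c (kappa : {ffun 'I_n -> 'I_c.+1}) : set T :=
  \bigcap_(j in [set` enum 'I_n])
    ((fun w => point_count (pts w) (grid_cell (R := R) m p j)) @^-1`
      [set (kappa j)%:R%:E]).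

Let mgrid_cell m p j : measurable (grid_cell (R := R) m p j).
Proof. exact: measurable_itv. Qed.

Let mcounts_set m p n c (kappa : {ffun 'I_n -> 'I_c.+1}) :
  measurable (counts_set m p kappa).
Proof.
apply: fin_bigcap_measurable => [|j _]; first exact: finite_seq.
rewrite -[X in measurable X]setTI; by apply: mcount.
Qed.

Let counts_set_prob m p n c (kappa : {ffun 'I_n -> 'I_c.+1}) :
  fine (P (counts_set m p kappa)) =
  \prod_(j < n) poisson_mass (cell_mean m p j) (kappa j).
Proof.
have [count_pmf _ count_indep] := eta_poisson.
have mA (j : 'I_n) : measurable (grid_cell (R := R) m p j) by [].
have tA : trivIset setT (fun j : 'I_n => grid_cell (R := R) m p j).
  apply/trivIsetP => j j' _ _ jj'; apply/seteqP; split => // x [h h'].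
  by case/eqP: jj'; apply/val_inj; exact: grid_cell_disjoint h h'.
have := count_indep n (fun j => grid_cell (R := R) m p j) mA tA (enum 'I_n)
  (fun j => [set (kappa j)%:R%:E]) (enum_uniq _) (fun j => emeasurable_set1 _).
rewrite /counts_set => ->.
rewrite big_enum/=.
rewrite (eq_bigr (fun j : 'I_n => (poisson_mass (cell_mean m p j) (kappa j))%:E)).
  by rewrite prodEFin.
move=> j _; apply: count_pmf => //.
exact: exp_intensity_itv_fin.
Qed.

Variables (f : mass_partition R -> R) (L B : R).
Hypotheses (L_ge0 : 0 <= L)
  (fL : forall p p', `|f p - f p'| <= L * mass_dist p p')
  (fB : forall p, `|f p| <= B).

(** The parameters are chosen in the order e, l, p, m, c: the level of a first
    point, the mesh, the depth of the grid, the cap on the counts. The lower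
    bound m1 leaves room for the conditions that the energies impose on m.
    The bound on the sum of Q is the case of the constant function 1. *)
Lemma poisson_side_by_counts (e : R) : 0 < e -> e <= 2^-1 ->
  exists l : nat, forall p m1, (0 < p)%N -> expR (beta / p%:R) <= 1 + e ->
  exists m c, [/\ (m1 <= m)%N, (0 < m)%N &
   let n := (2 * m * p)%N in
   let G := @hits R beta (expR (- (beta * l%:R))) m p n c : pred {ffun 'I_n -> 'I_c.+1} in
   let rep := resolved_representative n (fun j => expR (beta * grid R m p j)) e
     (fun kappa : {ffun 'I_n -> 'I_c.+1} => cumulative n (extend_counts kappa)) in
   let Q := fun kappa : {ffun 'I_n -> 'I_c.+1} =>
     \prod_(j < n) poisson_mass (fine (exp_intensity C b (grid_cell (R := R) m p j)))
       (kappa j) in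
   `|(\int[P]_w f (zeta w))%R - \sum_(kappa | G kappa) f (rep kappa) * Q kappa| <=
     L * (8 * e) + 2 * B * (3 * e) /\
   1 - 6 * e <= \sum_(kappa | G kappa) Q kappa].
Proof.
move=> e0 e2.
have hit_nd l w : hit l w -> hit l.+1 w.
  move=> [i _ h]; exists i => //=; apply: le_lt_trans h.
  by rewrite lerN2 ler_nat.
have [l hl] := ae_increasing_union mhit hit_nd hit_ae e0.
exists l => p m1 p0 pq.
have top_nd m w : top m w -> top m.+1 w.
  by move=> h i _; apply: lt_le_trans (h i I) _; rewrite ler_nat.
have e20 : 0 < e / 2 by rewrite divr_gt0.
have [m2 hm2] := ae_increasing_union mtop top_nd top_ae e20.
have low_nd m w : low e m w -> low e m.+1 w.
  move=> [M _ [h1 h2]]; exists M => //; split => //; apply: le_trans h1 _.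
  apply: lee_nneseries => [i _ _|i _]; rewrite lee_fin//.
  rewrite !indicE !mem_setE !in_itv/= !andbT ler_nat.
  case h : (- m%:R <= pts w i) => //.
  by rewrite (le_trans _ h)// lerN2 ler_nat.
have [m3 hm3] := ae_increasing_union (mlow e) low_nd (low_ae e0) e20.
pose m := (maxn l (maxn m1 (maxn m2 m3))).+1.
pose n := (2 * m * p)%N.
have few_nd c w : few m p n c w -> few m p n c.+1 w.
  by move=> h j jn; apply: le_trans (h j jn) _; rewrite lee_fin ler_nat.
have [c hc] := ae_increasing_union (mfew m p n) few_nd (few_ae m p n) e0.
have [Z [mZ Z0 Zgood]] : exists Z, [/\ measurable Z, P Z = 0%E &
    forall w, ~ Z w -> good_pt w].
  case: ae_good => Z [mZ Z0 sub]; exists Z; split => // w nZ.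
  by apply: contrapT => h; apply: nZ; exact: sub.
exists m, c; split => //.
  by rewrite /m leqW// !leq_max leqnn orbT.
move=> n' G rep Q.
pose bad := Z `|` (~` hit l `|` (~` top m `|` (~` low e m `|` ~` few m p n c))).
have mbad : measurable bad.
  apply: (measurableU _ _ mZ); apply: (measurableU _ _ (measurableC (mhit l))).
  apply: (measurableU _ _ (measurableC (mtop m))).
  exact: (measurableU _ _ (measurableC (mlow e m)) (measurableC (mfew m p n c))).
have Pbad : fine (P bad) <= 3 * e.
  have m4 := measurableU _ _ (measurableC (mlow e m)) (measurableC (mfew m p n c)).
  have m5 := measurableU _ _ (measurableC (mtop m)) m4.
  have m6 := measurableU _ _ (measurableC (mhit l)) m5.
  have := fine_probability_setU P mZ m6.
  have := fine_probability_setU P (measurableC (mhit l)) m5.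
  have := fine_probability_setU P (measurableC (mtop m)) m4.
  have := fine_probability_setU P (measurableC (mlow e m)) (measurableC (mfew m p n c)).
  rewrite Z0 /= add0r.
  have := hl l (leqnn l); have := hc c (leqnn c).
  have : (m2 <= m)%N by rewrite leqW// !leq_max leqnn !orbT.
  move=> /hm2; have : (m3 <= m)%N by rewrite leqW// !leq_max leqnn !orbT.
  move=> /hm3; rewrite -/bad; lra.
have good w : ~ bad w -> exists kappa : {ffun 'I_n -> 'I_c.+1},
    [/\ G kappa, counts_set m p kappa w & resolves n (fun j => expR (beta * grid R m p j)) e
         (cumulative n (extend_counts kappa)) (zeta w)].
  move=> nbad.
  have gw : good_pt w by apply: Zgood => h; apply: nbad; left.
  have h1 : hit l w by apply: contrapT => h; apply: nbad; right; left.
  have h2 : top m w by apply: contrapT => h; apply: nbad; right; right; left.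
  have h3 : low e m w by apply: contrapT => h; apply: nbad; right; right; right; left.
  have h4 : few m p n c w by apply: contrapT => h; apply: nbad; right; right; right; right.
  have lm : (l <= m)%N by rewrite leqW// leq_maxl.
  have [kappa [k1 k2 k3]] := good_resolved p0 lm gw h1 h2 h3 h4.
  by exists kappa; split => // j _; exact: k2.
have mesh j : (j < n)%N -> expR (beta * grid R m p j.+1) <=
  (1 + e) * expR (beta * grid R m p j) by move=> _; exact: grid_mesh.
have q1 : 1 <= 1 + e by rewrite lerDl ltW.
have e01 : 0 <= e < 1 by apply/andP; split; lra.
have Edisj kappa kappa' w : counts_set m p kappa w -> counts_set m p kappa' w ->
    kappa = kappa' :> {ffun 'I_n -> 'I_c.+1}.
  move=> h h'; apply/ffunP => j; apply/val_inj => /=.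
  have jn : [set` enum 'I_n] j by rewrite /= mem_enum.
  have := h j jn; rewrite /= (h' j jn) => -[/eqP]; rewrite eqr_nat => /eqP.
  by [].
have e12 : 0 <= e <= 2^-1 by rewrite ltW.
have main g Lg Bg : 0 <= Lg -> (forall p p', `|g p - g p'| <= Lg * mass_dist p p') ->
    (forall p, `|g p| <= Bg) ->
  `|(\int[P]_w g (zeta w))%R - \sum_(kappa | G kappa) g (rep kappa) * Q kappa| <=
     Lg * (8 * e) + 2 * Bg * (3 * e).
  move=> Lg0 gL gB.
  have := @expectation_by_counts R n (fun j => expR (beta * grid R m p j)) (1 + e) e
    (fun j => expR_gt0 _) mesh q1 e01 _
    (fun kappa : {ffun 'I_n -> 'I_c.+1} => cumulative n (extend_counts kappa))
    (fun kappa => cumulative_top _ _) g Lg Bg Lg0 gL gB d T P zeta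
    (fun kappa => counts_set m p kappa) G bad (3 * e) mzeta (fun kappa => mcounts_set _ _ _)
    Edisj mbad Pbad good.
  rewrite (eq_bigr (fun kappa => g (rep kappa) * Q kappa)); last first.
    by move=> kappa _; rewrite counts_set_prob.
  move=> h; apply: (le_trans h); rewrite lerD2r ler_wpM2l//.
  exact: mesh_error.
split; first exact: main.
have const_lip (p1 p2 : mass_partition R) : `|(1 : R) - 1| <= 0 * mass_dist p1 p2.
  by rewrite subrr normr0 mul0r.
have const_bnd (p1 : mass_partition R) : `|1 : R| <= 1 by rewrite normr1.
have := main (fun=> 1) 0 1 (lexx 0) const_lip const_bnd.
rewrite Rintegral_cst_probability mul0r add0r mulr1.
under eq_bigr do rewrite mul1r.
rewrite ler_norml => /andP[_ h].
by rewrite lerBlDl -lerBlDr (le_trans h)// mulrA -natrM.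
Qed.

End poisson_side.

(** * The energies seen through their cell counts *)

Lemma prod_dist_le (R : realType) (I : Type) (r : seq I) (a b : I -> R) :
  (forall i, 0 <= a i <= 1) -> (forall i, 0 <= b i <= 1) ->
  `|\prod_(i <- r) a i - \prod_(i <- r) b i| <= \sum_(i <- r) `|a i - b i|.
Proof.
move=> a01 b01.
have pa : 0 <= \prod_(i <- r) a i <= 1.
  by rewrite prodr_ge0 ?prodr_ile1// => i _; have /andP[] := a01 i.
elim: r {pa} => [|i r IH]; first by rewrite !big_nil subrr normr0.
rewrite !big_cons.
set A := \prod_(_ <- r) a _; set D := \prod_(_ <- r) b _.
have /andP[A0 A1] : 0 <= A <= 1.
  by rewrite prodr_ge0 ?prodr_ile1// => j _; have /andP[] := a01 j.
have /andP[b0 b1] := b01 i.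
have -> : a i * A - b i * D = (a i - b i) * A + b i * (A - D) by ring.
apply: (le_trans (ler_normD _ _)); rewrite !normrM (ger0_norm A0) (ger0_norm b0).
by apply: lerD; [rewrite ler_piMr|apply: le_trans IH; rewrite ler_piMl].
Qed.

Lemma poisson_counts_lipschitz (R : realType) (n : nat) (x x' : 'I_n -> R)
    (k : {ffun 'I_n -> nat}) : (forall j, 0 <= x j) -> (forall j, 0 <= x' j) ->
  `|poisson_counts x k - poisson_counts x' k| <= \sum_j `|x j - x' j|.
Proof.
move=> x0 x'0; apply: (le_trans (prod_dist_le _ _ _)).
- by move=> j; rewrite poisson_mass_ge0 ?poisson_mass_le1.
- by move=> j; rewrite poisson_mass_ge0 ?poisson_mass_le1.
apply: ler_sum => j _.
wlog xx' : x x' x0 x'0 / x' j <= x j.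
  move=> W; have [|/ltW] := leP (x' j) (x j); first exact: W.
  by move=> h; rewrite distrC (distrC (x j)); exact: W.
have d0 : 0 <= x j - x' j by rewrite subr_ge0.
have := poisson_mass_lipschitz (k j) (x'0 j) d0.
rewrite (_ : x' j + (x j - x' j) = x j); last by ring.
by rewrite (ger0_norm d0).
Qed.

Lemma mutually_independent_translate (R : realType) d (T : measurableType d)
    (P : probability T R) (I : eqType) (X : I -> T -> R) (t : I -> R) :
  mutually_independent P X ->
  mutually_independent P (fun i w => X i w + t i).
Proof.
move=> indX J B uJ mB.
have mB' i : measurable ((fun x => x + t i) @^-1` B i).
  rewrite -[X in measurable X]setTI.
  have mt : measurable_fun setT (fun x : R => x + t i) by exact: measurable_funD.
  exact: mt.
exact: (indX J (fun i => (fun x => x + t i) @^-1` B i) uJ mB').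
Qed.

Lemma fine_probability_bigsetU (R : realType) d (T : measurableType d)
    (P : probability T R) (I : Type) (r : seq I) (F : I -> set T) :
  (forall i, measurable (F i)) ->
  fine (P (\big[setU/set0]_(i <- r) F i)) <= \sum_(i <- r) fine (P (F i)).
Proof.
move=> mF; elim: r => [|i r IH]; first by rewrite !big_nil measure0.
rewrite !big_cons; apply: le_trans (fine_probability_setU _ _ _) _ => //.
  exact: bigsetU_measurable.
by rewrite lerD2l.
Qed.

Section array_side.
Variables (R : realType) (b C K beta e : R) (l p m c : nat).
Hypotheses (b_gt0 : 0 < b) (C_gt0 : 0 < C) (K_ge0 : 0 <= K) (b_beta : b < beta)
  (e_gt0 : 0 < e) (e_le : e <= 2^-1) (p_gt0 : (0 < p)%N) (m_gt0 : (0 < m)%N)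
  (mesh : expR (beta / p%:R) <= 1 + e).

Let tau : R := expR (- (beta * l%:R)).

Hypotheses (top_small : K / b * expR (- b * m%:R) <= e)
  (low_small : K / (beta - b) * expR (- (beta - b) * m%:R) <= e * (e * tau)).

Let n := (2 * m * p)%N.
Let label := {ffun 'I_n -> 'I_c.+1}.
Let G : pred label := @hits R beta tau m p n c.
Let rep := resolved_representative n (fun j => expR (beta * grid R m p j)) e
     (fun kappa : label => cumulative n (extend_counts kappa)).
Let lambda (j : 'I_n) : R := fine (exp_intensity C b (grid_cell (R := R) m p j)).
Let Q (kappa : label) := \prod_(j < n) poisson_mass (lambda j) (kappa j).

Hypothesis Q_mass : 1 - 6 * e <= \sum_(kappa | G kappa) Q kappa.

Variables (f : mass_partition R -> R) (L B : R).
Hypotheses (L_ge0 : 0 <= L)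
  (fL : forall p p', `|f p - f p'| <= L * mass_dist p p')
  (fB : forall p, `|f p| <= B).

Let as_counts (kappa : label) : {ffun 'I_n -> nat} := [ffun j => kappa j : nat].

(** c1, c2 and D depend on the parameters only, and neither on N nor on the
    field: this is what makes the final estimate uniform over good fields. *)
Let c1 : R := expR (b * m%:R) * K * m%:R * (2 * m%:R).
Let Lam : R := \sum_j lambda j.
Let c2 : R := 4 * m%:R * (Lam + n%:R * c1) + n%:R * c1.
Let D : R := 1 + 2 * m%:R + #|{: label}|%:R * c2 / e.

Let beta_gt0 : 0 < beta. Proof. exact: lt_trans b_gt0 b_beta. Qed.

Let lambda_ge0 j : 0 <= lambda j.
Proof. by apply: fine_ge0; apply: exp_intensity_ge0; exact: ltW. Qed.

Let c1_ge0 : 0 <= c1.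
Proof. by rewrite /c1 !mulr_ge0// expR_ge0. Qed.

Let c2_ge0 : 0 <= c2.
Proof.
have : 0 <= Lam by apply: sumr_ge0.
by move=> ?; rewrite /c2 addr_ge0 ?mulr_ge0 ?addr_ge0// mulr_ge0.
Qed.

Variables (d : measure_display) (T : measurableType d) (P : probability T R).
Variables (N : nat) (X : spins N -> {RV P >-> R}) (h : nat -> R) (a : R).
Hypotheses (N_gt0 : (0 < N)%N)
  (X_indep : mutually_independent P (fun sigma => X sigma : T -> R))
  (X_gaussian : forall sigma A, measurable A ->
     distribution P (X sigma) A = normal_prob 0 (Num.sqrt N%:R) A)
  (K_bound : forall y, expR (b * y) * gibbs_intensity N h (a + y) <= K /\
      `|expR (b * y) * gibbs_intensity N h (a + y) - C| <=
        K * (`|y| / Num.sqrt N%:R))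
  (N_large : D <= Num.sqrt N%:R).

Let H := centred_energy X h a.

Let mH sigma : measurable_fun setT (H sigma).
Proof. exact: measurable_centred_energy. Qed.

Let H_indep : mutually_independent P H.
Proof. exact: mutually_independent_translate X_indep. Qed.

Let cells (j : 'I_n) : set R := grid_cell m p j.

Let mcells j : measurable (cells j). Proof. exact: measurable_itv. Qed.

Let cells_disj x j j' : cells j x -> cells j' x -> j = j'.
Proof. by move=> h1 h2; apply/val_inj; exact: grid_cell_disjoint h1 h2. Qed.

Let E (kappa : label) : set T :=
  counts_event H cells (enum {: spins N}) (as_counts kappa).

Let sqrtN_gt0 : 0 < Num.sqrt N%:R :> R.
Proof. by rewrite sqrtr_gt0 ltr0n. Qed.

Let frac_ge0 : 0 <= #|{: label}|%:R * c2 / e.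
Proof. by rewrite divr_ge0 ?mulr_ge0// ltW. Qed.

Let sqrtN_ge1 : 1 <= Num.sqrt N%:R :> R.
Proof.
by apply: le_trans N_large; rewrite /D -addrA lerDl addr_ge0// mulr_ge0.
Qed.

Let prob_cells (sigma : spins N) j := cell_prob P H cells sigma j.

Let prob_cells_ge0 sigma j : 0 <= prob_cells sigma j.
Proof. by apply: fine_ge0; exact: measure_ge0. Qed.

Let grid_n (j : 'I_n) : grid R m p j.+1 <= m%:R.
Proof.
rewrite -(grid_top R m p_gt0); apply: grid_le; exact: ltn_ord.
Qed.

Let grid_0 (j : nat) : - m%:R <= grid R m p j.
Proof. by rewrite /grid lerDl divr_ge0. Qed.

Let tot_le sigma : \sum_j prob_cells sigma j <= 2 * m%:R / Num.sqrt N%:R.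
Proof.
apply: (@le_trans _ _ (\sum_(j < n) (p%:R^-1 / Num.sqrt N%:R))).
  apply: ler_sum => j _.
  apply: (le_trans (centred_energy_prob_le h a N_gt0 X_gaussian sigma (grid_nd R m p j))).
  rewrite ler_wpM2r ?invr_ge0 ?(ltW sqrtN_gt0)//.
  by rewrite /grid -natr1; lra.
rewrite sumr_const card_ord -[_ *+ n]mulr_natl /n !natrM mulrA mulfK//.
by rewrite pnatr_eq0 -lt0n.
Qed.

Let tot_le1 sigma : \sum_j prob_cells sigma j <= 1.
Proof.
apply: (le_trans (tot_le sigma)); rewrite ler_pdivrMr// mul1r.
by apply: le_trans N_large; rewrite /D; have := frac_ge0; lra.
Qed.

Let meanN (j : 'I_n) : R := \sum_(sigma <- enum {: spins N}) prob_cells sigma j.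

Let meanN_ge0 j : 0 <= meanN j. Proof. by apply: sumr_ge0. Qed.

Let meanN_close j : `|meanN j - lambda j| <= c1 / Num.sqrt N%:R.
Proof.
have := centred_energy_cell_mean N_gt0 X_gaussian b_gt0 C_gt0 K_bound
  (ler0n R m) (grid_0 j) (grid_nd R m p j) (grid_n j).
by rewrite /meanN big_enum/=.
Qed.

Let sum_meanN : \sum_j meanN j <= Lam + n%:R * c1.
Proof.
apply: (@le_trans _ _ (\sum_j (lambda j + c1))).
  apply: ler_sum => j _; have := meanN_close j; rewrite ler_norml => /andP[_].
  have : c1 / Num.sqrt N%:R <= c1 by rewrite ler_pdivrMr// ler_peMr.
  lra.
by rewrite big_split/= sumr_const card_ord -[_ *+ n]mulr_natl.
Qed.

(** Two errors, each O (1 / sqrt N): the Poisson approximation, whose error is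
    the sum of squares of probabilities O (1 / sqrt N) that add up to O (1), and
    the difference between the mean counts and those of the limit. *)
Let count_prob kappa : `|fine (P (E kappa)) - Q kappa| <= c2 / Num.sqrt N%:R.
Proof.
have -> : fine (P (E kappa)) =
    counts_law (cell_prob P H cells) (enum {: spins N}) (as_counts kappa).
  by rewrite /E probability_counts_event// enum_uniq.
have := counts_law_poisson prob_cells_ge0 tot_le1 (enum {: spins N}) (as_counts kappa).
have := poisson_counts_lipschitz (as_counts kappa) meanN_ge0 lambda_ge0.
have -> : poisson_counts lambda (as_counts kappa) = Q kappa.
  by apply: eq_bigr => j _; rewrite ffunE.
have sq : \sum_(sigma <- enum {: spins N}) (\sum_j prob_cells sigma j) ^+ 2 <=
    2 * m%:R / Num.sqrt N%:R * (Lam + n%:R * c1).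
  apply: (@le_trans _ _ (2 * m%:R / Num.sqrt N%:R *
      \sum_(sigma <- enum {: spins N}) \sum_j prob_cells sigma j)).
    rewrite mulr_sumr; apply: ler_sum => sigma _; rewrite expr2 ler_wpM2r//.
    exact: sumr_ge0.
  rewrite ler_wpM2l ?divr_ge0 ?mulr_ge0 ?(ltW sqrtN_gt0)//.
  by rewrite exchange_big.
have sm : \sum_j `|meanN j - lambda j| <= n%:R * c1 / Num.sqrt N%:R.
  apply: (@le_trans _ _ (\sum_(j < n) (c1 / Num.sqrt N%:R))).
    by apply: ler_sum => j _; exact: meanN_close.
  by rewrite sumr_const card_ord -[_ *+ n]mulr_natl mulrA.
move=> h1 h2; rewrite -(subrK (poisson_counts meanN (as_counts kappa)) (counts_law _ _ _)).
rewrite -addrA; apply: (le_trans (ler_normD _ _)).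
apply: (@le_trans _ _ (2 * (2 * m%:R / Num.sqrt N%:R * (Lam + n%:R * c1)) +
    n%:R * c1 / Num.sqrt N%:R)).
  by apply: lerD; [apply: (le_trans h2); rewrite ler_wpM2l|exact: le_trans h1 sm].
rewrite le_eqVlt; apply/orP; left; apply/eqP; rewrite /c2.
by field; rewrite gt_eqF.
Qed.

Let count_prob_sum : \sum_(kappa : label) `|fine (P (E kappa)) - Q kappa| <= e.
Proof.
apply: (@le_trans _ _ (\sum_(kappa : label) (c2 / Num.sqrt N%:R))).
  by apply: ler_sum => kappa _; exact: count_prob.
rewrite sumr_const -[_ *+ #|_|]mulr_natl mulrA ler_pdivrMr// [leRHS]mulrC -ler_pdivrMr//.
by apply: le_trans N_large; rewrite /D lerDr addr_ge0// mulr_ge0.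
Qed.

Let bad_top : set T := \big[setU/set0]_(sigma <- enum {: spins N})
  (H sigma @^-1` `[m%:R, +oo[%classic).

Let mtop sigma : measurable (H sigma @^-1` `[m%:R, +oo[%classic).
Proof. by rewrite -[X in measurable X]setTI; exact: mH. Qed.

Let mbad_top : measurable bad_top. Proof. exact: bigsetU_measurable. Qed.

Let bad_topP w : ~ bad_top w -> forall sigma, H sigma w < m%:R.
Proof.
move=> nb sigma; rewrite ltNge; apply/negP => Hm; apply: nb.
rewrite /bad_top -bigcup_seq; exists sigma => /=; first by rewrite mem_enum.
by rewrite in_itv/= Hm.
Qed.

Let bad_top_prob : fine (P bad_top) <= e.
Proof.
apply: (le_trans (fine_probability_bigsetU _ _ _)) => //; rewrite big_enum/=.
apply: le_trans top_small; rewrite -lee_fin -sumEFin.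
apply: le_trans (centred_energy_top_le X_gaussian b_gt0 K_bound m%:R).
by apply: lee_sum => sigma _; rewrite fineK// fin_num_measure.
Qed.

Let rem sigma w : R :=
  expR (beta * H sigma w) * \1_(`]-oo, (- m%:R)%R]%classic) (H sigma w).

Let rem_ge0 sigma w : 0 <= rem sigma w.
Proof. by rewrite mulr_ge0 ?expR_ge0. Qed.

Let mrem sigma : measurable_fun setT (rem sigma).
Proof.
apply: measurable_funM.
  by apply: (measurableT_comp (@measurable_expR R)); exact: measurable_funM.
by apply: (measurableT_comp _ (mH sigma)); exact: measurable_indic.
Qed.

Let irem sigma : P.-integrable setT (EFin \o rem sigma).
Proof.
apply: (@measurable_integrable_bounded _ _ _ P (rem sigma) 1) => // w.
rewrite ger0_norm// /rem indicE mem_setE in_itv/=.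
have [Hm|_] := leP (H sigma w) (- m%:R); last by rewrite mulr0.
rewrite mulr1 expR_le1 pmulr_rle0//; apply: (le_trans Hm).
by rewrite oppr_le0.
Qed.

Let bad_low : set T := [set w | e * tau < \sum_sigma rem sigma w].

Let tau_gt0 : 0 < tau. Proof. exact: expR_gt0. Qed.

Let bad_low_prob : fine (P bad_low) <= e.
Proof.
have [iS eS] := Rintegral_sum (index_enum (spins N)) xpredT irem.
have S0 w : 0 <= \sum_sigma rem sigma w by apply: sumr_ge0.
have mS : measurable_fun setT (fun w => \sum_sigma rem sigma w).
  exact: measurable_sum.
apply: (le_trans (markov_Rintegral S0 iS mS (mulr_gt0 e_gt0 tau_gt0))).
rewrite ler_pdivrMr ?mulr_gt0//; apply: le_trans low_small; rewrite eS.
rewrite -lee_fin -sumEFin.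
apply: le_trans (centred_energy_remainder_le X_gaussian b_gt0 K_bound m%:R b_beta).
apply: lee_sum => sigma _; rewrite /Rintegral fineK//.
exact: integrable_fin_num (irem sigma).
Qed.

Let mbad_low : measurable bad_low.
Proof. by apply: measurable_set_gt; exact: measurable_sum. Qed.

Let mE kappa : measurable (E kappa).
Proof. exact: measurable_counts_event. Qed.

Let E_disj kappa kappa' w : E kappa w -> E kappa' w -> kappa = kappa'.
Proof.
move=> h1 h2; apply/ffunP => j; apply/val_inj.
by have := h1 j; rewrite (h2 j) /as_counts !ffunE => /esym.
Qed.

(** Labels outside G, and counts beyond the cap, are excluded by comparing the
    total probability of G with that of the Poisson law rather than by a direct
    estimate. *)
Let seen : set T := \bigcup_(kappa : label) (if G kappa then E kappa else set0).

Let mseen : measurable seen.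
Proof.
apply: countable_bigcupT_measurable => [|kappa]; first exact: countableP.
by case: ifP.
Qed.

Let unseen_prob : fine (P (~` seen)) <= 7 * e.
Proof.
have seenE : fine (P seen) = \sum_(kappa | G kappa) fine (P (E kappa)).
  rewrite /seen probability_bigcup_fintype.
  - rewrite -sum_fine => [|kappa _]; last by rewrite fin_num_measure//; case: ifP.
    by rewrite [RHS]big_mkcond; apply: eq_bigr => kappa _; case: ifP; rewrite ?measure0.
  - by move=> kappa; case: ifP.
  - by move=> kappa kappa' w; case: ifP => // _; case: ifP => // _; exact: E_disj.
have -> : fine (P (~` seen)) = 1 - fine (P seen).
  have := probability_setC P mseen => ->.
  by rewrite -[P seen]fineK ?fin_num_measure.
have : \sum_(kappa | G kappa) Q kappa - e <= \sum_(kappa | G kappa) fine (P (E kappa)).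
  rewrite lerBlDr -lerBlDl -sumrB; apply: le_trans count_prob_sum.
  rewrite [leRHS](bigID G)/= -[leLHS]addr0; apply: lerD; last exact: sumr_ge0.
  by apply: ler_sum => kappa _; rewrite distrC ler_norm.
rewrite seenE; have := Q_mass.
move: (\sum_(_ | _) _) (\sum_(_ | _) _) => u v; lra.
Qed.

Let bad : set T := bad_top `|` (bad_low `|` ~` seen).

Let bad_prob : fine (P bad) <= 9 * e.
Proof.
have m1 := measurableU _ _ mbad_low (measurableC mseen).
have := fine_probability_setU P mbad_top m1.
have := fine_probability_setU P mbad_low (measurableC mseen).
have := bad_top_prob; have := bad_low_prob; have := unseen_prob.
by rewrite -/bad; lra.
Qed.

Let weights w := ordered_gibbs_weights (hamiltonian (fun sigma => X sigma w) h) beta.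

Let good_resolved w : ~ bad w -> exists kappa,
  [/\ G kappa, E kappa w & resolves n (fun j => expR (beta * grid R m p j)) e
     (cumulative n (extend_counts kappa)) (weights w)].
Proof.
move=> nbad.
have ntop : ~ bad_top w by move=> hb; apply: nbad; left.
have nlow : ~ bad_low w by move=> hb; apply: nbad; right; left.
have [kappa _] : seen w by apply: contrapT => hb; apply: nbad; right; right.
case: ifPn => // Gk Ek; exists kappa; split => //.
have cnt j (jn : (j < n)%N) : count (fun sigma => grid R m p j <= H sigma w < grid R m p j.+1)
    (enum {: spins N}) = extend_counts kappa j.
  rewrite (extend_countsE kappa jn).
  have := Ek (Ordinal jn); rewrite ffunE => <-; apply: eq_count => sigma.
  by apply/idP/asboolP; rewrite /cells /grid_cell/= in_itv.
have gnd j : (j < n)%N -> grid R m p j <= grid R m p j.+1 by move=> _; exact: grid_nd.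
have Hn sigma : H sigma w < grid R m p n by rewrite grid_top//; exact: bad_topP.
apply: (@ordered_gibbs_weights_resolved _ _ _ (fun sigma => H sigma w) a) => //.
- by move=> sigma; rewrite /H /centred_energy /hamiltonian /field_energy addrA.
set S := \sum_sigma expR (beta * H sigma w).
have tauS : tau <= S.
  move/existsP: Gk => -[j /andP[tj cj]].
  have [l' /andP[jl' l'n] kl'] : exists2 l', (j <= l' < n)%N & (0 < extend_counts kappa l')%N.
    have := cj; rewrite lt0n /cumulative sum_nat_seq_neq0 => /hasP[l' hl' kl'].
    exists l'; last by rewrite lt0n.
    by rewrite mem_index_iota in hl'.
  have : has (fun sigma => grid R m p l' <= H sigma w < grid R m p l'.+1)
      (enum {: spins N}) by rewrite has_count cnt.
  move=> /hasP[sigma _ /andP[hs _]]; apply: (le_trans tj).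
  apply: (@le_trans _ _ (expR (beta * H sigma w))).
    rewrite ler_expR ler_pM2l//; apply: le_trans hs; exact: grid_le.
  rewrite /S (bigD1 sigma)//= lerDl; apply: sumr_ge0 => s _; exact: expR_ge0.
apply: (@le_trans _ _ (\sum_sigma rem sigma w)).
  rewrite [leLHS]big_mkcond; apply: ler_sum => sigma _.
  case: ifPn => // hs; rewrite /rem indicE mem_setE in_itv/=.
  have -> : H sigma w <= - m%:R.
    by apply/ltW; apply: (lt_le_trans hs); rewrite /grid mul0r addr0.
  by rewrite mulr1.
apply: (@le_trans _ _ (e * tau)); first by rewrite leNgt; apply/negP.
by rewrite ler_wpM2l// ltW.
Qed.

(** The counts of the energies have almost the law Q, and resolve the weights off
    three bad events: an energy above the grid, too much weight below it, and
    counts outside G. The sum is the one of [poisson_side_by_counts]. *)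
Lemma array_side_by_counts :
  `|(\int[P]_w f (ordered_gibbs_weights (hamiltonian (fun sigma => X sigma w) h) beta))%R
    - \sum_(kappa | G kappa) f (rep kappa) * Q kappa| <= L * (8 * e) + 19 * B * e.
Proof.
have mw : random_element weights.
  apply: (measurable_ordered_weights
    (H := fun sigma w => hamiltonian (fun s => X s w) h sigma)).
  by move=> sigma; apply: measurable_funD => //; exact: measurable_funP.
have mesh' j : (j < n)%N -> expR (beta * grid R m p j.+1) <=
  (1 + e) * expR (beta * grid R m p j) by move=> _; exact: grid_mesh.
have q1 : 1 <= 1 + e by rewrite lerDl ltW.
have e01 : 0 <= e < 1 by apply/andP; split; move: e_gt0 e_le; lra.
have mbad : measurable bad.
  exact: (measurableU _ _ mbad_top (measurableU _ _ mbad_low (measurableC mseen))).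
have := @expectation_by_counts R n (fun j => expR (beta * grid R m p j)) (1 + e) e
    (fun j => expR_gt0 _) mesh' q1 e01 _
    (fun kappa : label => cumulative n (extend_counts kappa))
    (fun kappa => cumulative_top _ _) f L B L_ge0 fL fB d T P weights E G bad (9 * e)
    mw mE E_disj mbad bad_prob good_resolved.
rewrite -/rep => main.
have B0 : 0 <= B by exact: le_trans (fB (null_mass_partition R)).
set s := \sum_(kappa | G kappa) f (rep kappa) * fine (P (E kappa)) in main.
set t := \sum_(kappa | G kappa) f (rep kappa) * Q kappa.
have st : `|s - t| <= B * e.
  rewrite /s /t -sumrB; apply: (le_trans (ler_norm_sum _ _ _)).
  apply: (@le_trans _ _ (B * \sum_(kappa : label) `|fine (P (E kappa)) - Q kappa|)); last first.
    by rewrite ler_wpM2l.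
  rewrite mulr_sumr [leRHS](bigID G)/= -[leLHS]addr0; apply: lerD; last first.
    by apply: sumr_ge0 => kappa _; rewrite mulr_ge0.
  by apply: ler_sum => kappa _; rewrite -mulrBr normrM ler_wpM2r.
have e12 : 0 <= e <= 2^-1 by rewrite ltW.
have me := mesh_error e12.
set I := (\int[P]_w _)%R in main *.
have -> : I - t = (I - s) + (s - t) by ring.
apply: (le_trans (ler_normD _ _)).
apply: (le_trans (lerD main st)).
have : L * (e + ((1 + e) ^+ 2 / (1 - e) - 1)) <= L * (8 * e) by rewrite ler_wpM2l.
move: (L * _) (L * _) => u v uv; have := ltW e_gt0; nra.
Qed.

End array_side.

(** * Averaging over the field *)

Lemma exp_decay_le (R : realType) (c K e : R) : 0 < c -> 0 < e -> 0 <= K ->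
  exists m1, forall m, (m1 <= m)%N -> K * expR (- c * m%:R) <= e.
Proof.
move=> c0 e0 K0; exists (Num.bound (K / (c * e))) => m hm.
have ce : 0 < c * e by exact: mulr_gt0.
have : K / (c * e) <= m%:R.
  apply: (@le_trans _ _ (Num.bound (K / (c * e)))%:R); last by rewrite ler_nat.
  by apply/ltW/archi_boundP; rewrite divr_ge0// ltW.
rewrite ler_pdivrMr// mulNr expRN => h; rewrite ler_pdivrMr ?expR_gt0//.
apply: (le_trans h); rewrite mulrA mulrC ler_wpM2l ?(ltW e0)// mulrC.
by apply: le_trans (expR_ge1Dx _); rewrite lerDr.
Qed.

Lemma le_sqrtr_nat (R : realType) (D : R) :
  exists N1, forall N, (N1 <= N)%N -> D <= Num.sqrt N%:R.
Proof.
exists (Num.bound (D ^+ 2)) => N hN; apply: (le_trans (ler_norm D)).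
rewrite -sqrtr_sqr ler_sqrt//.
apply: (@le_trans _ _ (Num.bound (D ^+ 2))%:R); last by rewrite ler_nat.
by apply/ltW/archi_boundP; exact: sqr_ge0.
Qed.

Section good_fields.
Variables (R : realType) (d : measure_display) (T : measurableType d).
Variables (P : probability T R) (eta : nat -> {RV P >-> R}).
Variables (zeta : T -> mass_partition R) (C b beta : R).
Hypotheses (b_gt0 : 0 < b) (b_beta : b < beta) (C_gt0 : 0 < C)
  (eta_poisson : poisson_process eta (exp_intensity C b))
  (mzeta : random_element zeta)
  (zeta_rearranged : {ae P, forall w, decreasing_rearrangement
     (normalized_exp beta (fun i => eta i w)) (zeta w)})
  (zeta_proper : {ae P, forall w, proper (zeta w)}).
Variables (f : mass_partition R -> R) (L B : R).
Hypotheses (L_ge0 : 0 <= L)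
  (fL : forall p p', `|f p - f p'| <= L * mass_dist p p')
  (fB : forall p, `|f p| <= B).

(** The limit theorem with the field frozen, uniformly over the fields whose two
    statistics are of their typical order. *)
Lemma gibbs_weights_good_field (K e : R) : 0 <= K -> 0 < e -> e <= 2^-1 ->
  exists N0, forall d' (T' : measurableType d') (P' : probability T' R)
    (N : nat) (X : spins N -> {RV P' >-> R}) (h : nat -> R),
  (N0 <= N)%N -> (0 < N)%N ->
  mutually_independent P' (fun sigma => X sigma : T' -> R) ->
  (forall sigma A, measurable A ->
     distribution P' (X sigma) A = normal_prob 0 (Num.sqrt N%:R) A) ->
  `|\sum_(i < N) field_excess b (h i)| <= K * Num.sqrt N%:R ->
  \sum_(i < N) h i ^+ 2 <= K * N%:R ->
  `|(\int[P']_w f (ordered_gibbs_weights (hamiltonian (fun sigma => X sigma w) h) beta))%R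
    - (\int[P]_w f (zeta w))%R| <= (16 * L + 25 * B) * e.
Proof.
move=> K0 e0 e2.
have beta0 : 0 < beta by exact: lt_trans b_beta.
have bb0 : 0 < beta - b by rewrite subr_gt0.
have [N1 [K' [K'0 centre]]] := gibbs_intensity_centered b_gt0 C_gt0 K0.
have [l poisson] := poisson_side_by_counts beta0 eta_poisson mzeta zeta_rearranged
  zeta_proper L_ge0 fL fB e0 e2.
have [p p0 mesh] : exists2 p, (0 < p)%N & expR (beta / p%:R) <= 1 + e.
  have ln0 : 0 < ln (1 + e) / beta by rewrite divr_gt0// ln_gt0// ltrDl.
  have [k _ hk] := near_infty_natSinv_lt (PosNum ln0).
  exists k.+1 => //; have := hk k (leqnn k); rewrite /= ltr_pdivlMr// => h.
  rewrite -[leRHS]lnK ?posrE ?addr_gt0// ler_expR mulrC; exact: ltW.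
have tau0 : 0 < e * (e * expR (- (beta * l%:R))) by rewrite !mulr_gt0 ?expR_gt0.
have [m1 top] := exp_decay_le b_gt0 e0 (divr_ge0 K'0 (ltW b_gt0)).
have [m2 low] := exp_decay_le bb0 tau0 (divr_ge0 K'0 (ltW bb0)).
have [m [c [mm m0 []]]] := poisson p (maxn m1 m2) p0 mesh.
set S := (X in `|_ - X| <= _) => side mass.
move: mm; rewrite geq_max => /andP[/top {}top /low {}low].
have [D array] : exists D : R, forall d' (T' : measurableType d') (P' : probability T' R)
    (N : nat) (X : spins N -> {RV P' >-> R}) (h : nat -> R) (a : R),
  (0 < N)%N -> mutually_independent P' (fun sigma => X sigma : T' -> R) ->
  (forall sigma A, measurable A ->
     distribution P' (X sigma) A = normal_prob 0 (Num.sqrt N%:R) A) ->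
  (forall y, expR (b * y) * gibbs_intensity N h (a + y) <= K' /\
      `|expR (b * y) * gibbs_intensity N h (a + y) - C| <= K' * (`|y| / Num.sqrt N%:R)) ->
  D <= Num.sqrt N%:R ->
  `|(\int[P']_w f (ordered_gibbs_weights (hamiltonian (fun sigma => X sigma w) h) beta))%R
    - S| <= L * (8 * e) + 19 * B * e.
  eexists => d' T' P' N X h a N0 X_indep X_gaussian K_bound.
  exact: (array_side_by_counts b_gt0 C_gt0 K'0 b_beta e0 e2 p0 mesh top low mass
    L_ge0 fL fB N0 X_indep X_gaussian K_bound).
have [N2 large] := le_sqrtr_nat D.
exists (maxn N1 N2) => d' T' P' N X h; rewrite geq_max => /andP[hN1 /large hD] N0.
move=> X_indep X_gaussian h1 h2; have [a K_bound] := centre N h hN1 N0 h1 h2.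
have array' := array _ _ _ N X h a N0 X_indep X_gaussian K_bound hD.
rewrite -(subrK S (\int[P']_w _)%R) -addrA; apply: (le_trans (ler_normD _ _)).
rewrite distrC in side; apply: (le_trans (lerD array' side)).
by rewrite le_eqVlt; apply/orP; left; apply/eqP; ring.
Qed.

End good_fields.

Section generated.
Variables (d : measure_display) (T : measurableType d) (R : realType) (I : Type).
Variable (X : I -> T -> R).
Hypothesis mX : forall i, measurable_fun setT (X i).

(** Independence of the families is an independence of the sigma-algebras that
    they generate. Taking these as the sigma-algebras of two copies of T, the
    identity maps T to independent random elements. *)
Definition family_events : set (set T) :=
  \bigcup_i preimage_set_system setT (X i) measurable.

Definition family_space := g_sigma_algebraType family_events.

Lemma measurable_to_family_space :
  measurable_fun setT (id : T -> family_space).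
Proof.
apply: (@measurability _ _ T family_space _ _ family_events erefl).
move=> _ [A [i _ [C mC <-]] <-].
by rewrite setTI; exact: mX.
Qed.

Lemma measurable_family i : measurable_fun setT (X i : family_space -> R).
Proof.
move=> _ C mC; apply: sub_sigma_algebra; exists i => //.
by exists C.
Qed.

End generated.

Section annealing.
Variables (R : realType) (d : measure_display) (T : measurableType d)
    (P : probability T R)
    (X : forall N : nat, spins N -> {RV P >-> R}) (h : nat -> {RV P >-> R})
    (b beta : R)
    (d' : measure_display) (T' : measurableType d') (P' : probability T' R)
    (eta : nat -> {RV P' >-> R}) (zeta : T' -> mass_partition R) (C : R).
Arguments X : clear implicits.
Hypotheses (X_indep : forall N : nat, (0 < N)%N ->
      mutually_independent P (fun sigma => X N sigma : T -> R))
    (X_gaussian : forall (N : nat) (sigma : spins N) (A : set R), (0 < N)%N ->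
      measurable A ->
      distribution P (X N sigma) A = normal_prob 0 (Num.sqrt N%:R) A)
    (h_indep : mutually_independent P (fun i => h i : T -> R))
    (h_ident : forall (i : nat) (A : set R), measurable A ->
      distribution P (h i) A = distribution P (h 0%N) A)
    (h_exp_moments : forall t : R,
      ('E_P[(fun w => expR (t * h 0%N w))%R] < +oo)%E)
    (X_h_indep : forall N : nat, (0 < N)%N ->
      independent_families P (fun sigma => X N sigma : T -> R)
        (fun i => h i : T -> R))
    (bE : is_critical_beta P (h 0%N) b)
    (b_beta : b < beta)
    (C_gt0 : 0 < C)
    (eta_poisson : poisson_process eta (exp_intensity C b))
    (mzeta : random_element zeta)
    (zeta_rearranged : {ae P', forall w, decreasing_rearrangement
       (normalized_exp beta (fun i => eta i w)) (zeta w)})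
    (zeta_proper : {ae P', forall w, proper (zeta w)}).
Variables (f : mass_partition R -> R) (L B : R).
Hypotheses (L_ge0 : 0 <= L)
  (fL : forall p p', `|f p - f p'| <= L * mass_dist p p')
  (fB : forall p, `|f p| <= B).

Let weights N (x : spins N -> R) (y : nat -> R) :=
  ordered_gibbs_weights (hamiltonian x y) beta.

Let mX N sigma : measurable_fun setT (X N sigma : T -> R).
Proof. exact: measurable_funP. Qed.

Let mh i : measurable_fun setT (h i : T -> R).
Proof. exact: measurable_funP. Qed.

(** The energies at w and the field at w' may be sampled separately. *)
Let quenched N : (0 < N)%N ->
  measurable_fun setT
    (fun w' => (\int[P]_w f (weights (fun s => X N s w) (fun i => h i w')))%R) /\
  (\int[P]_w f (weights (fun s => X N s w) (fun i => h i w)))%R =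
  (\int[P]_w' (\int[P]_w f (weights (fun s => X N s w) (fun i => h i w'))))%R.
Proof.
move=> N0.
pose SX := family_space (fun sigma => X N sigma : T -> R).
pose Sh := family_space (fun i => h i : T -> R).
have mU : measurable_fun setT (id : T -> SX) by exact: measurable_to_family_space.
have mV : measurable_fun setT (id : T -> Sh) by exact: measurable_to_family_space.
have indep (A : set SX) (A' : set Sh) : measurable A -> measurable A' ->
    P (id @^-1` A `&` id @^-1` A') = (P (id @^-1` A) * P (id @^-1` A'))%E.
  by move=> mA mA'; exact: (X_h_indep N0 mA mA').
pose F (z : SX * Sh) : R := f (weights (fun s => X N s z.1) (fun i => h i z.2)).
have mF : measurable_fun setT F.
  apply: continuous_random_element (lipschitz_continuous_mass fL).
  apply: (measurable_ordered_weights (H := fun sigma (z : SX * Sh) =>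
    hamiltonian (fun s => X N s z.1) (fun i => h i z.2) sigma)) => sigma.
  apply: measurable_funD.
    apply: (@measurableT_comp _ _ _ _ _ _ (X N sigma : SX -> R)) measurable_fst.
    exact: measurable_family.
  apply: measurable_sum => i; apply: measurable_funM => //.
  apply: (@measurableT_comp _ _ _ _ _ _ (h i : Sh -> R)) measurable_snd.
  exact: measurable_family.
have [mg e] := independent_fubini mU mV indep mF (fun z => fB _).
split; last exact: e.
exact: (measurableT_comp mg mV).
Qed.

(** By independence the expectation is the average over the field of the
    expectation in a frozen field; bad fields have probability at most
    2 * c / K. *)
Lemma annealed_cvg :
  (\int[P]_w f (weights (fun s => X n s w) (fun i => h i w)))%R @[n --> \oo] -->
  (\int[P']_w f (zeta w))%R.
Proof.
have B0 : 0 <= B by exact: le_trans (fB (null_mass_partition R)).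
have b0 := critical_beta_gt0 bE.
have [c [c0 fluct]] := field_fluctuations h_indep h_ident h_exp_moments bE.
apply/cvgrPdist_le => eps eps0.
(* 16 L + 25 B for a frozen good field, 4 B = 2 * 2 B for the two ways in which
   a field can be bad, 1 to make M positive *)
pose M := 16 * L + 25 * B + 4 * B + 1.
have M0 : 0 < M by rewrite /M ltr_wpDl// !addr_ge0// mulr_ge0.
pose e := Order.min (2^-1) (eps / M).
have e0 : 0 < e by rewrite lt_min invr_gt0 ltr0n/= divr_gt0.
have e2 : e <= 2^-1 by rewrite ge_min lexx.
have eM : e * M <= eps by rewrite -ler_pdivlMr// ge_min lexx orbT.
pose K := 1 + c / e.
have K1 : 1 <= K by rewrite lerDl divr_ge0// ltW.
have K0 : 0 < K by exact: lt_le_trans K1.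
have cK : c / K <= e.
  rewrite ler_pdivrMr// /K mulrDr mulr1 mulrCA divff ?gt_eqF// mulr1.
  by rewrite lerDr ltW.
have [N0 good] := gibbs_weights_good_field b0 b_beta C_gt0 eta_poisson mzeta
  zeta_rearranged zeta_proper L_ge0 fL fB (ltW K0) e0 e2.
exists (maxn N0 1) => // N /=; rewrite geq_max => /andP[hN N_gt0].
have [mg ->] := quenched N_gt0.
set I := (\int[P']_w _)%R.
have [p1 p2] := fluct N K N_gt0 K1.
set bad1 := [set w | _] in p1; set bad2 := [set w | _] in p2.
have mbad1 : measurable bad1.
  apply: measurable_set_gt; apply: measurableT_comp => //; apply: measurable_sum => i.
  exact: (measurableT_comp (@measurable_field_excess R b)).
have mbad2 : measurable bad2.
  by apply: measurable_set_gt; apply: measurable_sum => i; exact: measurable_funX.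
rewrite distrC; apply: le_trans eM.
have bnd d1 (T1 : measurableType d1) (P1 : probability T1 R) (Y : T1 -> mass_partition R) :
    random_element Y -> `|(\int[P1]_w f (Y w))%R| <= B.
  move=> mY; apply: normr_Rintegral_le => [|w]; last exact: fB.
  exact: continuous_random_element mY (lipschitz_continuous_mass fL).
pose g w' := (\int[P]_w f (weights (fun s => X N s w) (fun i => h i w')))%R.
have mgI : measurable_fun setT (fun w => g w - I) by exact: measurable_funB.
have gB w : `|g w| <= B.
  apply: bnd; apply: measurable_ordered_weights => sigma.
  by apply: measurable_funD.
have ig := measurable_integrable_bounded P mg gB.
have iI := @measurable_integrable_bounded _ _ _ P (cst I) `|I| (measurable_cst _)
  (fun _ => lexx _).
rewrite -[X in _ - X](Rintegral_cst_probability P) -(RintegralB measurableT ig iI).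
have close := @Rintegral_le_off_bad _ _ _ P _ (2 * B) ((16 * L + 25 * B) * e) _ mgI
  (measurableU _ _ mbad1 mbad2).
apply: (le_trans (close _ _ _)).
- by rewrite mulr_ge0 ?(ltW e0)// addr_ge0// mulr_ge0.
- by move=> w; rewrite (le_trans (ler_normB _ _))// mulr_natl mulr2n lerD ?gB ?bnd//.
- move=> w nbad; apply: good => //.
  + exact: X_indep.
  + by move=> sigma A mA; exact: X_gaussian.
  + by rewrite leNgt; apply/negP => hb; apply: nbad; left.
  + by rewrite leNgt; apply/negP => hb; apply: nbad; right.
have ue : fine (P (bad1 `|` bad2)) <= e + e.
  apply: (le_trans (fine_probability_setU P mbad1 mbad2)).
  by apply: lerD; [exact: le_trans p1 cK|exact: le_trans p2 cK].
apply: (@le_trans _ _ ((16 * L + 25 * B) * e + 2 * B * (e + e))).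
  by rewrite lerD2l ler_wpM2l// mulr_ge0.
rewrite (_ : _ + _ = e * (M - 1)); last by rewrite /M; ring.
by rewrite ler_pM2l// gerDl.
Qed.

End annealing.

Theorem theorem3 (R : realType) (d : measure_display) (T : measurableType d)
    (P : probability T R)
    (X : forall N : nat, spins N -> {RV P >-> R}) (h : nat -> {RV P >-> R})
    (beta_c beta : R)
    (d' : measure_display) (T' : measurableType d') (P' : probability T' R)
    (xi : T' -> mass_partition R)
    (X_indep : forall N : nat, (0 < N)%N ->
      mutually_independent P (fun sigma => X N sigma : T -> R))
    (X_gaussian : forall (N : nat) (sigma : spins N) (A : set R), (0 < N)%N ->
      measurable A ->
      distribution P (X N sigma) A = normal_prob 0 (Num.sqrt N%:R) A)
    (h_indep : mutually_independent P (fun i => h i : T -> R))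
    (h_ident : forall (i : nat) (A : set R), measurable A ->
      distribution P (h i) A = distribution P (h 0%N) A)
    (h_exp_moments : forall t : R,
      ('E_P[(fun w => expR (t * h 0%N w))%R] < +oo)%E)
    (X_h_indep : forall N : nat, (0 < N)%N ->
      independent_families P (fun sigma => X N sigma : T -> R)
        (fun i => h i : T -> R))
    (beta_cE : is_critical_beta P (h 0%N) beta_c)
    (beta_gt : beta_c < beta)
    (xi_PD : is_poisson_dirichlet beta_c beta P' xi) :
  converges_in_law P
    (fun N w => ordered_gibbs_weights
      (hamiltonian (fun sigma => X N sigma w) (fun i => h i w)) beta)
    P' xi.
Proof.
have [mxi xi_ae [C [d2 [T2 [P2 [eta [zeta [C0 eta_poisson mzeta zeta_re law]]]]]]]] :=
  xi_PD.
apply: lipschitz_converges_in_law => // [n|f K B fK fB].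
  apply: (measurable_ordered_weights (H := fun sigma w =>
    hamiltonian (fun s => X n s w) (fun i => h i w) sigma)) => sigma.
  apply: measurable_funD; first exact: measurable_funP.
  by apply: measurable_sum => i; apply: measurable_funM => //; exact: measurable_funP.
have zeta_proper : {ae P2, forall w, proper (zeta w)}.
  apply: (same_law_ae mxi mzeta law (@measurable_proper R)).
  by apply: filterS xi_ae => w [_ h1 h2].
have fL p q : `|f p - f q| <= `|K| * mass_dist p q.
  apply: (le_trans (fK p q)); rewrite ler_wpM2r ?ler_norm// -mdist_massE.
  exact: mdist_ge0.
rewrite (same_law_Rintegral mxi mzeta law (lipschitz_continuous_mass fL) fB).
exact: (annealed_cvg X_indep X_gaussian h_indep h_ident h_exp_moments X_h_indep
  beta_cE beta_gt C0 eta_poisson mzeta zeta_re zeta_proper (normr_ge0 K) fL fB).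
Qed.
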